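(* Let $\vec G$ be an ordered digraph on edge set $E$ with underlying graph $G$, and let $\omega=\max(E)$. The images $\alpha_{\vec G}(A)$, $A\subseteq E$, satisfy (and are computed by) the following inductive rules, with $\alpha_{\vec G}(\emptyset)=\emptyset$ if $E=\emptyset$. (Refined isthmus/loop case) If $\omega$ is an isthmus of $G$ then, for all $A\subseteq E$, $\alpha_{\vec G}(A\cup\{\omega\})=\alpha_{\vec G\backslash\omega}(A\setminus\{\omega\})$ and $\alpha_{\vec G}(A\setminus\{\omega\})=\alpha_{\vec G/\omega}(A\setminus\{\omega\})\cup\{\omega\}$. If $\omega$ is a loop of $G$ then, for all $A\subseteq E$, $\alpha_{\vec G}(A\cup\{\omega\})=\alpha_{\vec G\backslash\omega}(A\setminus\{\omega\})\cup\{\omega\}$ and $\alpha_{\vec G}(A\setminus\{\omega\})=\alpha_{\vec G/\omega}(A\setminus\{\omega\})$. Otherwise, for $A\subseteq E$, put $\vec H=-_A\vec G$ and define $\vec H_0\in\{\vec H/\omega,\vec H\backslash\omega\}$ as follows. (Choice by activity comparison) If $\vec H/\omega$ and $\vec H\backslash\omega$ do not have the same active partition, then $\vec H_0$ is the unique one of them whose active partition is obtained by removing $\omega$ from the active partition of $\vec H$. (Choice by full optimality) If they have the same active partition, let $\vec H_\omega$ be the active minor of $\vec H$ containing $\omega$, with edge set $E_\omega$ and underlying graph $H_\omega$. Let $T'=\alpha(\vec H_\omega\backslash\omega)=\alpha(\vec H\backslash\omega)\cap E_\omega$, $C=C_{H_\omega}(T';\omega)$, $e=\min(C)$; if $e$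 and $\omega$ have opposite directions in $C$ then $\vec H_0=\vec H\backslash\omega$, and if they have the same directions in $C$ then $\vec H_0=\vec H/\omega$. Or equivalently: let $T''=\alpha(\vec H_\omega/\omega)=\alpha(\vec H/\omega)\cap E_\omega$, $D=C^*_{H_\omega}(T''\cup\{\omega\};\omega)$, $e=\min(D)$; if $e$ and $\omega$ have opposite directions in $D$ then $\vec H_0=\vec H/\omega$, and if they have the same directions in $D$ then $\vec H_0=\vec H\backslash\omega$. (Refined assignment) If $\vec H_0=-_A\vec G\backslash\omega$ then $\alpha_{\vec G}(A)=\alpha_{\vec G\backslash\omega}(A\setminus\{\omega\})$ and $\alpha_{\vec G}(A\triangle\{\omega\})=\alpha_{\vec G/\omega}(A\setminus\{\omega\})\cup\{\omega\}$. If $\vec H_0=-_A\vec G/\omega$ then $\alpha_{\vec G}(A)=\alpha_{\vec G/\omega}(A\setminus\{\omega\})\cup\{\omega\}$ and $\alpha_{\vec G}(A\triangle\{\omega\})=\alpha_{\vec G\backslash\omega}(A\setminus\{\omega\})$.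
   Context: Graphs are finite, may have loops and multiple edges, and are connected unless they arise as minors (isolated vertices are ignored, and for a disconnected graph ''spanning tree'' means maximal spanning forest). For $F\subseteq E$, $G(F)$ is the restriction of $G$ to $F$ (deletion of $E\setminus F$) and $G/F$ is the contraction of $F$; $G\backslash\omega$, $G/\omega$ are deletion and contraction of the edge $\omega$; similarly for digraphs. Cycles and cocycles (inclusion-minimal non-empty edge cuts) are edge subsets. Minors inherit the linear order. $-_A\vec G$ is obtained by reversing the edges in $A$. A cycle is directed if its edges are consistently oriented along it; a cocycle is directed if all its edges go from one side of the cut to the other. $\subset$ is strict inclusion, $\uplus$ disjoint union, $\triangle$ symmetric difference. For an ordered digraph $\vec H$ on $E$, $O^*(\vec H)=\{a_1<\cdots<a_\iota\}$ (dual-active edges) is the set of smallest edges of directed cocycles, $O(\vec H)=\{a'_1<\cdots<a'_\varepsilon\}$ (active edges) the set of smallest edges of directed cycles. The active filtration of $\vec H$ is $\emptyset=F'_\varepsilon\subset\cdots\subset F'_0=F_c=F_0\subset\cdots\subset F_\iota=E$, where $F_c$ is the union of all directed cycles, $F_k=E\setminus\bigcup\{D\text{ directed cocycle}:\min(D)\ge a_{k+1}\}$ for $0\le k\le\iota-1$, $F'_k=\bigcup\{C\text{ directed cycle}:\min(C)\ge a'_{k+1}\}$ for $0\le k\le\varepsilon-1$. The active partition has parts $F_k\setminus F_{k-1}$ ($1\le k\le\iota$) and $F'_{k-1}\setminus F'_k$ ($1\le k\le\varepsilon$), always considered as given together with the cyclic flat $F_c$ (so equality of active partitions includes equality of cyclic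 flats). The active minors are $\vec H(F_k)/F_{k-1}$ ($1\le k\le\iota$) and $\vec H(F'_{k-1})/F'_k$ ($1\le k\le\varepsilon$). Removing $\omega$ from an active partition means removing it from its part (and from the cyclic flat if it belongs to it). $\vec H$ is bipolar w.r.t. $p$ if every edge is in a directed cocycle and every directed cocycle contains $p$; cyclic-bipolar w.r.t. $p$ if every edge is in a directed cycle and every directed cycle contains $p$. For a spanning tree $T$ of the underlying graph $H$, $C^*_H(T;b)$ ($b\in T$) is the unique cocycle contained in $(E\setminus T)\cup\{b\}$ and $C_H(T;e)$ ($e\notin T$) the unique cycle contained in $T\cup\{e\}$. Two edges of a cycle have the same (opposite) directions in it if they are oriented the same way (opposite ways) along it; two edges of a cocycle have the same (opposite) directions in it if they cross the cut in the same (opposite) way. Active spanning tree $\alpha(\vec H)$. If $\vec H$ is bipolar w.r.t. $p=\min(E)$, $\alpha(\vec H)$ is the unique spanning tree $T$ (existence and uniqueness is a known theorem) such that every $b\in T\setminus\{p\}$ and $\min C^*_H(T;b)$ have opposite directions in $C^*_H(T;b)$, and every $e\in E\setminus T$ and $\min C_H(T;e)$ have opposite directions in $C_H(T;e)$. If $\vec H$ is cyclic-bipolar w.r.t. $p=\min(E)$, the definition is the same with ''every $b\in T$'' and ''every $e\in(E\setminus T)\setminus\{p\}$''. In general, $\alpha(\vec H)=\biguplus_{1\le k\le\iota}\alpha(\vec H(F_k)/F_{k-1})\uplus\biguplus_{1\le k\le\varepsilon}\alpha(\vec H(F'_{k-1})/F'_k)$ with the active filtration of $\vec H$ (these minors are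 bipolar, resp. cyclic-bipolar, w.r.t. their smallest edge); $\alpha=\emptyset$ on the empty edge set. The refined active bijection w.r.t. $\vec G$ is, for $A\subseteq E$: $\alpha_{\vec G}(A)=\bigl(\alpha(-_A\vec G)\setminus(A\cap O^*(-_A\vec G))\bigr)\cup\bigl(A\cap O(-_A\vec G)\bigr)$. *)

(* Defs.v *)
(* Graphs are encoded over a fixed vertex type V and a fixed, linearly
   ordered, ambient edge type E, so that a graph and all its minors live in the
   same type and minors inherit the linear order. *)
From mathcomp Require Import all_boot all_order.

Set Implicit Arguments.
Unset Strict Implicit.
Unset Printing Implicit Defensive.

(* Only src and tgt of elements of edges matter.  Loops, multiple edges,
   disconnected graphs and isolated vertices are allowed; contraction leaves
   isolated vertices behind (see contract), and no notion below sees them. *)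
Record digraph (V : finType) (d : Order.disp_t) (E : finOrderType d) := Digraph {
  edges : {set E};
  src : E -> V;
  tgt : E -> V
}.

Section Digraphs.

Context (V : finType) (d : Order.disp_t) (E : finOrderType d).
Implicit Types (G H M : digraph V E) (A B C D F T : {set E}) (X : {set V}).
Implicit Types (a b e f p w : E) (c : seq (E * bool)).

Definition restrict G F : digraph V E :=
  Digraph (edges G :&: F) (src G) (tgt G).

Definition reorient A G : digraph V E :=
  Digraph (edges G)
    (fun e => if e \in A then tgt G e else src G e)
    (fun e => if e \in A then src G e else tgt G e).

Definition adjacent G : rel V :=
  [rel x y | [exists e in edges G,
     ((src G e == x) && (tgt G e == y)) || ((src G e == y) && (tgt G e == x))]].

(* Every vertex is sent to a canonical representative of its connected
   component in G(F). *)
Definition contract G F : digraph V E :=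
  let r := root (adjacent (restrict G F)) in
  Digraph (edges G :\: F) (fun e => r (src G e)) (fun e => r (tgt G e)).

Inductive minor_op := Deletion | Contraction.

Definition minor (op : minor_op) G w : digraph V E :=
  match op with
  | Deletion => restrict G [set~ w]
  | Contraction => contract G [set w]
  end.

Definition symdiff A B : {set E} := (A :\: B) :|: (B :\: A).

(* The smallest element of A, for e0 \in A. *)
Definition emin e0 A : E := [arg min_(e < e0 in A) e]%O.

Definition is_min A e : bool := (e \in A) && [forall f in A, (e <= f)%O].
Definition is_max A e : bool := (e \in A) && [forall f in A, (f <= e)%O].

(* A step (e, true) traverses e forwards and (e, false) traverses it backwards. *)
Definition step_src G (s : E * bool) : V := if s.2 then src G s.1 else tgt G s.1.
Definition step_tgt G (s : E * bool) : V := if s.2 then tgt G s.1 else src G s.1.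

(* Requiring distinct edges excludes going forth and back along one edge. *)
Definition cycle_walk G c : bool :=
  [&& c != [::], all (fun s => s.1 \in edges G) c,
      path.cycle (fun s t => step_tgt G s == step_src G t) c,
      uniq (map (step_src G) c) & uniq (unzip1 c)].

(* The length bound is harmless since the edges of the walk are distinct. *)
Definition has_walk G C (P : pred (seq (E * bool))) : bool :=
  [exists c : {bseq #|E| of E * bool},
     [&& cycle_walk G c, [set e in unzip1 c] == C & P c]].

Definition is_cycle G C : bool := has_walk G C predT.

Definition is_directed_cycle G C : bool := has_walk G C (all snd).

(* The walk along a given cycle is unique up to rotation and reversal, so two
   edges of a cycle have exactly one of the next two relations. *)
Definition same_in_cycle G C e f : bool :=
  has_walk G C (fun c => [exists s, ((e, s) \in c) && ((f, s) \in c)]).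

Definition opposite_in_cycle G C e f : bool :=
  has_walk G C (fun c => [exists s, ((e, s) \in c) && ((f, ~~ s) \in c)]).

Definition cut G X : {set E} :=
  [set e in edges G | (src G e \in X) != (tgt G e \in X)].

Definition is_cocycle G D : bool :=
  minset (fun B => (B != set0) && [exists X, B == cut G X]) D.

Definition is_directed_cocycle G D : bool :=
  is_cocycle G D &&
  [exists X, (D == cut G X) && [forall e in D, src G e \in X]].

(* For an edge e of cut G X, src G e \in X tells in which way e crosses. *)
Definition same_in_cocycle G D e f : bool :=
  [&& e \in D, f \in D &
      [exists X, (D == cut G X) && ((src G e \in X) == (src G f \in X))]].

Definition opposite_in_cocycle G D e f : bool :=
  [&& e \in D, f \in D &
      [exists X, (D == cut G X) && ((src G e \in X) != (src G f \in X))]].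

Definition is_isthmus G w : bool := is_cocycle G [set w].
Definition is_loop G w : bool := (w \in edges G) && (src G w == tgt G w).

(* Maximal spanning forest; a spanning tree when G is connected. *)
Definition spanning_tree G T : bool :=
  maxset (fun F => (F \subset edges G)
                   && [forall C, is_cycle G C ==> ~~ (C \subset F)]) T.

(* When T is a spanning tree of G (and e \in edges G :\: T, resp. b \in T)
   exactly one C, resp. D, can be picked. *)
Definition fund_cycle G T e : {set E} :=
  odflt set0 [pick C | is_cycle G C && (C \subset e |: T)].

Definition fund_cocycle G T b : {set E} :=
  odflt set0 [pick D | is_cocycle G D && (D \subset b |: (edges G :\: T))].

Definition dual_active H : {set E} :=
  [set a | [exists D, is_directed_cocycle H D && is_min D a]].

Definition active H : {set E} :=
  [set a | [exists C, is_directed_cycle H C && is_min C a]].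

(* a_1 < ... < a_iota and a'_1 < ... < a'_epsilon. *)
Definition dual_active_seq H : seq E := sort <=%O (enum (dual_active H)).
Definition active_seq H : seq E := sort <=%O (enum (active H)).

Definition cyclic_flat H : {set E} :=
  \bigcup_(C : {set E} | is_directed_cycle H C) C.

(* F_k and F'_k; sequences are numbered from 0, so the element of index k in
   the lists of active edges is a_{k+1}, resp. a'_{k+1}. *)
Definition dual_filtration H (k : nat) : {set E} :=
  if onth (dual_active_seq H) k is Some a then
    edges H :\: \bigcup_(D | is_directed_cocycle H D && (a <= emin a D)%O) D
  else edges H.

Definition cyclic_filtration H (k : nat) : {set E} :=
  if onth (active_seq H) k is Some a then
    \bigcup_(C | is_directed_cycle H C && (a <= emin a C)%O) C
  else set0.

Definition active_parts H : seq {set E} :=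
  mkseq (fun k => dual_filtration H k.+1 :\: dual_filtration H k)
        (size (dual_active_seq H))
  ++ mkseq (fun k => cyclic_filtration H k :\: cyclic_filtration H k.+1)
           (size (active_seq H)).

Definition active_minors H : seq (digraph V E) :=
  mkseq (fun k => contract (restrict H (dual_filtration H k.+1))
                           (dual_filtration H k))
        (size (dual_active_seq H))
  ++ mkseq (fun k => contract (restrict H (cyclic_filtration H k))
                              (cyclic_filtration H k.+1))
           (size (active_seq H)).

(* The active partition is given together with the cyclic flat. *)
Definition active_partition H : {set {set E}} * {set E} :=
  ([set P in active_parts H], cyclic_flat H).

Definition remove_edge w (pi : {set {set E}} * {set E}) : {set {set E}} * {set E} :=
  ([set P :\ w | P : {set E} in pi.1], pi.2 :\ w).

(* The active minor containing w, for w \in edges H. *)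
Definition active_minor_at H w : digraph V E :=
  head H [seq M <- active_minors H | w \in edges M].

Definition bipolar H p : bool :=
  [forall e in edges H, exists D : {set E}, is_directed_cocycle H D && (e \in D)]
  && [forall D, is_directed_cocycle H D ==> (p \in D)].

Definition cyclic_bipolar H p : bool :=
  [forall e in edges H, exists C : {set E}, is_directed_cycle H C && (e \in C)]
  && [forall C, is_directed_cycle H C ==> (p \in C)].

Definition fully_optimal H (B F : {set E}) T : bool :=
  [&& spanning_tree H T,
      [forall b in B, let D := fund_cocycle H T b in
                      opposite_in_cocycle H D b (emin b D)] &
      [forall e in F, let C := fund_cycle H T e in
                      opposite_in_cycle H C e (emin e C)]].

(* alpha for digraphs that are bipolar or cyclic-bipolar with respect to their
   smallest edge p; the tree picked is unique. *)
Definition alpha_base H : {set E} :=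
  odflt set0 [pick T | [exists p, is_min (edges H) p &&
    (bipolar H p && fully_optimal H (T :\ p) (edges H :\: T) T
     || cyclic_bipolar H p && fully_optimal H T ((edges H :\: T) :\ p) T)]].

(* A (cyclic-)bipolar digraph is its own single active minor. *)
Definition alpha H : {set E} := \bigcup_(M <- active_minors H) alpha_base M.

Definition alpha_ref G A : {set E} :=
  (alpha (reorient A G) :\: (A :&: dual_active (reorient A G)))
  :|: (A :&: active (reorient A G)).

(* The two equivalent forms of the choice by full optimality. *)
Inductive criterion := ByCycle | ByCocycle.

(* In all that follows, act H stands for alpha H. *)
Definition optimality_choice (cr : criterion) (act : digraph V E -> {set E})
    M w (op : minor_op) : bool :=
  match cr with
  | ByCycle =>
      let C := fund_cycle M (act (minor Deletion M w)) w in
      let e := emin w C in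
      match op with
      | Deletion => opposite_in_cycle M C e w
      | Contraction => same_in_cycle M C e w
      end
  | ByCocycle =>
      let D := fund_cocycle M (w |: act (minor Contraction M w)) w in
      let e := emin w D in
      match op with
      | Contraction => opposite_in_cocycle M D e w
      | Deletion => same_in_cocycle M D e w
      end
  end.

Definition same_minor_partition H w : bool :=
  active_partition (minor Contraction H w) == active_partition (minor Deletion H w).

(* H0_choice cr act H w op: the digraph H_0 is minor op H w. *)
Definition H0_choice (cr : criterion) (act : digraph V E -> {set E})
    H w (op : minor_op) : bool :=
  if same_minor_partition H w then
    optimality_choice cr act (active_minor_at H w) w op
  else active_partition (minor op H w) == remove_edge w (active_partition H).

Definition refined_assignment (ref : digraph V E -> {set E} -> {set E})
    G w A (op : minor_op) : Prop :=
  match op with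
  | Deletion =>
      ref G A = ref (minor Deletion G w) (A :\ w) /\
      ref G (symdiff A [set w]) = w |: ref (minor Contraction G w) (A :\ w)
  | Contraction =>
      ref G A = w |: ref (minor Contraction G w) (A :\ w) /\
      ref G (symdiff A [set w]) = ref (minor Deletion G w) (A :\ w)
  end.

(* The inductive rules, as conditions on a map ref, at the digraph G. *)
Definition inductive_rules (cr : criterion) (act : digraph V E -> {set E})
    (ref : digraph V E -> {set E} -> {set E}) G : Prop :=
  (edges G = set0 -> ref G set0 = set0) /\
  forall w, is_max (edges G) w -> forall A, A \subset edges G ->
    [/\ is_isthmus G w ->
          ref G (w |: A) = ref (minor Deletion G w) (A :\ w) /\
          ref G (A :\ w) = w |: ref (minor Contraction G w) (A :\ w),
        is_loop G w ->
          ref G (w |: A) = w |: ref (minor Deletion G w) (A :\ w) /\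
          ref G (A :\ w) = ref (minor Contraction G w) (A :\ w) &
        ~~ is_isthmus G w -> ~~ is_loop G w ->
          forall op, H0_choice cr act (reorient A G) w op ->
                     refined_assignment ref G w A op].

(* What the choice of H_0 takes for granted: H_0 exists and is unique, both
   criteria agree, and T', T'' are as claimed, so that the fundamental cycle
   and cocycle that are used exist. *)
Definition well_defined_choice H w : Prop :=
  [/\ forall cr, exists! op, H0_choice cr alpha H w op,
      forall op, H0_choice ByCycle alpha H w op
                 = H0_choice ByCocycle alpha H w op &
      same_minor_partition H w ->
        let M := active_minor_at H w in
        let T' := alpha (minor Deletion M w) in
        let T'' := alpha (minor Contraction M w) in
        [/\ w \in edges M,
            T' = alpha (minor Deletion H w) :&: edges M,
            T'' = alpha (minor Contraction H w) :&: edges M,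
            spanning_tree M T' /\ w \notin T' &
            spanning_tree M (w |: T'') /\ w \notin T'']].

End Digraphs.

(* Main.v *)
Require Import Defs.
From mathcomp Require Import all_boot all_order all_algebra.
From mathcomp Require Import boolp.
From mathcomp Require Import ring lra zify.

(** Why the theorem is true.

    The flows and the tensions of a digraph, taken with rational values, are two
    orthogonal spaces of vectors indexed by the edges, and all the notions involved can
    be read off from the signs of these vectors.  A pair of such spaces is an [omat].
    In an [omat] cycles and cocycles play symmetric roles, minors and reorientations are
    given by simple formulas, and every statement on cycles yields its dual.  All
    existence results rest on the painting property of Minty, a field of the structure
    that holds for digraphs by a search for reachable vertices ([minty]).

    Fully optimal trees.  Give every edge a weight, each one much larger than the next
    in the order.  A tree T that is fully optimal with respect to the smallest edge p
    yields a tension equal to the weights on T and larger off T, and a flow equal to the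
    weights off T and larger on T, both except possibly at p ([FO_coc], [FO_cyc]).  These
    vectors are strictly complementary optimal solutions of dual linear programs that are
    the same for all trees, so T is unique ([FO_uniq]); their positivity shows that the
    digraph is bipolar or cyclic-bipolar ([FO_cbip]).  Existence ([FO_exists]) is by induction on
    the number of edges: a tree that is fully optimal in a minor at the greatest edge w
    gives one of M or of M with w reversed, and uniqueness excludes that both trees,
    coming from the deletion and from the contraction, serve the same one of the two.

    Active partitions.  Let [lvl M n] be the union of the supports of the nonnegative
    flows on the edges of rank at least n.  The parts of the active partition are the
    differences of successive levels of M and of its dual, and the active minors are the
    corresponding minors [part M n].  The active spanning tree is the unique set that
    meets every part in the fully optimal tree of the active minor there
    ([alpha_active_basis], [active_basis_uniq]).

    The choice.  Let w be the greatest edge, neither an isthmus nor a loop, and let T be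
    the active spanning tree.  If w is not in T, then the active minor at w keeps a fully
    optimal tree when w is deleted, hence it remains bipolar or cyclic-bipolar, and this
    forces the active partition of the deletion of w to be that of M without w
    ([levels_del], [levels_con]); all active minors are then preserved and T is the
    active spanning tree of the deletion.  The dual holds when w is in T.  So the minor
    H_0 is the deletion exactly when w is not in T ([H0_choiceP]): if the two minors have
    different active partitions only one of them can agree with M, and otherwise the sign
    of the smallest edge in the fundamental cycle or cocycle of w tells whether the tree
    of the minor is optimal in the active minor.  Reversing w exchanges the two cases
    ([active_basis_flip]): otherwise M and its reorientation would have the same levels
    and the same active spanning tree, and the fundamental cycle or cocycle of w would
    have the wrong sign in one of them.  The refined rules follow, because the active and
    dual-active edges other than w depend on the levels only ([alpha_ref_off]), and they
    determine the map by induction on the number of edges ([inductive_rules_uniq]). *)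

Set Implicit Arguments.
Unset Strict Implicit.
Unset Printing Implicit Defensive.

Import Order.TTheory GRing.Theory Num.Theory.
Local Open Scope ring_scope.

(** * Pairs of orthogonal spaces with the painting property *)

Section OrientedMatroids.

Context (d : Order.disp_t) (E : finOrderType d).
Implicit Types (A B W F T X Y : {set E}) (e f g p w : E) (y z t : E -> rat).

Definition flipv A y : E -> rat := fun e => if e \in A then - y e else y e.

(** [cyc] stands for the flows and [coc] for the tensions.  In [paint] the edges of B are
    black, those of W white, the others red, or green for those in A: black edges are free
    for [cyc] and forbidden to [coc], white ones conversely. *)
Record omat := OMat {
  ground : {set E};
  cyc : (E -> rat) -> Prop;
  coc : (E -> rat) -> Prop;
  cyc_ground : forall y e, cyc y -> e \notin ground -> y e = 0;
  coc_ground : forall t e, coc t -> e \notin ground -> t e = 0;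
  cyc0 : cyc (fun=> 0);
  coc0 : coc (fun=> 0);
  cyc_lin : forall a b y z, cyc y -> cyc z -> cyc (fun e => a * y e + b * z e);
  coc_lin : forall a b t z, coc t -> coc z -> coc (fun e => a * t e + b * z e);
  orth : forall y t, cyc y -> coc t -> \sum_e y e * t e = 0;
  paint : forall A B W e, e \in ground -> e \notin B -> e \notin W ->
    (forall f, f \in B -> f \notin W) ->
    (exists y, [/\ cyc y, forall f, f \notin B -> 0 <= flipv A y f,
                   forall f, f \in W -> y f = 0 & 0 < flipv A y e]) \/
    (exists t, [/\ coc t, forall f, f \notin W -> 0 <= flipv A t f,
                   forall f, f \in B -> t f = 0 & 0 < flipv A t e])
}.

Implicit Types M N : omat.

Lemma flipvK A : involutive (flipv A).
Proof.
by move=> y; apply/funext => e; rewrite /flipv; case: (e \in A); rewrite ?opprK.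
Qed.

Lemma flipv0 A : flipv A (fun=> 0) = (fun=> 0).
Proof. by apply/funext => e; rewrite /flipv; case: ifP; rewrite ?oppr0. Qed.

Lemma flipv_lin A a b y z :
  flipv A (fun e => a * y e + b * z e)
  = (fun e => a * flipv A y e + b * flipv A z e).
Proof. by apply/funext => e; rewrite /flipv; case: (e \in A) => //; lra. Qed.

Lemma flipv_eq0 A y e : (flipv A y e == 0) = (y e == 0).
Proof. by rewrite /flipv; case: ifP; rewrite ?oppr_eq0. Qed.

Lemma flipv_symdiff A B y : flipv A (flipv B y) = flipv (symdiff A B) y.
Proof.
apply/funext => e; rewrite /flipv /symdiff !inE.
by case: (e \in A); case: (e \in B); rewrite ?opprK.
Qed.

Lemma sum_flip A y t : \sum_e flipv A y e * t e = \sum_e y e * flipv A t e.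
Proof.
by apply: eq_bigr => e _; rewrite /flipv; case: (e \in A) => //; lra.
Qed.

Definition dual M : omat.
Proof.
refine (@OMat (ground M) (coc M) (cyc M) (@coc_ground M) (@cyc_ground M) (coc0 M) (cyc0 M)
  (@coc_lin M) (@cyc_lin M) _ _).
- move=> y t cy ct; rewrite -[RHS](orth ct cy).
  by apply: eq_bigr => e _; rewrite mulrC.
- move=> A B W e ge eB eW BW.
  have [|[y H]|[t H]] := @paint M A W B e ge eW eB; last by left; exists t.
    by move=> f fW; apply/negP => /BW; rewrite fW.
  by right; exists y.
Defined.

Definition del M F : omat.
Proof.
refine (@OMat (ground M :\: F) (fun y => cyc M y /\ forall e, e \in F -> y e = 0)
  (fun t => exists2 t', coc M t' & t = fun e => if e \in F then 0 else t' e)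
  _ _ _ _ _ _ _ _).
- move=> y e [cy yF]; rewrite !inE negb_and negbK => /orP[/yF //|].
  exact: cyc_ground.
- move=> t e [t' ct' ->]; case: ifP => //= eF; rewrite inE eF /=.
  exact: coc_ground.
- by split; [exact: cyc0|].
- by exists (fun=> 0); [exact: coc0|apply/funext => e; case: ifP].
- move=> a b y z [cy yF] [cz zF]; split; first exact: cyc_lin.
  by move=> e eF; rewrite yF // zF //; lra.
- move=> a b _ _ [t ct ->] [z cz ->].
  exists (fun e => a * t e + b * z e); first exact: coc_lin.
  by apply/funext => e; case: ifP => // _; lra.
- move=> y _ [cy yF] [t ct ->]; rewrite -[RHS](orth cy ct).
  by apply: eq_bigr => e _; case: ifP => // /yF ->; lra.
- move=> A B W e; rewrite inE => /andP[eF ge] eB eW BW.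
  have [||f|[y [cy y1 y2 y3]]|[t [ct t1 t2 t3]]] := @paint M A (B :\: F) (W :|: F) e ge.
  + by rewrite inE negb_and eB orbT.
  + by rewrite inE negb_or eW.
  + by rewrite !inE negb_or => /andP[-> /BW ->].
  + left; exists y; split=> //.
    * by split=> // f fF; apply: y2; rewrite inE fF orbT.
    * move=> f fB; have [fF|fF] := boolP (f \in F); last first.
        by apply: y1; rewrite inE fF.
      by rewrite /flipv (y2 f) ?inE ?fF ?orbT // oppr0 if_same.
    * by move=> f fW; apply: y2; rewrite inE fW.
  + right; exists (fun f => if f \in F then 0 else t f); split.
    * by exists t.
    * move=> f fW; rewrite /flipv; have [fF|fF] := boolP (f \in F).
        by rewrite oppr0 if_same.
      by apply: t1; rewrite inE negb_or fW.
    * by move=> f fB; case: ifP => // fF; apply: t2; rewrite inE fF.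
    * by rewrite /flipv (negbTE eF).
Defined.

Definition con M F : omat := dual (del (dual M) F).

Definition flip A M : omat.
Proof.
refine (@OMat (ground M) (fun y => cyc M (flipv A y)) (fun t => coc M (flipv A t))
  _ _ _ _ _ _ _ _).
- by move=> y e cy /(cyc_ground cy) /eqP; rewrite flipv_eq0 => /eqP.
- by move=> y e cy /(coc_ground cy) /eqP; rewrite flipv_eq0 => /eqP.
- by rewrite flipv0; exact: cyc0.
- by rewrite flipv0; exact: coc0.
- by move=> a b y z cy cz; rewrite flipv_lin; exact: cyc_lin.
- by move=> a b y z cy cz; rewrite flipv_lin; exact: coc_lin.
- by move=> y t cy ct; rewrite -[RHS](orth cy ct) sum_flip flipvK.
- move=> A' B W e ge eB eW BW.
  have [[y [cy y1 y2 y3]]|[t [ct t1 t2 t3]]] :=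
    @paint M (symdiff A' A) B W e ge eB eW BW.
  + left; exists (flipv A y); split; rewrite ?flipvK ?flipv_symdiff //.
    by move=> f fW; apply/eqP; rewrite flipv_eq0; apply/eqP/y2.
  + right; exists (flipv A t); split; rewrite ?flipvK ?flipv_symdiff //.
    by move=> f fW; apply/eqP; rewrite flipv_eq0; apply/eqP/t2.
Defined.

Lemma cyc_ext M y z : y =1 z -> cyc M y -> cyc M z.
Proof. by move=> /funext ->. Qed.

Lemma cyc_scale M a y : cyc M y -> cyc M (fun e => a * y e).
Proof.
move=> cy; apply: cyc_ext (cyc_lin a 0 cy (cyc0 M)) => e /=.
by rewrite mul0r addr0.
Qed.

Lemma cyc_sum M (I : Type) (r : seq I) (P : pred I) (c : I -> rat) (v : I -> E -> rat) :
  (forall i, P i -> cyc M (v i)) ->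
  cyc M (fun e => \sum_(i <- r | P i) c i * v i e).
Proof.
move=> cv; elim: r => [|i r IH].
  by apply: cyc_ext (cyc0 M) => e; rewrite big_nil.
have [Pi|Pi] := boolP (P i).
  apply: cyc_ext (cyc_lin (c i) 1 (cv _ Pi) IH) => e.
  by rewrite big_cons Pi mul1r.
by apply: cyc_ext IH => e; rewrite big_cons (negbTE Pi).
Qed.

(** A self-dual form of being a spanning tree: no nonzero flow lives on T and no nonzero
    tension lives on its complement. *)
Definition basis M T : Prop :=
  [/\ T \subset ground M,
      forall y, cyc M y -> (forall e, e \notin T -> y e = 0) -> forall e, y e = 0 &
      forall t, coc M t -> (forall e, e \in T -> t e = 0) -> forall e, t e = 0].

Lemma basis_dual M T : basis M T -> basis (dual M) (ground M :\: T).
Proof.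
case=> sT T1 T2; split => /=; first exact: subsetDl.
- move=> t ct t0; apply: T2 => // e eT; apply: t0.
  by rewrite inE eT.
- move=> y cy y0; apply: T1 => // e eT.
  have [ge|/(cyc_ground cy) //] := boolP (e \in ground M).
  by apply: y0; rewrite inE eT.
Qed.

Lemma basis_dualE M T : T \subset ground M -> basis (dual M) (ground M :\: T) -> basis M T.
Proof.
move=> sT [/= _ T1 T2]; split=> // [y cy y0|t ct t0].
  apply: T2 => // e; rewrite inE => /andP[eT _]; exact: y0.
apply: T1 => // e; rewrite inE negb_and negbK => /orP[/t0//|]; exact: coc_ground.
Qed.

Lemma fund_cyc M T e : basis M T -> e \in ground M -> e \notin T ->
  exists y, [/\ cyc M y, y e = 1 & forall f, f \notin T -> f != e -> y f = 0].
Proof.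
case=> sT T1 T2 ge eT.
have [|f fT|[y [cy y1 y2 y3]]|[t [ct t1 t2 t3]]] :=
  @paint M set0 T (~: (e |: T)) e ge eT.
- by rewrite !inE eqxx.
- by rewrite !inE fT orbT.
- rewrite /flipv inE in y3.
  exists (fun f => (y e)^-1 * y f); split; first exact: cyc_scale.
    by rewrite mulVf // gt_eqF.
  by move=> f fT fe; rewrite (y2 f) ?mulr0 // !inE negb_or fe.
- by move: t3; rewrite /flipv (T2 t ct t2) oppr0 if_same ltxx.
Qed.

Lemma fund_coc M T b : basis M T -> b \in T ->
  exists t, [/\ coc M t, t b = 1 & forall f, f \in T -> f != b -> t f = 0].
Proof.
move=> bT Tb; have gb : b \in ground M by case: bT => /subsetP /(_ b Tb).
have [|t [ct t1 t2]] := @fund_cyc (dual M) _ b (basis_dual bT) gb.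
  by rewrite inE Tb.
by exists t; split=> // f fT; apply: t2; rewrite inE fT.
Qed.

Lemma fund_cyc_uniq M T e y z : basis M T -> cyc M y -> cyc M z ->
  (forall f, f \notin T -> f != e -> y f = 0) ->
  (forall f, f \notin T -> f != e -> z f = 0) ->
  forall f, z e * y f = y e * z f.
Proof.
case=> _ T1 _ cy cz y0 z0 f.
have := T1 _ (cyc_lin (z e) (- y e) cy cz) _ f.
suff H : forall g, g \notin T -> z e * y g + - y e * z g = 0.
  by move=> /(_ H) /= Hf; lra.
move=> g gT; have [->|ge] := eqVneq g e; first lra.
by rewrite (y0 g) // (z0 g) //; lra.
Qed.

(** A maximal set that carries no nonzero flow is a basis: if a tension off T were nonzero at
    e, a nonzero flow on e |: T would be nonzero at e too and not orthogonal to it. *)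
Lemma basis_exists M : exists T, basis M T.
Proof.
pose P T := (T \subset ground M) &&
  `[< forall y, cyc M y -> (forall e, e \notin T -> y e = 0) -> forall e, y e = 0 >].
have [|T /maxsetP[/andP[sT /asboolP T1] T2]] := @ex_maxset E P.
  by exists set0; rewrite /P sub0set; apply/asboolP => y _ y0 e; apply: y0; rewrite inE.
exists T; split=> // t ct t0 e.
have [ge|/(coc_ground ct) //] := boolP (e \in ground M).
apply/eqP/contraT => te.
have eT : e \notin T by apply: contra te => /t0 ->.
suff : P (e |: T).
  move=> /T2 /(_ (subsetUr _ _)) eqT; by rewrite -eqT !inE eqxx in eT.
rewrite /P subUset sub1set ge sT; apply/asboolP => y cy y0.
have ye : y e = 0.
  have := orth cy ct; rewrite (bigD1 e) //= big1 ?addr0.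
    by move/eqP; rewrite mulf_eq0 (negbTE te) orbF => /eqP.
  move=> f fe; have [fT|fT] := boolP (f \in T); first by rewrite t0 // mulr0.
  by rewrite y0 ?mul0r // !inE negb_or fe.
apply: T1 => // f fT; have [->//|fe] := eqVneq f e.
by apply: y0; rewrite !inE negb_or fe.
Qed.

Lemma coc_extend M T (v : E -> rat) : basis M T ->
  exists2 t, coc M t & forall b, b \in T -> t b = v b.
Proof.
move=> bT.
have /choice[tb tbP] : forall b, exists t, b \in T ->
    [/\ coc M t, t b = 1 & forall f, f \in T -> f != b -> t f = 0].
  move=> b; have [Tb|_] := boolP (b \in T); last by exists (fun=> 0).
  by have [t Ht] := fund_coc bT Tb; exists t.
exists (fun e => \sum_(b in T) v b * tb b e).
  by apply: (@cyc_sum (dual M)) => b /tbP[].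
move=> b Tb; rewrite (bigD1 b) //= big1; first by have [_ -> _] := tbP b Tb; lra.
move=> f /andP[Tf fb]; have [_ _ ->] := tbP f Tf; rewrite ?mulr0 //.
by rewrite eq_sym.
Qed.

(** A tension with prescribed values on a basis exists, and orthogonality to the
    fundamental flows determines its other values.  Hence either space is the whole
    orthogonal complement of the other. *)
Lemma coc_orth M t : (forall e, e \notin ground M -> t e = 0) ->
  (forall y, cyc M y -> \sum_e y e * t e = 0) -> coc M t.
Proof.
move=> t0 tM; have [T bT] := basis_exists M.
have [s cs sT] := coc_extend t bT.
suff -> : t = s by [].
apply/funext => e; have [ge|ge] := boolP (e \in ground M); last first.
  by rewrite t0 // (coc_ground cs).
have [eT|eT] := boolP (e \in T); first by rewrite sT.
have [y [cy y1 y2]] := fund_cyc bT ge eT.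
have := tM y cy; have := orth cy cs.
rewrite (bigD1 e) //= [in X in _ -> X -> _](bigD1 e) //= y1.
rewrite [X in _ -> _ + X = _ -> _](eq_bigr (fun i => y i * s i)); first by lra.
move=> f fe; have [fT|fT] := boolP (f \in T); first by rewrite sT.
by rewrite y2 // !mul0r.
Qed.

(** Since the tensions are determined by the flows, matroids can be compared by their flows
    alone; this is what makes Leibniz equality of minors convenient. *)
Lemma omat_eq M N : ground M = ground N -> (forall y, cyc M y <-> cyc N y) -> M = N.
Proof.
move=> eqg eqc.
have eqd t : coc M t <-> coc N t.
  split=> ct; apply: coc_orth.
  - by move=> e; rewrite -eqg; exact: coc_ground.
  - by move=> y /eqc cy; exact: orth cy ct.
  - by move=> e; rewrite eqg; exact: coc_ground.
  - by move=> y /eqc cy; exact: orth cy ct.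
have {}eqc : cyc M = cyc N by apply/funext => y; apply/propext.
have {}eqd : coc M = coc N by apply/funext => y; apply/propext.
case: M eqg eqc eqd => g c k c1 c2 c3 c4 c5 c6 c7 c8 /=.
case: N => g' c' k' d1 d2 d3 d4 d5 d6 d7 d8 /= eg ec ed.
subst g' c' k'.
by congr OMat; exact: Prop_irrelevance.
Qed.

Lemma dualK : involutive dual.
Proof. by move=> M; apply: omat_eq. Qed.

Lemma omat_eq_coc M N : ground M = ground N -> (forall y, coc M y <-> coc N y) -> M = N.
Proof.
by move=> eqg eqc; rewrite -[M]dualK -[N]dualK; congr dual; apply: omat_eq.
Qed.

Lemma dual_del M F : dual (del M F) = con (dual M) F.
Proof. by rewrite /con dualK. Qed.

Lemma dual_con M F : dual (con M F) = del (dual M) F.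
Proof. by rewrite /con dualK. Qed.

Lemma dual_flip M A : dual (flip A M) = flip A (dual M).
Proof. exact: omat_eq. Qed.

Lemma cyc_con M F y : cyc (con M F) y <->
  exists2 y', cyc M y' & y = fun e => if e \in F then 0 else y' e.
Proof. by []. Qed.

End OrientedMatroids.

(** * Fully optimal bases and linear programming duality *)

Section FullOptimality.

Context (d : Order.disp_t) (E : finOrderType d).
Implicit Types (A B W F T X Y : {set E}) (e f g p w : E) (y z t : E -> rat).
Implicit Types M N : omat E.

Definition rk e : nat := #|[set f | (f < e)%O]|.

Lemma leq_rk e f : (rk e <= rk f)%N = (e <= f)%O.
Proof.
case: (leP e f) => [le|lt].
  apply: subset_leq_card; apply/subsetP => g; rewrite !inE => ge.
  exact: lt_le_trans ge le.
apply/negbTE; rewrite -ltnNge; apply: proper_card.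
apply/properP; split.
  by apply/subsetP => g; rewrite !inE => gf; exact: lt_trans gf lt.
by exists f; rewrite !inE ?lt // ltxx.
Qed.

Lemma rk_inj : injective rk.
Proof. by move=> e f ef; apply/le_anti; rewrite -!leq_rk ef leqnn. Qed.

Lemma rk_lt e : (rk e < #|E|)%N.
Proof.
rewrite -cardsT; apply: proper_card; apply/properP; split; first exact: subsetT.
by exists e; rewrite !inE ?ltxx.
Qed.

Definition min_of M p := p \in ground M /\ forall f, f \in ground M -> (rk p <= rk f)%N.
Definition max_of M w := w \in ground M /\ forall f, f \in ground M -> (rk f <= rk w)%N.

(** The flow y is unique up to a positive factor when T is a basis: it orients the
    fundamental cycle of e along e. *)
Definition opp_min M T e : Prop :=
  forall y, cyc M y -> (forall f, f \notin T -> f != e -> y f = 0) -> 0 < y e ->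
  exists2 f, y f < 0 & forall g, y g != 0 -> (rk f <= rk g)%N.

(** Only one of the two exceptions for p is effective: p in T is the bipolar case, p outside
    T the cyclic-bipolar one, and duality exchanges them. *)
Definition FO M p T : Prop :=
  [/\ basis M T,
      forall e, e \in ground M -> e \notin T -> e != p -> opp_min M T e &
      forall b, b \in T -> b != p -> opp_min (dual M) (ground M :\: T) b].

Lemma setDDK A B : B \subset A -> A :\: (A :\: B) = B.
Proof. by move=> sBA; rewrite setDDr setDv set0U; apply/setIidPr. Qed.

Lemma FO_dual M p T : FO M p T -> FO (dual M) p (ground M :\: T).
Proof.
case=> bT F1 F2; have sT : T \subset ground M by case: bT.
split; first exact: basis_dual.
- move=> e /= ge; rewrite inE ge andbT negbK; exact: F2.
- move=> b /=; rewrite inE dualK setDDK // => /andP[]; move=> *; exact: F1.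
Qed.

Lemma FO_dualE M p T : T \subset ground M -> FO (dual M) p (ground M :\: T) -> FO M p T.
Proof. by move=> sT /FO_dual; rewrite dualK /= setDDK. Qed.

(** The base n is a parameter to be taken large: each edge then outweighs all later ones. *)
Definition wt (n : rat) e : rat := n ^+ (#|E| - rk e).

Lemma wt_gt0 n e : 1 <= n -> 0 < wt n e.
Proof. by move=> n1; apply: exprn_gt0; lra. Qed.

Lemma wt_step n e f : 1 <= n -> (rk e < rk f)%N -> n * wt n f <= wt n e.
Proof.
move=> n1 ef; rewrite /wt -exprS; apply: ler_weXn2l => //.
by have := rk_lt f; lia.
Qed.

(** Evaluate t at e by orthogonality with the fundamental flow y.  The smallest edge f of
    its support has y f < 0 and its weight exceeds the total of the others, so the term of
    f, which is positive in t e, dominates all the others and the weight of e itself. *)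
Lemma opp_min_dominates M T e y : basis M T -> e \notin T ->
  cyc M y -> y e = 1 -> (forall f, f \notin T -> f != e -> y f = 0) ->
  opp_min M T e ->
  exists n0, forall n, n0 <= n -> 1 <= n -> forall t, coc M t ->
    (forall b, b \in T -> t b = wt n b) -> wt n e < t e.
Proof.
move=> bT eT cy y1 y0 /(_ y cy y0); rewrite y1 => /(_ ltr01) [f yf fmin].
have fe : f != e by apply: contraTneq yf => ->; rewrite y1 -leNgt.
have rfe : (rk f < rk e)%N.
  rewrite ltn_neqAle fmin ?y1 ?oner_eq0 // andbT.
  by apply: contra fe => /eqP/rk_inj ->.
(* n times |y f| has to exceed 1, for the edge e, plus the sum of the other coefficients *)
exists ((1 + \sum_b `|y b|) / (- y f) + 1) => n n0n n1 t ct tT.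
have S0 : 0 <= \sum_b `|y b| by apply: sumr_ge0 => b _; exact: normr_ge0.
have big_n : 1 + \sum_b `|y b| < n * - y f.
  by rewrite -ltr_pdivrMr ?oppr_gt0 //; lra.
have := orth cy ct.
rewrite (bigD1 e) //= y1 mul1r (bigD1 f) //=.
have -> : t f = wt n f.
  by apply: tT; apply: contraTT yf => fT; rewrite y0 // ltxx.
have wf := wt_gt0 f n1.
set S := \sum_(i | _) _ => H.
have leS : n * S <= (\sum_b `|y b|) * wt n f.
  rewrite /S mulr_sumr.
  apply: le_trans (_ : \sum_(i | (i != e) && (i != f)) `|y i| * wt n f <= _).
    apply: ler_sum => b /andP[be bf].
    have [->|yb] := eqVneq (y b) 0; first by rewrite normr0; lra.
    have Tb : b \in T by apply: contraNT yb => bT'; rewrite y0.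
    rewrite tT //.
    have lt_fb : (rk f < rk b)%N.
      rewrite ltn_neqAle fmin // andbT; apply: contra bf => /eqP/rk_inj ->.
      by rewrite eqxx.
    have := wt_step n1 lt_fb; have := wt_gt0 b n1 => wb step.
    have := ler_norm (y b) => nb.
    apply: le_trans (_ : `|y b| * (n * wt n b) <= _); last first.
      exact: ler_wpM2l.
    rewrite mulrCA; apply: ler_wpM2r => //.
    apply: mulr_ge0; lra.
  rewrite -mulr_suml; apply: ler_wpM2r; first lra.
  rewrite [leRHS](bigID (fun i => (i != e) && (i != f))) /= lerDl.
  by apply: sumr_ge0 => b _; exact: normr_ge0.
have step_e := wt_step n1 rfe.
have te : t e = wt n f * - y f - S by lra.
have H2 : n * t e = n * wt n f * - y f - n * S by rewrite te; ring.
have n0' : 0 < n by lra.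
rewrite -(ltr_pM2l n0') H2.
have : (1 + \sum_b `|y b|) * wt n f < n * - y f * wt n f.
  by rewrite ltr_pM2r.
lra.
Qed.

Lemma eventually_all (P : E -> rat -> Prop) :
  (forall e, exists n0, forall n, n0 <= n -> P e n) ->
  exists n0, forall n, n0 <= n -> forall e, P e n.
Proof.
move=> /choice[n0 n0P]; exists (\sum_e `|n0 e|) => n le e; apply: n0P.
apply: le_trans le; rewrite (bigD1 e) //=.
have := ler_norm (n0 e).
have : 0 <= \sum_(i | i != e) `|n0 i| by apply: sumr_ge0 => i _; exact: normr_ge0.
lra.
Qed.

Lemma FO_coc M p T : FO M p T -> exists n0, forall n, n0 <= n -> 1 <= n ->
  exists t, [/\ coc M t, forall b, b \in T -> t b = wt n b &
    forall e, e \in ground M -> e \notin T -> e != p -> wt n e < t e].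
Proof.
case=> bT F1 _.
have [n0 n0P] : exists n0, forall n, n0 <= n -> forall e,
    1 <= n -> e \in ground M -> e \notin T -> e != p ->
    forall t, coc M t -> (forall b, b \in T -> t b = wt n b) -> wt n e < t e.
  apply: eventually_all => e.
  have [ge|] := boolP (e \in ground M); last by exists 0.
  have [|eT] := boolP (e \in T); first by exists 0.
  have [|ep] := boolP (e == p); first by exists 0.
  have [y [cy y1 y0]] := fund_cyc bT ge eT.
  have [n0 H] := opp_min_dominates bT eT cy y1 y0 (F1 e ge eT ep).
  by exists n0 => n /H{}H n1 _ _ _; exact: H.
exists n0 => n n0n n1.
have [t ct tT] := coc_extend (wt n) bT.
by exists t; split=> // e ge eT ep; apply: n0P.
Qed.

Lemma FO_cyc M p T : FO M p T -> exists n0, forall n, n0 <= n -> 1 <= n ->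
  exists y, [/\ cyc M y, forall e, e \in ground M -> e \notin T -> y e = wt n e &
    forall b, b \in T -> b != p -> wt n b < y b].
Proof.
move=> FT; have sT : T \subset ground M by case: FT => [[]].
have [n0 H] := FO_coc (FO_dual FT).
exists n0 => n n0n n1; have [y [/= cy y1 y2]] := H n n0n n1.
exists y; split=> // [e ge eT|b Tb bp]; first by apply: y1; rewrite inE eT.
by apply: y2 => //; [exact: (subsetP sT)|rewrite inE Tb].
Qed.

(** The vectors t1 - t2 and y1 - y2 are orthogonal.  Complementarity makes every term of
    their scalar product nonpositive, and negative at the edges where T1 and T2 differ; the
    exceptional edge p contributes 0 because t1 and t2 agree there. *)
Lemma FO_uniq_in M p T1 T2 : FO M p T1 -> FO M p T2 ->
  p \in T1 -> p \in T2 -> T1 = T2.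
Proof.
move=> FT1 FT2 pT1 pT2.
have [n1 H1] := FO_coc FT1; have [n2 H2] := FO_coc FT2.
have [n3 H3] := FO_cyc FT1; have [n4 H4] := FO_cyc FT2.
pose n := 1 + `|n1| + `|n2| + `|n3| + `|n4|.
have := ler_norm n1; have := ler_norm n2; have := ler_norm n3.
have := ler_norm n4; have := normr_ge0 n1; have := normr_ge0 n2.
have := normr_ge0 n3; have := normr_ge0 n4 => a1 a2 a3 a4 a5 a6 a7 a8.
have ge1 : 1 <= n by rewrite /n; lra.
have [|t1 [ct1 t1T t1e]] := H1 n _ ge1; first by rewrite /n; lra.
have [|t2 [ct2 t2T t2e]] := H2 n _ ge1; first by rewrite /n; lra.
have [|y1 [cy1 y1T y1e]] := H3 n _ ge1; first by rewrite /n; lra.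
have [|y2 [cy2 y2T y2e]] := H4 n _ ge1; first by rewrite /n; lra.
have := orth (cyc_lin 1 (-1) cy1 cy2) (coc_lin 1 (-1) ct1 ct2).
under eq_bigr do rewrite !mul1r !mulN1r.
move=> sum0.
have term e : (y1 e - y2 e) * (t1 e - t2 e) <= 0 /\
    (e \in T1 != (e \in T2) -> (y1 e - y2 e) * (t1 e - t2 e) < 0).
  have [->|ep] := eqVneq e p.
    by rewrite pT1 pT2 t1T // t2T // subrr mulr0.
  have [ge|ge] := boolP (e \in ground M); last first.
    rewrite (cyc_ground cy1) // (cyc_ground cy2) // subrr mul0r; split=> //.
    case: FT1 FT2 => -[/subsetP s1 _ _] _ _ [[/subsetP s2 _ _] _ _].
    by rewrite (contraNF (s1 e) ge) (contraNF (s2 e) ge).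
  have [eT1|eT1] := boolP (e \in T1); have [eT2|eT2] := boolP (e \in T2).
  - by rewrite t1T // t2T // subrr mulr0.
  - rewrite t1T // y2T //.
    suff : 0 < (y1 e - wt n e) * (t2 e - wt n e) by move=> H; split => [|_]; lra.
    by apply: mulr_gt0; rewrite subr_gt0; [apply: y1e|apply: t2e].
  - rewrite t2T // y1T //.
    suff : 0 < (y2 e - wt n e) * (t1 e - wt n e) by move=> H; split => [|_]; lra.
    by apply: mulr_gt0; rewrite subr_gt0; [apply: y2e|apply: t1e].
  - by rewrite y1T // y2T // subrr mul0r.
apply/setP => e; apply/eqP/contraT => ne.
have [_ /(_ ne)] := term e; move: sum0; rewrite (bigD1 e) //=.
have : \sum_(i | i != e) (y1 i - y2 i) * (t1 i - t2 i) <= 0.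
  by apply: sumr_le0 => i _; have [] := term i.
lra.
Qed.

Lemma FO_uniq M p T1 T2 : p \in ground M -> FO M p T1 -> FO M p T2 ->
  (p \in T1) = (p \in T2) -> T1 = T2.
Proof.
move=> gp F1 F2; have [pT1 /esym pT2|pT1 /esym pT2] := boolP (p \in T1).
  exact: FO_uniq_in F1 F2 pT1 pT2.
have s1 : T1 \subset ground M by case: F1 => [[]].
have s2 : T2 \subset ground M by case: F2 => [[]].
have := FO_uniq_in (FO_dual F1) (FO_dual F2); rewrite !inE pT1 pT2 /= gp.
by move=> /(_ isT isT) eqD; rewrite -(setDDK s1) eqD setDDK.
Qed.

Definition pos M (n : nat) e : Prop :=
  exists y, [/\ cyc M y, forall f, 0 <= y f,
                forall f, y f != 0 -> (n <= rk f)%N & 0 < y e].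

Lemma pos_orth M y t : cyc M y -> coc M t ->
  (forall f, 0 <= y f * t f) -> forall f, y f * t f = 0.
Proof.
move=> cy ct ge0 f; have /eqP := orth cy ct.
by rewrite psumr_eq0 // => /allP /(_ f (mem_index_enum _)) /eqP.
Qed.

Lemma pos_excl M n m e : pos M n e -> pos (dual M) m e -> False.
Proof.
move=> [y [cy y0 _ ye]] [t [/= ct t0 _ te]].
have /eqP := pos_orth cy ct (fun f => mulr_ge0 (y0 f) (t0 f)) e.
by rewrite mulf_eq0 !gt_eqF.
Qed.

Lemma pos_total M e : e \in ground M -> pos M 0 e \/ pos (dual M) 0 e.
Proof.
move=> ge; have [||//|[y [cy y1 _ y2]]|[t [ct t1 _ t2]]] := @paint _ _ M set0 set0 set0 e ge.
- by rewrite inE.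
- by rewrite inE.
- by move=> f; rewrite inE.
- left; exists y; rewrite /flipv in_set0 in y2; split=> // f.
  by have := y1 f; rewrite /flipv !in_set0 => ->.
- right; exists t; rewrite /flipv in_set0 in t2; split=> // f.
  by have := t1 f; rewrite /flipv !in_set0 => ->.
Qed.

(** Cyclic-bipolarity with respect to p; bipolarity is [cbip (dual M) p]. *)
Definition cbip M p : Prop :=
  (forall e, e \in ground M -> pos M 0 e) /\
  (forall y, cyc M y -> (forall f, 0 <= y f) -> (exists f, y f != 0) -> 0 < y p).

(** For large weights the tension of [FO_coc] is positive everywhere, and the flow of
    [FO_cyc] is positive except at p, so a nonnegative tension vanishing at p would not be
    orthogonal to it. *)
Lemma FO_cbip_dual M p T : p \in T -> FO M p T -> cbip (dual M) p.
Proof.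
move=> pT FT.
have [n1 H1] := FO_coc FT; have [n2 H2] := FO_cyc FT.
pose n := 1 + `|n1| + `|n2|.
have := ler_norm n1; have := ler_norm n2.
have := normr_ge0 n1; have := normr_ge0 n2 => a1 a2 a3 a4.
have ge1 : 1 <= n by rewrite /n; lra.
have [|t [ct tT te]] := H1 n _ ge1; first by rewrite /n; lra.
have [|y [cy yT ye]] := H2 n _ ge1; first by rewrite /n; lra.
have t_gt0 e : e \in ground M -> 0 < t e.
  move=> ge; have w0 := wt_gt0 e ge1.
  have [eT|eT] := boolP (e \in T); first by rewrite tT.
  apply: lt_trans w0 (te e ge eT _).
  by apply: contraNneq eT => ->.
have y_gt0 e : e \in ground M -> e != p -> 0 < y e.
  move=> ge ep; have w0 := wt_gt0 e ge1.
  have [eT|eT] := boolP (e \in T); last by rewrite yT.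
  exact: lt_trans w0 (ye e eT ep).
split=> /= [e ge|s cs s0 [f sf]].
  exists t; split=> //; last exact: t_gt0.
  move=> f; have [/t_gt0/ltW //|gf] := boolP (f \in ground M).
  by rewrite (coc_ground ct gf).
rewrite lt_def s0 andbT; apply/negP => /eqP sp.
have ge0 e : 0 <= y e * s e.
  have [->|ep] := eqVneq e p; first by rewrite sp mulr0.
  have [ge|/(coc_ground cs) ->] := boolP (e \in ground M); last by rewrite mulr0.
  by apply: mulr_ge0; [apply/ltW/y_gt0|].
have /eqP := pos_orth cy cs ge0 f.
rewrite mulf_eq0 (negbTE sf) orbF gt_eqF // y_gt0 //.
  by apply: contraNT sf => /(coc_ground cs) ->.
by apply: contraNneq sf => ->; rewrite sp.
Qed.

Lemma FO_cbip M p T : p \in ground M -> p \notin T -> FO M p T -> cbip M p.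
Proof.
move=> gp pT /FO_dual FT; rewrite -[M]dualK; apply: FO_cbip_dual FT.
by rewrite inE pT.
Qed.

End FullOptimality.

(** * Existence of fully optimal bases *)

Section Existence.

Context (d : Order.disp_t) (E : finOrderType d).
Implicit Types (A B W F T X Y : {set E}) (e f g p w : E) (y z t : E -> rat).
Implicit Types M N : omat E.

Definition isthmus M w := exists2 t, coc M t & t w != 0 /\ forall f, f != w -> t f = 0.
Definition loop M w := isthmus (dual M) w.

Lemma cyc_elim M w y z : cyc M y -> cyc M z ->
  cyc M (fun e => y e - y w / z w * z e).
Proof.
move=> cy cz; apply: cyc_ext (cyc_lin 1 (- (y w / z w)) cy cz) => e.
by rewrite mul1r mulNr.
Qed.

Lemma in_del1 M w e : (e \in ground (del M [set w])) = (e != w) && (e \in ground M).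
Proof. by rewrite !inE. Qed.

Lemma max_neq M w e : max_of M w -> e \in ground M -> e != w -> (rk e < rk w)%N.
Proof.
move=> [_ wm] ge ew; rewrite ltn_neqAle wm // andbT.
by apply: contra ew => /eqP/rk_inj ->.
Qed.

Lemma min_del M w p : max_of M w -> min_of (del M [set w]) p -> min_of M p.
Proof.
move=> [gw wm] [/=]; rewrite in_del1 => /andP[pw gp] pm; split=> // f gf.
have [->|fw] := eqVneq f w; first exact: wm.
by apply: pm; rewrite in_del1 fw.
Qed.

Lemma del_min M w p : p != w -> min_of M p -> min_of (del M [set w]) p.
Proof.
move=> pw [gp pm]; split; first by rewrite in_del1 pw.
by move=> f /=; rewrite inE => /andP[_]; exact: pm.
Qed.

Lemma opp_min_del M T e w : w \notin T -> e != w ->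
  opp_min (del M [set w]) T e <-> opp_min M T e.
Proof.
move=> wT ew; split=> H y cy y0 ye; apply: H => //=; last by case: cy.
by split=> // f; rewrite inE => /eqP ->; apply: y0 => //; rewrite eq_sym.
Qed.

(** The vector may take any value at w, but b is smaller than w and lies in the support, so w
    has no influence on the smallest edge of the support. *)
Lemma opp_min_con M T b w : max_of M w -> b != w -> w \in T ->
  opp_min (con M [set w]) (T :\ w) b <-> opp_min M T b.
Proof.
move=> wm bw wT; split=> H y cy y0 yb.
  have := H (fun e => if e \in [set w] then 0 else y e).
  rewrite inE (negbTE bw); case=> //; first by apply/cyc_con; exists y.
    move=> f; rewrite !inE; case: (eqVneq f w) => //= fw; exact: y0.
  move=> f; rewrite inE; case: (eqVneq f w) => [//|fw yf fm].
  exists f => // g yg; have := fm g; rewrite inE.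
  case: (eqVneq g w) => [gw _|_ -> //]; rewrite gw; apply: (wm.2).
  by apply: contraLR yf => /(cyc_ground cy) ->; rewrite ltxx.
have [y' cy' eqy] := cy; rewrite eqy inE (negbTE bw) in yb.
have [|f y'f fm] := H y' cy' _ yb.
  move=> f fT fb; have fw : f != w by apply: contraNneq fT => ->.
  by have := y0 f; rewrite eqy !inE (negbTE fw) /=; apply.
have fw : f != w.
  apply: contraTneq (fm b (lt0r_neq0 yb)) => ->; rewrite -ltnNge.
  apply: (max_neq wm) => //; have := lt0r_neq0 yb.
  by apply: contraNT => /(cyc_ground cy') ->.
exists f; first by rewrite eqy inE (negbTE fw).
move=> g; rewrite eqy inE; case: ifP => [|_ /fm //]; by rewrite eqxx.
Qed.

Lemma basis_del M T w : w \notin T -> basis M T -> basis (del M [set w]) T.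
Proof.
move=> wT [sT T1 T2]; split => /=.
- by rewrite subsetD1 sT.
- by move=> y [cy _]; exact: T1.
- move=> _ [t ct ->] t0 e; case: ifP => // _; apply: T2 => // f fT.
  have := t0 f fT; rewrite inE; case: (eqVneq f w) => // fw.
  by rewrite -fw fT in wT.
Qed.

Lemma basis_delE M T w : ~ isthmus M w -> basis (del M [set w]) T -> basis M T.
Proof.
move=> nw [/= sT T1 T2].
have wT : w \notin T by move: sT; rewrite subsetD1 => /andP[].
split; first by apply: subset_trans sT _; exact: subsetDl.
- move=> y cy y0; apply: T1 => //; split=> // e; rewrite inE => /eqP ->.
  exact: y0.
- move=> t ct t0.
  have t1 e : e != w -> t e = 0.
    have := T2 (fun e => if e \in [set w] then 0 else t e) _ _ e.
    rewrite inE => H /negbTE ew; rewrite ew in H; apply: H; first by exists t.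
    by move=> f /t0 ->; rewrite if_same.
  move=> e; have [->|/t1 //] := eqVneq e w; apply/eqP/contraT => tw.
  by case: nw; exists t.
Qed.

Lemma FO_del M p T w : max_of M w -> w \notin T -> FO M p T ->
  FO (del M [set w]) p T.
Proof.
move=> wm wT [bT F1 F2]; split; first exact: basis_del.
- move=> e; rewrite in_del1 => /andP[ew ge] eT ep.
  by apply/opp_min_del => //; exact: F1.
- move=> b Tb bp; rewrite dual_del /= setDDl setUC -setDDl.
  have bw : b != w by apply: contraNneq wT => <-.
  by apply/(@opp_min_con (dual M)) => //; [rewrite inE wT; case: wm|exact: F2].
Qed.

Lemma FO_delE M p T w : max_of M w -> ~ isthmus M w ->
  (w != p -> opp_min M T w) -> FO (del M [set w]) p T -> FO M p T.
Proof.
move=> wm nw ow [bT F1 F2].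
have wT : w \notin T by case: bT; rewrite subsetD1 => /andP[].
split; first exact: basis_delE bT.
- move=> e ge eT ep; have [ew|ew] := eqVneq e w.
    by rewrite ew in ep *; exact: ow.
  by apply/(opp_min_del _ wT) => //; apply: F1 => //; rewrite in_del1 ew.
- move=> b Tb bp; have := F2 b Tb bp; rewrite dual_del /= setDDl setUC -setDDl.
  have bw : b != w by apply: contraNneq wT => <-.
  by move/(@opp_min_con (dual M)); apply=> //; rewrite inE wT; case: wm.
Qed.

Lemma con_setE M T w : w \in T -> T \subset ground M ->
  (ground M :\: [set w]) :\: (ground M :\: T) = T :\ w.
Proof.
move=> wT sT; apply/setP => e; rewrite !inE.
by have /implyP := subsetP sT e; case: (e \in T); case: (e \in ground M); case: (e == w).
Qed.

Lemma FO_con M p T w : max_of M w -> w \in T -> FO M p T ->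
  FO (con M [set w]) p (T :\ w).
Proof.
move=> wm wT FT; have sT : T \subset ground M by case: FT => [[]].
have := FO_dual (@FO_del (dual M) p _ w wm _ (FO_dual FT)).
by rewrite dual_del dualK /= con_setE //; apply; rewrite inE wT.
Qed.

Lemma del_flip M w : del (flip [set w] M) [set w] = del M [set w].
Proof.
apply: omat_eq => //= y.
suff H : (forall e, e \in [set w] -> y e = 0) -> flipv [set w] y = y.
  by split=> -[cy y0]; split=> //; move: cy; rewrite H.
move=> y0; apply/funext => e; rewrite /flipv; case: ifP => // /y0 ->.
by rewrite oppr0.
Qed.

Lemma con_flip M w : con (flip [set w] M) [set w] = con M [set w].
Proof. by rewrite /con dual_flip del_flip. Qed.

Lemma isthmus_flip A M w : isthmus (flip A M) w <-> isthmus M w.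
Proof.
split=> -[t ct [tw t0]]; exists (flipv A t) => //=; rewrite ?flipvK //;
  rewrite flipv_eq0; split=> // f /t0 tf; by apply/eqP; rewrite flipv_eq0 tf.
Qed.

Lemma loop_flip A M w : loop (flip A M) w <-> loop M w.
Proof. by rewrite /loop dual_flip isthmus_flip. Qed.

Lemma cycN M y : cyc M y -> cyc M (fun e => - y e).
Proof. by move=> cy; apply: cyc_ext (cyc_scale (-1) cy) => e; rewrite mulN1r. Qed.

Lemma cyc_flip A M y : cyc M y -> cyc (flip A M) (flipv A y).
Proof. by rewrite /= flipvK. Qed.

Lemma basis_flip A M T : basis M T -> basis (flip A M) T.
Proof.
move=> [sT T1 T2]; split=> //= y cy y0 e; apply/eqP; rewrite -(flipv_eq0 A).
  apply/eqP; apply: T1 => // f /y0 yf; by apply/eqP; rewrite flipv_eq0 yf.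
by apply/eqP; apply: T2 => // f /y0 yf; apply/eqP; rewrite flipv_eq0 yf.
Qed.

(** Reversing w changes the relative sign of w and of the smallest edge of the fundamental
    cycle of w, which are different edges when w is not a loop. *)
Lemma opp_min_flip M T w : basis M T -> max_of M w -> w \notin T -> ~ loop M w ->
  opp_min M T w \/ opp_min (flip [set w] M) T w.
Proof.
move=> bT wm wT nl; have gw := wm.1; have [y [cy yw y0]] := fund_cyc bT gw wT.
have [f yf fm] : exists2 f, y f != 0 & forall g, y g != 0 -> (rk f <= rk g)%N.
  have : exists n, [exists f, (y f != 0) && (rk f == n)].
    by exists (rk w); apply/existsP; exists w; rewrite yw oner_eq0 eqxx.
  move=> /ex_minnP[n /existsP[f /andP[yf /eqP <-]] nm].
  by exists f => // g yg; apply: nm; apply/existsP; exists g; rewrite yg eqxx.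
have ywn : y w != 0 by rewrite yw oner_eq0.
have fw : f != w.
  apply/negP => /eqP fw; apply: nl; exists y => //=; split=> // g gw'.
  apply/eqP/contraT => yg; have := fm g yg; rewrite fw leqNgt (max_neq wm) //.
  by apply: contraNT yg => /(cyc_ground cy) ->.
have nf : 0 < y f \/ y f < 0 by case: (ltgtP (y f) 0) yf => //; auto.
have key N z : basis N T -> cyc N z -> 0 < z w -> z f < 0 ->
    (forall g, (z g == 0) = (y g == 0)) -> opp_min N T w.
  move=> bN cz zw zf zy s cs s0 sw.
  have z0 g : g \notin T -> g != w -> z g = 0.
    by move=> gT gw'; apply/eqP; rewrite zy y0.
  have sz g : s g = s w / z w * z g.
    have := fund_cyc_uniq bN cs cz s0 z0 g => H.
    by apply: (mulfI (lt0r_neq0 zw)); rewrite H; field; exact: lt0r_neq0.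
  have c0 : 0 < s w / z w by rewrite divr_gt0.
  exists f; first by rewrite sz pmulr_rlt0.
  move=> g; rewrite sz mulf_eq0 negb_or zy => /andP[_]; exact: fm.
have bT' : basis (flip [set w] M) T by exact: basis_flip.
case: nf => yf0; [right|left].
  apply: (key _ (fun e => - flipv [set w] y e)) => //.
  - exact/cycN/cyc_flip.
  - by rewrite /flipv inE eqxx opprK yw.
  - by rewrite /flipv inE (negbTE fw) oppr_lt0.
  - by move=> g; rewrite oppr_eq0 flipv_eq0.
by apply: (key _ y) => //; rewrite yw.
Qed.

Lemma opp_min_flip_excl M T w : basis M T -> w \in ground M -> w \notin T ->
  opp_min M T w -> opp_min (flip [set w] M) T w -> False.
Proof.
move=> bT gw wT o1 o2; have [y [cy yw y0]] := fund_cyc bT gw wT.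
have [|f yf fm] := o1 y cy y0; first by rewrite yw.
have fw : f != w by apply: contraTneq yf => ->; rewrite yw -leNgt.
have [|||g zg gm] := o2 (fun e => - flipv [set w] y e).
- exact/cycN/cyc_flip.
- by move=> g gT gw'; rewrite /flipv inE (negbTE gw') y0 // oppr0.
- by rewrite /flipv inE eqxx opprK yw.
suff eqfg : f = g by move: zg; rewrite -eqfg /flipv inE (negbTE fw); lra.
apply: rk_inj; apply/eqP; rewrite eqn_leq fm /=.
  by apply: gm; rewrite oppr_eq0 flipv_eq0 lt_eqF.
by move: (lt_eqF zg) => /negbT; rewrite oppr_eq0 flipv_eq0.
Qed.

(** All conditions of full optimality but the one at w are the same in M and in the deletion
    of w, and the condition at w holds either in M or after w is reversed. *)
Lemma FO_lift_del M p T w : max_of M w -> ~ isthmus M w -> ~ loop M w ->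
  FO (del M [set w]) p T -> FO M p T \/ FO (flip [set w] M) p T.
Proof.
move=> wm ni nl FT; have bT : basis M T by apply: basis_delE ni _; case: FT.
have wT : w \notin T by case: FT => -[/=]; rewrite subsetD1 => /andP[].
have [o|o] := opp_min_flip bT wm wT nl; [left|right].
  exact: FO_delE FT.
by apply: (@FO_delE _ _ _ w); rewrite ?del_flip // isthmus_flip.
Qed.

Lemma FO_lift_con M p T w : max_of M w -> ~ isthmus M w -> ~ loop M w ->
  FO (con M [set w]) p T -> FO M p (w |: T) \/ FO (flip [set w] M) p (w |: T).
Proof.
move=> wm ni nl FT; have sT : T \subset ground M :\ w by case: FT => -[].
have eqD : (ground M :\: [set w]) :\: T = ground M :\: (w |: T) by rewrite setDDl.
have sT' : w |: T \subset ground M.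
  rewrite subUset sub1set wm.1; apply: subset_trans sT _; exact: subD1set.
have := FO_dual FT; rewrite dual_con /= eqD => FT'.
have [||FD|FD] := @FO_lift_del (dual M) p _ w wm _ _ FT' => //.
- by left; apply: FO_dualE.
- by right; apply: FO_dualE => //; rewrite dual_flip.
Qed.

Lemma FO_flip_excl_del M p T w : w \in ground M -> w != p -> w \notin T ->
  FO M p T -> FO (flip [set w] M) p T -> False.
Proof.
move=> gw wp wT [bT F1 _] [_ F2 _]; apply: (opp_min_flip_excl bT gw wT).
  exact: F1.
exact: F2.
Qed.

Lemma FO_flip_excl M p T w : w \in ground M -> w != p ->
  FO M p T -> FO (flip [set w] M) p T -> False.
Proof.
move=> gw wp F1 F2; have [wT|wT] := boolP (w \in T); last exact: FO_flip_excl_del F1 F2.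
apply: (@FO_flip_excl_del (dual M) p (ground M :\: T) w) => //; first by rewrite inE wT.
  exact: FO_dual.
by rewrite -dual_flip; exact: FO_dual F2.
Qed.

(** Used to absorb the negative values of y by a large positive vector of a level. *)
Lemma dominate y x : (forall f, 0 <= x f) ->
  exists c, [/\ 0 <= c, forall f, 0 < x f -> 0 < y f + c * x f
    & forall f, x f = 0 -> y f + c * x f = y f].
Proof.
move=> x0; exists (\sum_f (`|y f| + 1) / x f).
have ge0 f : 0 <= (`|y f| + 1) / x f.
  by rewrite divr_ge0 // addr_ge0.
split; first by apply: sumr_ge0 => f _.
- move=> f xf; rewrite (bigD1 f) //= mulrDl divfK ?gt_eqF //.
  have : 0 <= (\sum_(i | i != f) (`|y i| + 1) / x i) * x f.
    by apply: mulr_ge0 => //; apply: sumr_ge0.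
  by have := ler_norm (- y f); rewrite normrN; lra.
- by move=> f ->; rewrite mulr0 addr0.
Qed.

Lemma pos_full M n : exists y, [/\ cyc M y, forall f, 0 <= y f,
  forall f, y f != 0 -> (n <= rk f)%N & forall e, pos M n e -> 0 < y e].
Proof.
have /choice[v vP] : forall e, exists y, [/\ cyc M y, forall f, 0 <= y f,
    forall f, y f != 0 -> (n <= rk f)%N & pos M n e -> 0 < y e].
  move=> e; have [[y [cy y0 yn ye]]|npe] := pselect (pos M n e); first by exists y.
  exists (fun=> 0); split=> //; exact: cyc0.
exists (fun e => \sum_i 1 * v i e); split.
- by apply: cyc_sum => i _; have [] := vP i.
- by move=> f; apply: sumr_ge0 => i _; rewrite mul1r; have [] := vP i.
- move=> f; apply: contraR => nf; apply/eqP/big1 => i _.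
  have [_ _ vn _] := vP i; rewrite mul1r; apply/eqP; apply: contraR nf; exact: vn.
- move=> e pe; rewrite (bigD1 e) //= mul1r ltr_wpDr //.
    by apply: sumr_ge0 => i _; rewrite mul1r; have [] := vP i.
  by have [_ _ _] := vP e; apply.
Qed.

Lemma cbip_full M p : cbip M p -> exists y, [/\ cyc M y, forall f, 0 <= y f
  & forall e, e \in ground M -> 0 < y e].
Proof.
by case=> p0 _; have [y [cy y0 _ yp]] := pos_full M 0; exists y; split=> // e /p0/yp.
Qed.

Lemma cbip_del_of M w p : cbip M p ->
  (forall e, e \in ground M -> e != w -> pos (del M [set w]) 0 e) ->
  cbip (del M [set w]) p.
Proof.
move=> [_ p2] p1; split=> [e|y [cy _]]; last exact: p2.
by rewrite in_del1 => /andP[ew ge]; exact: p1.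
Qed.

Lemma cbip_con_of M w p : p != w -> cbip M p ->
  (forall z, cyc M z -> (forall f, f != w -> 0 <= z f) ->
     (exists2 f, f != w & z f != 0) -> z p != 0) ->
  cbip (con M [set w]) p.
Proof.
move=> pw cbM H; have [Y [cY Y0 Yp]] := cbip_full cbM.
split=> [e|_ [z cz ->] z0 [f]].
  rewrite in_del1 => /andP[ew ge].
  exists (fun e => if e \in [set w] then 0 else Y e); split=> //.
  - by exists Y.
  - by move=> f; case: ifP.
  - by rewrite inE (negbTE ew) Yp.
rewrite inE; case: (eqVneq f w) => [//|fw zf].
have z0' g : g != w -> 0 <= z g.
  by move=> gw; have := z0 g; rewrite inE (negbTE gw).
rewrite inE (negbTE pw) lt_def z0' // andbT; apply: H => //.
by exists f.
Qed.

(** If contracting w fails to be cyclic-bipolar, there is a flow z avoiding p that is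
    nonnegative but at w; combined with a flow positive everywhere it cancels at w, which
    gives a flow positive on all the edges of the deletion. *)
Lemma cbip_del_or_con M w p : p != w -> w \in ground M -> cbip M p ->
  cbip (del M [set w]) p \/ cbip (con M [set w]) p.
Proof.
move=> pw gw cbM; have [Y [cY Y0 Yp]] := cbip_full cbM.
have [[z [cz z0 zn zp]]|H] := pselect (exists z, [/\ cyc M z,
  forall f, f != w -> 0 <= z f, exists2 f, f != w & z f != 0 & z p = 0]); last first.
  right; apply: cbip_con_of => // z cz z0 zn; apply/eqP => zp; apply: H.
  by exists z.
left; apply: cbip_del_of => // e ge ew.
have zw : z w < 0.
  rewrite ltNge; apply/negP => zw; have z0' f : 0 <= z f.
    by have [->|/z0] := eqVneq f w.
  case: zn => f _ zf; have := cbM.2 z cz z0' (ex_intro _ f zf).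
  by rewrite zp ltxx.
have Yw := Yp w gw.
have c0 : 0 < - (z w / Y w) by rewrite -mulNr divr_gt0 // oppr_gt0.
exists (fun e => z e - z w / Y w * Y e); split.
- split; first exact: cyc_elim.
  by move=> f; rewrite inE => /eqP ->; field; exact: lt0r_neq0.
- move=> f; have [->|fw] := eqVneq f w.
    by rewrite divfK ?subrr // lt0r_neq0.
  by rewrite -mulNr addr_ge0 ?z0 // mulr_ge0 // ltW.
- by [].
- by rewrite -mulNr ltr_wpDl ?z0 // mulr_gt0 // Yp.
Qed.

(** Two flows that are positive everywhere but at w, with opposite signs at w, combine to
    one that vanishes there; and a flow that is nonnegative off w is nonnegative in M or
    after w is reversed, so that it contains p. *)
Lemma cbip_flip_both M w p : p != w -> w \in ground M -> cbip M p ->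
  cbip (flip [set w] M) p ->
  cbip (del M [set w]) p /\ cbip (con M [set w]) p.
Proof.
move=> pw gw cbM cbF; have [Y [cY Y0 Yp]] := cbip_full cbM.
have [Z [cZ Z0 Zp]] := cbip_full cbF; set z := flipv [set w] Z.
have zE f : f != w -> z f = Z f by move=> fw; rewrite /z /flipv inE (negbTE fw).
have zw : z w < 0 by rewrite /z /flipv inE eqxx oppr_lt0 Zp.
split; [apply: cbip_del_of => // e ge ew|apply: cbip_con_of => // y cy y0 [f fw yf]].
  have Yw := Yp w gw.
  have c0 : 0 < - (z w / Y w) by rewrite -mulNr divr_gt0 // oppr_gt0.
  exists (fun e => z e - z w / Y w * Y e); split.
  - split; first exact: cyc_elim.
    by move=> f; rewrite inE => /eqP ->; field; exact: lt0r_neq0.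
  - move=> f; have [->|fw] := eqVneq f w.
      by rewrite divfK ?subrr // lt0r_neq0.
    by rewrite -mulNr zE //; apply: addr_ge0 => //; rewrite mulr_ge0 // ltW.
  - by [].
  - by rewrite -mulNr zE // ltr_wpDl // mulr_gt0 // Yp.
apply: lt0r_neq0; have [yw|yw] := leP 0 (y w).
  apply: cbM.2 => //; last by exists f.
  by move=> g; have [->|/y0] := eqVneq g w.
have <- : flipv [set w] y p = y p by rewrite /flipv inE (negbTE pw).
apply: cbF.2; first exact: cyc_flip.
  move=> g; rewrite /flipv inE; case: eqVneq => [->|/y0 //].
  by rewrite oppr_ge0 ltW.
by exists f; rewrite flipv_eq0.
Qed.

Lemma cbip_not_isthmus M p w : w \in ground M -> cbip M p -> ~ isthmus M w.
Proof.
move=> gw [/(_ w gw)[y [cy _ _ yw]] _] [t ct [tw t0]].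
have := orth cy ct; rewrite (bigD1 w) //= big1; last by move=> f /t0 ->; rewrite mulr0.
by rewrite addr0 => /eqP; rewrite mulf_eq0 (negbTE tw) gt_eqF.
Qed.

Lemma cbip_not_loop M p w : p != w -> cbip M p -> ~ loop M w.
Proof.
move=> pw [_ cb] [y /= cy [yw y0]].
wlog {yw} yw : y cy y0 / 0 < y w.
  move=> H; case: (ltgtP (y w) 0) yw => // yw _; last exact: (H y).
  apply: (H (fun e => - y e)); [exact: cycN| |by rewrite oppr_gt0].
  by move=> f /y0 ->; rewrite oppr0.
suff : 0 < y p by rewrite (y0 p pw) ltxx.
apply: cb => //.
  by move=> f; have [->|/y0 -> //] := eqVneq f w; exact: ltW.
by exists w; exact: lt0r_neq0.
Qed.

Lemma max_of_exists M p : p \in ground M -> exists w, max_of M w.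
Proof.
by move=> gp; case: (@arg_maxnP _ p (fun e => e \in ground M) (@rk _ _) gp) => w gw wm; exists w.
Qed.

(** The tree of a minor at w serves M or M with w reversed.  If the latter is not
    cyclic-bipolar it has no such tree; if it is, both minors are cyclic-bipolar, and the two
    trees, one avoiding w and the other not, cannot both be the unique tree of the
    reoriented matroid. *)
Theorem FO_exists M p : min_of M p -> cbip M p -> exists2 T, FO M p T & p \notin T.
Proof.
have [n] := ubnP #|ground M|; elim: n => // n IH in M p *.
rewrite ltnS => len pm cbM; have gp := pm.1.
have [w wm] := max_of_exists gp.
have gw := wm.1.
have [wp|wp] := eqVneq w p.
  exists set0; rewrite ?inE //.
  have gd1 e : e \in ground M -> e = p.
    move=> ge; apply: rk_inj; apply/eqP; rewrite eqn_leq pm.2 // andbT -wp.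
    exact: wm.2.
  split; last by move=> b; rewrite inE.
  - split; first exact: sub0set.
    + by move=> y _ y0 e; apply: y0; rewrite inE.
    + move=> t ct _ e; have [ge|/(coc_ground ct) //] := boolP (e \in ground M).
      rewrite (gd1 e ge); apply/eqP/contraT => tp.
      case: (cbip_not_isthmus gp cbM); exists t => //; split=> // f fp.
      have [gf|/(coc_ground ct) //] := boolP (f \in ground M).
      by rewrite (gd1 f gf) eqxx in fp.
  - by move=> e ge _; rewrite (gd1 e ge) eqxx.
have pw : p != w by rewrite eq_sym.
have ni := cbip_not_isthmus gw cbM; have nl := cbip_not_loop pw cbM.
have ltn1 : (#|ground M :\ w| < n)%N.
  by move: len; rewrite (cardsD1 w) gw.
have pD : min_of (del M [set w]) p by exact: del_min.
have pC : min_of (con M [set w]) p by exact: (@del_min (dual M)).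
have liftD : cbip (del M [set w]) p -> exists T,
    [/\ p \notin T, w \notin T & FO M p T \/ FO (flip [set w] M) p T].
  move=> /(IH (del M [set w]) p ltn1 pD)[T FT pT]; exists T; split=> //.
    by case: FT => -[/=]; rewrite subsetD1 => /andP[].
  exact: FO_lift_del FT.
have liftC : cbip (con M [set w]) p -> exists T,
    [/\ p \notin T, w \in T & FO M p T \/ FO (flip [set w] M) p T].
  move=> /(IH (con M [set w]) p ltn1 pC)[T FT pT]; exists (w |: T); split=> //.
  - by rewrite !inE negb_or pw.
  - by rewrite !inE eqxx.
  - exact: FO_lift_con FT.
suff [nF|[cD cC]] : ~ cbip (flip [set w] M) p \/
    cbip (del M [set w]) p /\ cbip (con M [set w]) p.
- have noF T : p \notin T -> FO (flip [set w] M) p T -> False.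
    by move=> pT FT; apply: nF; exact: (@FO_cbip _ _ (flip [set w] M) p T).
  have [/liftD|/liftC] := cbip_del_or_con pw gw cbM => -[T [pT _ [|/noF]]];
    by [exists T|].
- have [T1 [p1 w1 [|F1]]] := liftD cD; first by exists T1.
  have [T2 [p2 w2 [|F2]]] := liftC cC; first by exists T2.
  have eqT : T1 = T2 by apply: (@FO_uniq _ _ (flip [set w] M) p T1 T2 gp F1 F2); rewrite (negbTE p1) (negbTE p2).
  by move: w1; rewrite eqT w2.
have [cF|] := pselect (cbip (flip [set w] M) p); [right|by left].
exact: cbip_flip_both.
Qed.

End Existence.

(** * Levels and active minors *)

Section ActivePartition.

Context (d : Order.disp_t) (E : finOrderType d).
Implicit Types (A B W F T X Y : {set E}) (e f g p w : E) (y z t : E -> rat).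
Implicit Types M N : omat E.

Definition lvl M n : {set E} := [set e | `[< pos M n e >]].

Lemma in_lvl M n e : reflect (pos M n e) (e \in lvl M n).
Proof. by rewrite inE; exact: asboolP. Qed.

Lemma pos_ground M n e : pos M n e -> e \in ground M.
Proof.
move=> [y [cy _ _ ye]]; apply: contraLR ye => /(cyc_ground cy) ->.
by rewrite ltxx.
Qed.

Lemma pos_rk M n e : pos M n e -> (n <= rk e)%N.
Proof. by move=> [y [_ _ yn /lt0r_neq0 /yn]]. Qed.

Lemma pos_le M n m e : (n <= m)%N -> pos M m e -> pos M n e.
Proof. by move=> nm [y [cy y0 ym ye]]; exists y; split=> // f /ym; exact: leq_trans. Qed.

Lemma lvl_anti M n m : (n <= m)%N -> lvl M m \subset lvl M n.
Proof. by move=> nm; apply/subsetP => e /in_lvl pe; apply/in_lvl; exact: pos_le pe. Qed.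

Lemma pos_of M y n e : cyc M y -> (forall f, 0 <= y f) ->
  (forall f, y f != 0 -> (n <= rk f)%N) -> y e != 0 -> pos M n e.
Proof. by move=> cy y0 yn ye; exists y; split=> //; rewrite lt_def ye y0. Qed.

Lemma lvl_full M n : exists y, [/\ cyc M y, forall f, 0 <= y f,
  forall f, y f != 0 -> (n <= rk f)%N & forall f, (0 < y f) = (f \in lvl M n)].
Proof.
have [y [cy y0 yn ye]] := pos_full M n; exists y; split=> // f.
by apply/idP/in_lvl => [/lt0r_neq0|/ye //]; exact: pos_of.
Qed.

Lemma lvl_full_out M n y : (forall f, 0 <= y f) -> (forall f, (0 < y f) = (f \in lvl M n)) ->
  forall f, f \notin lvl M n -> y f = 0.
Proof. by move=> y0 yU f; rewrite -yU lt_def y0 andbT negbK => /eqP. Qed.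

(** An active minor of the cyclic kind; those of the acyclic kind are the
    [dual (part (dual M) n)].  A part may be empty, and n is the rank of its smallest edge
    otherwise ([part_inhabited]). *)
Definition part M n : omat E := con (del M (~: lvl M n)) (lvl M n.+1).

Lemma in_part M n e : (e \in ground (part M n)) = (e \in lvl M n) && (e \notin lvl M n.+1).
Proof.
rewrite !in_setD in_setC negbK andbC; case: (boolP (e \in lvl M n)) => //=.
by move=> /in_lvl/pos_ground ->.
Qed.

Lemma cyc_part M n y : cyc (part M n) y <->
  exists y', [/\ cyc M y', forall e, e \notin lvl M n -> y' e = 0 &
                 y = fun e => if e \in lvl M n.+1 then 0 else y' e].
Proof.
split=> [[y' [/= cy y0] ->]|[y' [cy y0 ->]]].
  by exists y'; split=> // e eU; apply: y0; rewrite inE.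
by exists y' => //=; split=> // e; rewrite inE; exact: y0.
Qed.

Lemma part_inhabited M n e : e \in ground (part M n) ->
  exists2 p, min_of (part M n) p & rk p = n.
Proof.
rewrite in_part => /andP[/in_lvl [y [cy y0 yn ye]] eU].
have [p [yp rp]] : exists p, y p != 0 /\ rk p = n.
  apply: contrapT => H; case/in_lvl: eU; exists y; split=> // f yf.
  rewrite ltn_neqAle yn // andbT; apply/eqP => nf; apply: H.
  by exists f.
exists p => //; split; last first.
  by move=> f; rewrite in_part rp => /andP[/in_lvl/pos_rk].
rewrite in_part; apply/andP; split; first by apply/in_lvl; exact: pos_of yp.
by apply/in_lvl => /pos_rk; rewrite rp ltnn.
Qed.

Lemma rk_min_part M n p : min_of (part M n) p -> rk p = n.
Proof.
move=> [gp pm]; have [q [gq qm] <-] := part_inhabited gp.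
by apply/eqP; rewrite eqn_leq pm // qm.
Qed.

Lemma part_of_pos M e : pos M 0 e -> exists n, e \in ground (part M n).
Proof.
move=> p0; have ex : exists n, e \in lvl M n by exists 0; apply/in_lvl.
have [|n nU nm] := @ex_maxnP (fun n => e \in lvl M n) (rk e) ex.
  by move=> n /in_lvl/pos_rk.
by exists n; rewrite in_part nU; apply/negP => /nm; rewrite ltnn.
Qed.

Lemma level_total M e : e \in ground M ->
  (exists n, e \in ground (part M n)) \/ (exists n, e \in ground (part (dual M) n)).
Proof. by move=> /pos_total[] /part_of_pos; [left|right]. Qed.

Lemma part_uniq M n m e : e \in ground (part M n) -> e \in ground (part M m) -> n = m.
Proof.
wlog le : n m / (n < m)%N.
  by move=> H; case: (ltngtP n m) => // lt h1 h2; [exact: H|apply/esym/H].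
rewrite !in_part => /andP[_ eU] /andP[/(subsetP (lvl_anti M le))]; by rewrite (negbTE eU).
Qed.

Lemma part_excl M n m e : e \in ground (part M n) -> e \in ground (part (dual M) m) -> False.
Proof. by rewrite !in_part => /andP[/in_lvl p1 _] /andP[/in_lvl p2 _]; exact: pos_excl p1 p2. Qed.

Lemma part_ground M n e : e \in ground (part M n) -> e \in ground M.
Proof. by rewrite in_part => /andP[/in_lvl/pos_ground]. Qed.

Lemma part_max M n w : max_of M w -> w \in ground (part M n) -> max_of (part M n) w.
Proof. by move=> [_ wm] gw; split=> // f /part_ground; exact: wm. Qed.

(** A nonnegative flow of the part that avoids p extends to a flow of M; a multiple of a
    positive flow on the next level makes the extension nonnegative, so that its support
    lies in the next level, and it is zero on the part. *)
Lemma part_cbip M n p : min_of (part M n) p -> cbip (part M n) p.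
Proof.
move=> pm; have rp := rk_min_part pm; split=> [e|y /cyc_part[y' [cy' y'0 ->]] y0 [f]].
  rewrite in_part => /andP[/in_lvl[y [cy y0 yn ye]] eU].
  exists (fun e => if e \in lvl M n.+1 then 0 else y e); split=> //.
  - apply/cyc_part; exists y; split=> // f fU; apply/eqP; apply: contraNT fU => yf.
    by apply/in_lvl; exact: pos_of yf.
  - by move=> f; case: ifP.
  - by rewrite (negbTE eU).
case: ifPn => [_|fU yf]; first by rewrite eqxx.
have pU : p \notin lvl M n.+1 by case: pm; rewrite in_part => /andP[].
rewrite lt_def y0 andbT (negbTE pU); apply/eqP => yp.
have [z [cz z0 zn zU]] := lvl_full M n.+1.
have [c [c0 c1 c2]] := dominate y' z0.
have zE := lvl_full_out z0 zU.
have zf := zE f fU; case/in_lvl: fU; have cv := cyc_lin 1 c cy' cz.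
have vE g : 1 * y' g + c * z g = y' g + c * z g by rewrite mul1r.
apply: (pos_of cv) => [g|g|]; rewrite vE.
- have [gU|gU] := boolP (g \in lvl M n.+1); first by rewrite ltW // c1 // zU.
  by rewrite c2 ?zE //; have := y0 g; rewrite (negbTE gU).
- have [/in_lvl/pos_rk //|gU] := boolP (g \in lvl M n.+1).
  rewrite c2 ?zE // => yg; rewrite ltn_neqAle; apply/andP; split.
    by rewrite -rp; apply: contraNneq yg => /rk_inj <-; rewrite yp.
  have [/in_lvl/pos_rk //|/y'0 yg0] := boolP (g \in lvl M n).
  by rewrite yg0 eqxx in yg.
- by rewrite c2.
Qed.

Definition same_levels w M N := forall n, lvl N n = lvl M n :\ w.
Definition same_profile w M N := same_levels w M N /\ same_levels w (dual M) (dual N).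

Lemma same_profile_dual w M N : same_profile w M N -> same_profile w (dual M) (dual N).
Proof. by case=> H1 H2; split; rewrite ?dualK. Qed.

Lemma same_levelsP w M N : w \notin ground N ->
  (forall n e, e != w -> pos M n e <-> pos N n e) -> same_levels w M N.
Proof.
move=> wN H n; apply/setP => e; rewrite in_setD1; have [->|ew] /= := eqVneq e w.
  by apply/in_lvl => /pos_ground; rewrite (negbTE wN).
by apply/in_lvl/in_lvl => /(H n e ew).
Qed.

Lemma notin_del M w : w \notin ground (del M [set w]).
Proof. by rewrite in_del1 eqxx. Qed.

Lemma cyc_con1 M w y : cyc M y -> cyc (con M [set w]) (fun e => if e \in [set w] then 0 else y e).
Proof. by exists y. Qed.

Lemma pos_con M w n e : e != w -> pos M n e -> pos (con M [set w]) n e.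
Proof.
move=> ew [y [cy y0 yn ye]]; exists (fun e => if e \in [set w] then 0 else y e); split.
- exact: cyc_con1.
- by move=> f; case: ifP.
- by move=> f; case: ifP => // _; exact: yn.
- by rewrite inE (negbTE ew).
Qed.

Lemma pos_del M w n e : pos (del M [set w]) n e -> pos M n e.
Proof. by move=> [y [[cy _] y0 yn ye]]; exists y. Qed.

Lemma pos_delI M w n e y : cyc M y -> (forall f, 0 <= y f) ->
  (forall f, y f != 0 -> (n <= rk f)%N) -> 0 < y e -> y w = 0 -> pos (del M [set w]) n e.
Proof.
move=> cy y0 yn ye yw; exists y; split=> //; split=> // f.
by rewrite inE => /eqP ->.
Qed.

(** A flow y of M that is nonnegative but at w is to be made nonnegative at w.  At low
    levels one adds a positive flow through w.  At higher levels y lies in the part of w and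
    avoids p, so by cyclic-bipolarity it vanishes on the part but at w, and this would put w
    in the next level. *)
Lemma levels_con M w n0 p : max_of M w -> w \in ground (part M n0) ->
  min_of (part M n0) p -> p != w -> cbip (con (part M n0) [set w]) p ->
  same_profile w M (con M [set w]).
Proof.
move=> wm gw pm pw [_ cb]; have rp := rk_min_part pm.
have [wU wU'] : w \in lvl M n0 /\ w \notin lvl M n0.+1.
  by move: gw; rewrite in_part => /andP.
have rw : (n0 < rk w)%N.
  by rewrite -rp; apply: max_neq wm _ pw; exact: part_ground pm.1.
have [x [cx x0 xn xU]] := lvl_full M n0.
have xw : 0 < x w by rewrite xU.
split; apply: same_levelsP; try exact: notin_del.
  move=> n e ew; split; first exact: pos_con.
  case=> _ [[y cy ->] y0 yn]; rewrite inE (negbTE ew) => ye.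
  have y0' f : f != w -> 0 <= y f.
    by move=> fw; have := y0 f; rewrite inE (negbTE fw).
  have yn' f : f != w -> y f != 0 -> (n <= rk f)%N.
    by move=> fw yf; apply: yn; rewrite inE (negbTE fw).
  have nw : (n <= rk w)%N.
    apply: leq_trans (yn' e ew (lt0r_neq0 ye)) (wm.2 _ _).
    by apply: contraLR ye => /(cyc_ground cy) ->; rewrite ltxx.
  have [yw|yw] := leP 0 (y w).
    exists y; split=> // f; first by have [->|/y0'] := eqVneq f w.
    by have [->|/yn'] := eqVneq f w.
  set c := - (y w / x w).
  have c0 : 0 < c by rewrite /c -mulNr divr_gt0 // oppr_gt0.
  have vw : y w + c * x w = 0 by rewrite /c; field; exact: lt0r_neq0.
  have cv : cyc M (fun f => y f + c * x f).
    by apply: cyc_ext (cyc_lin 1 c cy cx) => f; rewrite mul1r.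
  have v0 f : 0 <= y f + c * x f.
    have [->|fw] := eqVneq f w; first by rewrite vw.
    by rewrite addr_ge0 ?y0' // mulr_ge0 // ltW.
  have vpos f : f != w -> y f != 0 -> 0 < y f + c * x f.
    move=> fw yf; rewrite ltr_wpDr //; first by rewrite mulr_ge0 // ltW.
    by rewrite lt_def yf y0'.
  have [n_n0|n0_n] := leqP n n0.
    exists (fun f => y f + c * x f); split=> //; last exact/vpos/lt0r_neq0.
    move=> f; have [->|fw] := eqVneq f w; first by rewrite vw eqxx.
    have [yf|/yn'->//] := eqVneq (y f) 0.
    rewrite yf add0r mulf_eq0 negb_or => /andP[_ /xn]; exact: leq_trans.
  have inU0 f : y f != 0 -> f \in lvl M n0.
    move=> yf; have [->//|fw] := eqVneq f w.
    apply/in_lvl; exists (fun f => y f + c * x f); split=> //; last exact: vpos.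
    move=> g; have [->|gw'] := eqVneq g w; first by rewrite vw eqxx.
    have [yg|yg _] := eqVneq (y g) 0.
      by rewrite yg add0r mulf_eq0 negb_or => /andP[_ /xn].
    exact: leq_trans (ltnW n0_n) (yn' g gw' yg).
  (* n0 < n: the trace of y on the part avoids p, which has rank n0 *)
  have y_out f : f != w -> f \notin lvl M n0.+1 -> y f = 0.
    move=> fw fU; apply/eqP/contraT => yf.
    pose v g := if g \in [set w] then 0 else if g \in lvl M n0.+1 then 0 else y g.
    have /cb : cyc (con (part M n0) [set w]) v.
      apply: cyc_con1; apply/cyc_part; exists y; split=> // g.
      by move=> gU; apply/eqP; apply: contraNT gU; exact: inU0.
    have -> : v p = 0.
      rewrite /v; case: ifP => // _; case: ifP => // _; apply/eqP.
      by apply: contraLR n0_n => /(yn' p pw); rewrite rp -leqNgt.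
    rewrite ltxx => H; apply: H.
      by move=> g; rewrite /v inE; case: (eqVneq g w) => // gw'; case: ifP => // _; exact: y0'.
    by exists f; rewrite /v inE (negbTE fw) (negbTE fU).
  have [z [cz z0 zn zU]] := lvl_full M n0.+1.
  have [k [k0 k1 k2]] := dominate (fun f => - y f) z0.
  have zE := lvl_full_out z0 zU.
  have zw := zE w wU'; case/in_lvl: wU'.
  have cu : cyc M (fun f => - y f + k * z f).
    by apply: cyc_ext (cyc_lin (-1) k cy cz) => f; rewrite mulN1r.
  apply: (pos_of cu) => [g|g|].
  - have [gU|gU] := boolP (g \in lvl M n0.+1); first by rewrite ltW // k1 // zU.
    rewrite k2 ?zE //; have [->|gw'] := eqVneq g w; first by rewrite oppr_ge0 ltW.
    by rewrite y_out // oppr0.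
  - have [/in_lvl/pos_rk //|gU] := boolP (g \in lvl M n0.+1).
    rewrite k2 ?zE //; have [->|gw'] := eqVneq g w; first by [].
    by rewrite y_out // oppr0 eqxx.
  - by rewrite k2 ?oppr_eq0 ?lt_eqF.
move=> n e ew; rewrite dual_con; split; last exact: pos_del.
case=> t [/= ct t0 tn te]; apply: pos_delI te _ => //.
have /eqP := pos_orth cx ct (fun f => mulr_ge0 (x0 f) (t0 f)) w.
by rewrite mulf_eq0 gt_eqF //= => /eqP.
Qed.

(** Cyclic-bipolarity of the deletion gives a positive flow v on the level of w that vanishes
    exactly at w.  Subtracting a flow through w from a multiple of v gives a flow negative
    only at w, which is used to cancel at w any positive flow.  Orthogonality to v also
    settles the levels of the dual. *)
Lemma levels_del M w n0 p : max_of M w -> w \in ground (part M n0) ->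
  min_of (part M n0) p -> p != w -> cbip (del (part M n0) [set w]) p ->
  same_profile w M (del M [set w]).
Proof.
move=> wm gw pm pw cb; have rp := rk_min_part pm.
have [wU wU'] : w \in lvl M n0 /\ w \notin lvl M n0.+1.
  by move: gw; rewrite in_part => /andP.
have [x [cx x0 xn xU]] := lvl_full M n0.
have [z [cz z0 zn zU]] := lvl_full M n0.+1.
have xw : 0 < x w by rewrite xU.
have zE := lvl_full_out z0 zU.
have xE := lvl_full_out x0 xU.
have [v [cv v0 vw vU]] : exists v, [/\ cyc M v, forall f, 0 <= v f, v w = 0 &
    forall f, f != w -> (0 < v f) = (f \in lvl M n0)].
  have [_ [[/cyc_part[y [cy yU ->]] yw] y0 yp]] := cbip_full cb.
  have [c [c0 c1 c2]] := dominate y z0.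
  have yw0 : y w = 0 by have := yw w; rewrite inE eqxx (negbTE wU') => ->.
  have pU f : f != w -> (0 < y f + c * z f) = (f \in lvl M n0).
    move=> fw; have [fU'|fU'] := boolP (f \in lvl M n0.+1).
      by rewrite c1 ?zU // (subsetP (lvl_anti M (leqnSn n0))).
    rewrite c2 ?zE //; have [fU|/yU ->] := boolP (f \in lvl M n0); last by rewrite ltxx.
    have := yp f; rewrite in_del1 fw in_part fU fU' (negbTE fU'); exact.
  exists (fun f => y f + c * z f); split=> //.
  - by apply: cyc_ext (cyc_lin 1 c cy cz) => f; rewrite mul1r.
  - move=> f; have [->|fw] := eqVneq f w; first by rewrite yw0 zE // mulr0 addr0.
    have [fU|fU] := boolP (f \in lvl M n0); first by rewrite ltW // pU.
    rewrite yU // zE ?mulr0 ?addr0 //; apply: contraNN fU; exact: (subsetP (lvl_anti M (leqnSn n0))).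
  - by rewrite yw0 zE // mulr0 addr0.
have vn f : v f != 0 -> (n0 <= rk f)%N.
  move=> vf; have [fw|fw] := eqVneq f w; first by rewrite fw vw eqxx in vf.
  by have := vU f fw; rewrite lt_def vf v0 => /esym /in_lvl/pos_rk.
have vpos_eq0 g : g != w -> v g = 0 -> x g = 0.
  by move=> gw' vg; apply: xE; rewrite -vU // vg ltxx.
have posE n e : e != w -> pos M n e <-> pos (del M [set w]) n e.
  move=> ew; split; last exact: pos_del.
  case=> y [cy y0 yn ye]; have [yw|yw] := eqVneq (y w) 0; first exact: pos_delI cy _ _ ye yw.
  have nn0 : (n <= n0)%N.
    rewrite leqNgt; apply/negP => lt; case/in_lvl: wU'.
    by apply: pos_le lt _; exact: pos_of yw.
  have [c [c0 c1 c2]] := dominate (fun f => - x f) v0.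
  set k := y w / x w.
  have k0 : 0 <= k by rewrite divr_ge0.
  have cu : cyc M (fun f => y f + k * (- x f + c * v f)).
    have cu1 := cyc_lin (-1) c cx cv.
    by apply: cyc_ext (cyc_lin 1 k cy cu1) => f; rewrite mul1r mulN1r.
  have u1 f : f != w -> 0 <= - x f + c * v f.
    move=> fw; have [vf|vf] := eqVneq (v f) 0.
      by rewrite vf (vpos_eq0 f) // mulr0 oppr0 addr0.
    by rewrite ltW // c1 // lt_def vf v0.
  have uw : y w + k * (- x w + c * v w) = 0.
    by rewrite vw mulr0 addr0 /k; field; exact: lt0r_neq0.
  apply: (pos_delI cu) => //.
  - move=> f; have [->|fw] := eqVneq f w; first by rewrite uw.
    by rewrite addr_ge0 // mulr_ge0 // u1.
  - move=> f; have [->|fw] := eqVneq f w; first by rewrite uw eqxx.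
    have [yf|/yn //] := eqVneq (y f) 0.
    have [vf|/vn] := eqVneq (v f) 0; last by move=> h _; exact: leq_trans h.
    by rewrite vf (vpos_eq0 f) // yf mulr0 oppr0 !addr0 mulr0 eqxx.
  - by rewrite ltr_wpDr // mulr_ge0 // u1.
split; apply: same_levelsP => //; try exact: notin_del.
move=> n e ew; rewrite dual_del; split; first exact: pos_con.
case=> _ [[t ct ->] t0 tn]; rewrite inE (negbTE ew) => te.
have t0' f : f != w -> 0 <= t f.
  by move=> fw; have := t0 f; rewrite inE (negbTE fw).
have tn' f : f != w -> t f != 0 -> (n <= rk f)%N.
  by move=> fw tf; apply: tn; rewrite inE (negbTE fw).
have nw : (n <= rk w)%N.
  apply: leq_trans (tn' e ew (lt0r_neq0 te)) (wm.2 _ _).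
  by apply: contraLR te => /(coc_ground ct) ->; rewrite ltxx.
suff tw : 0 <= t w.
  exists t; split=> // f; first by have [->|/t0'] := eqVneq f w.
  by have [->|/tn'] := eqVneq f w.
rewrite leNgt; apply/negP => tw.
have ge0 f : 0 <= v f * t f.
  have [->|fw] := eqVneq f w; first by rewrite vw mul0r.
  by rewrite mulr_ge0 // t0'.
have vt := pos_orth cv ct ge0.
have := orth cx ct; rewrite (bigD1 w) //= big1.
  by rewrite addr0 => /eqP; rewrite mulf_eq0 gt_eqF // lt_eqF.
move=> f fw; have /eqP := vt f; rewrite mulf_eq0 => /orP[/eqP vf|/eqP ->].
  by rewrite (vpos_eq0 f) // mul0r.
by rewrite mulr0.
Qed.

End ActivePartition.

(** * Active bases *)

Section ActiveBasis.

Context (d : Order.disp_t) (E : finOrderType d).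
Implicit Types (A B W F T X Y : {set E}) (e f g p w : E) (y z t : E -> rat).
Implicit Types M N : omat E.

Lemma omat_eq0 M N : ground M =i set0 -> ground N =i set0 -> M = N.
Proof.
move=> M0 N0; apply: omat_eq => [|y]; first by apply/setP => e; rewrite M0 N0.
suff H K : ground K =i set0 -> cyc K y -> y = fun=> 0.
  by split=> [/(H M M0)|/(H N N0)] ->; exact: cyc0.
by move=> K0 cy; apply/funext => e; apply: (cyc_ground cy); rewrite K0 inE.
Qed.

Lemma levels_ground w M N n : same_levels w M N ->
  ground (part N n) = ground (part M n) :\ w.
Proof.
move=> sl; apply/setP => e; rewrite in_setD1 !in_part !sl !in_setD1.
by case: (e == w) => //=; rewrite !andbF.
Qed.

Lemma part_del_in M w n : same_levels w M (del M [set w]) -> w \in ground (part M n) ->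
  part (del M [set w]) n = del (part M n) [set w].
Proof.
move=> sl; rewrite in_part => /andP[wU wU']; apply: omat_eq; first exact: levels_ground.
move=> y; split.
  move=> /cyc_part[y' [[cy yw] yU ->]]; have yw' : y' w = 0 by apply: yw; rewrite inE.
  split; last by move=> e; rewrite inE => /eqP ->; rewrite yw' if_same.
  apply/cyc_part; exists y'; split=> //.
    move=> e eU; have [->//|ew] := eqVneq e w.
    by apply: yU; rewrite sl in_setD1 (negbTE eU) andbF.
  apply/funext => e; rewrite sl in_setD1; case: eqVneq => [->|//] /=.
  by rewrite yw' if_same.
case=> /cyc_part[y' [cy yU ->]] yw; have yw' : y' w = 0.
  by have := yw w; rewrite inE eqxx (negbTE wU') => ->.
apply/cyc_part; exists y'; split=> //.
- by split=> // e; rewrite inE => /eqP ->.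
- move=> e; rewrite sl in_setD1 negb_and negbK => /orP[/eqP -> //|]; exact: yU.
- apply/funext => e; rewrite sl in_setD1; case: eqVneq => [->|//] /=.
  by rewrite yw' if_same.
Qed.

Lemma part_con_in M w n : same_levels w M (con M [set w]) -> w \in ground (part M n) ->
  part (con M [set w]) n = con (part M n) [set w].
Proof.
move=> sl; rewrite in_part => /andP[wU wU']; apply: omat_eq; first exact: levels_ground.
move=> y; split.
  move=> /cyc_part[_ [[y' cy ->] yU ->]].
  exists (fun e => if e \in lvl M n.+1 then 0 else y' e).
    apply/cyc_part; exists y'; split=> // e eU.
    have := yU e; rewrite sl in_setD1 (negbTE eU) andbF => /(_ isT).
    by rewrite inE; case: eqVneq => // ew; rewrite ew wU in eU.
  apply/funext => e; rewrite sl in_setD1 !in_set1; case: (eqVneq e w) => //= ->.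
case=> _ /cyc_part[y' [cy yU ->]] ->; apply/cyc_part.
exists (fun e => if e \in [set w] then 0 else y' e); split.
- by exists y'.
- move=> e; rewrite sl in_setD1 in_set1; case: eqVneq => //= ew; exact: yU.
- apply/funext => e; rewrite sl in_setD1 !in_set1; case: (eqVneq e w) => //= ->.
Qed.

(** If w lies in the next level it is spanned by the other contracted edges, and can be
    removed from any flow; otherwise w is deleted in both. *)
Lemma part_del_out M w n : same_levels w M (del M [set w]) -> w \notin ground (part M n) ->
  part (del M [set w]) n = part M n.
Proof.
move=> sl wn; apply: omat_eq.
  rewrite (levels_ground n sl); apply/setP => e; rewrite in_setD1.
  by case: eqVneq => // ->; rewrite (negbTE wn).
have wU : w \in lvl M n -> w \in lvl M n.+1.
  by move: wn; rewrite in_part => wn wU; rewrite wU /= negbK in wn.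
move=> y; split.
  move=> /cyc_part[y' [[cy yw] yU ->]]; have yw' : y' w = 0 by apply: yw; rewrite inE.
  apply/cyc_part; exists y'; split=> //.
    move=> e eU; apply: yU; by rewrite sl in_setD1 (negbTE eU) andbF.
  apply/funext => e; rewrite sl in_setD1; case: eqVneq => [->|//] /=.
  by rewrite yw' if_same.
move=> /cyc_part[y' [cy yU ->]]; apply/cyc_part.
have [wU1|wU1] := boolP (w \in lvl M n.+1); last first.
  have wU0 : w \notin lvl M n by apply: contra wU1; exact: wU.
  exists y'; split.
  - by split=> // e; rewrite inE => /eqP ->; exact: yU.
  - move=> e; rewrite sl in_setD1; case: eqVneq => [-> _|_] /=; exact: yU.
  - apply/funext => e; rewrite sl in_setD1; case: eqVneq => [->|//] /=.
    by rewrite (negbTE wU1).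
have [z [cz z0 zn zU]] := lvl_full M n.+1.
have zw : 0 < z w by rewrite zU.
have zE := lvl_full_out z0 zU.
have vw : y' w - y' w / z w * z w = 0 by field; exact: lt0r_neq0.
exists (fun e => y' e - y' w / z w * z e); split.
- split; first exact: cyc_elim.
  by move=> e; rewrite inE => /eqP ->.
- move=> e; rewrite sl in_setD1; have [-> _|ew /= eU] := eqVneq e w; first by rewrite vw.
  rewrite (yU e) // (zE e) ?mulr0 ?subr0 //; apply: contraNN eU.
  exact: (subsetP (lvl_anti M (leqnSn n))).
- apply/funext => e; rewrite sl in_setD1; have [->|ew] /= := eqVneq e w.
    by rewrite wU1 vw.
  by case: ifPn => // /zE ->; rewrite mulr0 subr0.
Qed.

(** Let w be outside a level that is not empty.  A flow on w and the level that is nonzero at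
    w would, after adding a large positive flow on the level, put w in the level.  So there
    is none, and contracting w has the same effect as deleting it. *)
Lemma part_con_out M w n : max_of M w -> same_levels w M (con M [set w]) ->
  w \notin ground (part M n) -> part (con M [set w]) n = part M n.
Proof.
move=> wm sl wn.
have gE : ground (part (con M [set w]) n) = ground (part M n).
  rewrite (levels_ground n sl); apply/setP => e; rewrite in_setD1.
  by case: eqVneq => // ->; rewrite (negbTE wn).
have wU : w \in lvl M n -> w \in lvl M n.+1.
  by move: wn; rewrite in_part => wn wU; rewrite wU /= negbK in wn.
have [nw|wltn] := leqP n (rk w); last first.
  have U0 : ground (part M n) =i set0.
    move=> e; rewrite in_set0; apply/negP => ge; have /wm.2 := part_ground ge.
    move: ge; rewrite in_part => /andP[/in_lvl/pos_rk le _].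
    by rewrite leqNgt (leq_trans wltn).
  by apply: omat_eq0; rewrite // gE.
have [x [cx x0 xn xU]] := lvl_full M n.
apply: omat_eq => // y; split.
  move=> /cyc_part[_ [[y' cy ->] yU ->]].
  have [wU1|wU1] := boolP (w \in lvl M n.+1).
    apply/cyc_part; exists y'; split=> //.
      move=> e eU; have := yU e; rewrite sl in_setD1 (negbTE eU) andbF => /(_ isT).
      rewrite inE; case: eqVneq => // ew; move: eU; rewrite ew.
      by rewrite (subsetP (lvl_anti M (leqnSn n))).
    by apply/funext => e; rewrite sl in_setD1 in_set1; case: eqVneq => // ->; rewrite wU1.
  have wU0 : w \notin lvl M n by apply: contra wU1; exact: wU.
  have yU' e : e != w -> e \notin lvl M n -> y' e = 0.
    move=> ew eU; have := yU e; rewrite sl in_setD1 (negbTE eU) andbF => /(_ isT).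
    by rewrite inE (negbTE ew).
  have yw : y' w = 0.
    apply/eqP/contraT => yw; have xw : x w = 0.
      by apply/eqP; move: wU0; rewrite -xU lt_def x0 andbT negbK.
    wlog {yw} yw : y' cy yU yU' / 0 < y' w.
      move=> H; case: (ltgtP (y' w) 0) yw => // yw _; last exact: (H y').
      apply: (H (fun e => - y' e)); [exact: cycN| | |by rewrite oppr_gt0].
        by move=> e /yU; case: ifP => // _ ->; rewrite oppr0.
      by move=> e ew /(yU' e ew) ->; rewrite oppr0.
    have [c [c0 c1 c2]] := dominate y' x0.
    case/in_lvl: wU0; exists (fun e => y' e + c * x e); split.
    - by apply: cyc_ext (cyc_lin 1 c cy cx) => f; rewrite mul1r.
    - move=> f; have [fU|fU] := boolP (f \in lvl M n); first by rewrite ltW // c1 // xU.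
      have xf : x f = 0 by apply/eqP; move: fU; rewrite -xU lt_def x0 andbT negbK.
      rewrite c2 //; have [->|fw] := eqVneq f w; first exact: ltW.
      by rewrite yU'.
    - move=> f; have [->//|fw] := eqVneq f w; have [/in_lvl/pos_rk //|fU] := boolP (f \in lvl M n).
      have xf : x f = 0 by apply/eqP; move: fU; rewrite -xU lt_def x0 andbT negbK.
      by rewrite c2 // yU' // eqxx.
    - by rewrite c2.
  apply/cyc_part; exists y'; split=> //.
    by move=> e eU; have [->//|ew] := eqVneq e w; exact: yU'.
  apply/funext => e; rewrite sl in_setD1 in_set1; case: (eqVneq e w) => [->|_] //=.
  by rewrite (negbTE wU1).
move=> /cyc_part[y' [cy yU ->]]; apply/cyc_part.
exists (fun e => if e \in [set w] then 0 else y' e); split.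
- by exists y'.
- move=> e; rewrite sl in_setD1 in_set1; case: eqVneq => //= ew; exact: yU.
- apply/funext => e; rewrite sl in_setD1 !in_set1; case: (eqVneq e w) => //= ->.
  by case: ifPn => // wU1; rewrite yU //; apply: contra wU1; exact: wU.
Qed.

Definition partFO M T := forall n p, min_of (part M n) p ->
  FO (part M n) p (T :&: ground (part M n)) /\ p \notin T.

(** Both kinds of active minors are required to have the trace of T as their fully optimal
    basis, the second kind through the complement of T in the dual matroid. *)
Definition active_basis M T :=
  [/\ T \subset ground M, partFO M T & partFO (dual M) (ground M :\: T)].

Lemma active_basis_dual M T : active_basis M T -> active_basis (dual M) (ground M :\: T).
Proof.
by case=> sT F1 F2; split; rewrite ?dualK /= ?setDDK //; exact: subsetDl.
Qed.

Lemma partFO_del M w T : max_of M w -> w \notin T ->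
  same_levels w M (del M [set w]) -> partFO M T -> partFO (del M [set w]) T.
Proof.
move=> wm wT sl FT n p; have [wn|wn] := boolP (w \in ground (part M n)).
  rewrite part_del_in // => pm; have wm' := part_max wm wn.
  have [FOp pT] := FT n p (min_del wm' pm); split=> //=.
  suff -> : T :&: (ground (part M n) :\ w) = T :&: ground (part M n).
    by apply: FO_del FOp; rewrite // inE (negbTE wT).
  apply/setP => e; rewrite !in_setI in_setD1; case: eqVneq => // ->.
  by rewrite (negbTE wT).
by rewrite part_del_out //; exact: FT.
Qed.

Lemma partFO_con M w T : max_of M w -> w \in T ->
  same_levels w M (con M [set w]) -> partFO M T -> partFO (con M [set w]) (T :\ w).
Proof.
move=> wm wT sl FT n p; have [wn|wn] := boolP (w \in ground (part M n)).
  rewrite part_con_in // => pm; have wm' := part_max wm wn.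
  have [FOp pT] := FT n p (@min_del _ _ (dual (part M n)) w p wm' pm).
  rewrite in_setD1 (negbTE pT) andbF; split=> //=.
  have -> : (T :\ w) :&: (ground (part M n) :\ w) = (T :&: ground (part M n)) :\ w.
    by rewrite -setDIl.
  by apply: FO_con FOp; rewrite // inE wT.
rewrite part_con_out // => pm; have [FOp pT] := FT n p pm.
rewrite in_setD1 (negbTE pT) andbF; split=> //.
suff -> : (T :\ w) :&: ground (part M n) = T :&: ground (part M n) by [].
apply/setP => e; rewrite !in_setI in_setD1; case: eqVneq => //= ->.
by rewrite (negbTE wn) andbF.
Qed.

Lemma active_basis_del M w T : max_of M w -> w \notin T ->
  same_profile w M (del M [set w]) -> active_basis M T ->
  active_basis (del M [set w]) T.
Proof.
move=> wm wT [s1 s2] [sT F1 F2]; split.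
- by rewrite /= subsetD1 sT.
- exact: partFO_del.
- have -> : ground (del M [set w]) :\: T = (ground M :\: T) :\ w by rewrite /= !setDDl setUC.
  rewrite dual_del in s2 *; apply: partFO_con => //.
  by rewrite inE wT; case: wm.
Qed.

Lemma active_basis_con M w T : max_of M w -> w \in T ->
  same_profile w M (con M [set w]) -> active_basis M T ->
  active_basis (con M [set w]) (T :\ w).
Proof.
move=> wm wT sp aT; have sT : T \subset ground M by case: aT.
have := @active_basis_del (dual M) w _ wm _ _ (active_basis_dual aT).
rewrite inE wT -dual_con => /(_ isT (same_profile_dual sp)) /active_basis_dual.
by rewrite dualK /= con_setE.
Qed.

Lemma active_basis_uniq M T1 T2 : active_basis M T1 -> active_basis M T2 -> T1 = T2.
Proof.
have half N S1 S2 n e : partFO N S1 -> partFO N S2 -> e \in ground (part N n) ->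
    (e \in S1) = (e \in S2).
  move=> F1 F2 ge; have [p pm _] := part_inhabited ge.
  have [FO1 p1] := F1 n p pm; have [FO2 p2] := F2 n p pm.
  have /setP/(_ e) : S1 :&: ground (part N n) = S2 :&: ground (part N n).
    by apply: (FO_uniq pm.1 FO1 FO2); rewrite !in_setI (negbTE p1) (negbTE p2).
  by rewrite !in_setI ge !andbT.
case=> s1 F1 G1 [s2 F2 G2]; apply/setP => e.
have [ge|ge] := boolP (e \in ground M); last first.
  by rewrite (contraNF (subsetP s1 e) ge) (contraNF (subsetP s2 e) ge).
have [[n en]|[n en]] := level_total ge; first exact: half F1 F2 en.
have := half _ _ _ _ _ G1 G2 en; rewrite !in_setD ge !andbT.
by case: (e \in T1); case: (e \in T2).
Qed.

Lemma min_part_neq M n p w : ~ loop M w -> max_of M w -> w \in ground (part M n) ->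
  min_of (part M n) p -> p != w.
Proof.
move=> nl wm gw pm; apply/negP => /eqP pw; apply: nl.
have rp := rk_min_part pm; rewrite pw in rp.
move: gw; rewrite in_part => /andP[/in_lvl [y [cy y0 yn yw]] _].
exists y => //; split; first exact: lt0r_neq0.
move=> f fw; apply/eqP/contraT => yf; have := yn f yf; rewrite -rp leqNgt (max_neq wm) //.
by apply: contraNT yf => /(cyc_ground cy) ->.
Qed.

(** The trace of T on the active minor at w is fully optimal after w is deleted, so the
    minor remains cyclic-bipolar or bipolar, and [levels_del] or [levels_con] applies. *)
Lemma active_basis_profile M w T : max_of M w -> ~ isthmus M w -> ~ loop M w ->
  active_basis M T -> w \notin T -> same_profile w M (del M [set w]).
Proof.
move=> wm ni nl [sT F1 F2] wT; have [[n wn]|[n wn]] := level_total wm.1.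
  have [p pm _] := part_inhabited wn; have [FT pT] := F1 n p pm.
  have pw := min_part_neq nl wm wn pm; have wm' := part_max wm wn.
  apply: (levels_del wm wn pm pw); apply: (@FO_cbip _ _ _ _ (T :&: ground (part M n))).
  - by case: (del_min pw pm).
  - by rewrite inE (negbTE pT).
  - by apply: FO_del => //; rewrite inE (negbTE wT).
have [p pm _] := part_inhabited wn; have [FT pT] := F2 n p pm.
have pw : p != w by apply: (@min_part_neq (dual M)) wn pm => //; rewrite /loop dualK.
have wm' : max_of (part (dual M) n) w by exact: part_max.
suff /same_profile_dual : same_profile w (dual M) (con (dual M) [set w]).
  by rewrite -dual_del !dualK.
apply: (levels_con (wm : max_of (dual M) w) wn pm pw).
apply: (@FO_cbip _ _ _ _ (((ground M :\: T) :&: ground (part (dual M) n)) :\ w)).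
- by case: (@del_min _ _ (dual (part (dual M) n)) w p pw pm).
- by rewrite in_setD1 in_setI (negbTE pT) andbF.
- by apply: FO_con => //; rewrite in_setI wn in_setD wT wm.1.
Qed.

Lemma active_basis_profile_con M w T : max_of M w -> ~ isthmus M w -> ~ loop M w ->
  active_basis M T -> w \in T -> same_profile w M (con M [set w]).
Proof.
move=> wm ni nl aT wT.
suff /same_profile_dual : same_profile w (dual M) (del (dual M) [set w]).
  by rewrite -dual_con !dualK.
apply: (@active_basis_profile (dual M)) (active_basis_dual aT) _ => //.
by rewrite inE wT.
Qed.

Lemma pos_flip_neg M w n e : pos (flip [set w] M) n e -> exists y,
  [/\ cyc M y, forall f, f != w -> 0 <= y f,
      forall f, y f != 0 -> (n <= rk f)%N, y w <= 0 & y e != 0].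
Proof.
case=> y [cy y0 yn ye]; exists (flipv [set w] y); split=> //.
- by move=> f fw; rewrite /flipv inE (negbTE fw).
- by move=> f; rewrite flipv_eq0; exact: yn.
- by rewrite /flipv inE eqxx oppr_le0.
- by rewrite flipv_eq0 lt0r_neq0.
Qed.

Definition same_levels_off w M N := forall n, lvl M n :\ w = lvl N n :\ w.

Lemma same_levels_offE w M N n f : same_levels_off w M N -> f != w ->
  (f \in lvl N n) = (f \in lvl M n).
Proof. by move=> sl fw; have /setP/(_ f) := sl n; rewrite !in_setD1 fw /= => ->. Qed.

(** Suppose w were at a higher level m after its reversal.  A flow certifying it is negative at w
    in M and its other edges lie in [lvl M n.+1]; minus this flow, plus a large positive
    flow on that level, would put w in [lvl M n.+1] as well. *)
Lemma flip_level M w n m : same_levels_off w M (flip [set w] M) ->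
  w \in ground (part M n) -> w \in ground (part (flip [set w] M) m) -> (m <= n)%N.
Proof.
move=> sl; rewrite !in_part => /andP[_ wn] /andP[/in_lvl pw _].
rewrite leqNgt; apply/negP => nm.
have [y [cy y0 yr yw ye]] := pos_flip_neg pw.
(* y is the flow of the reorientation, seen in M *)
have {}yw : y w < 0 by rewrite lt_def eq_sym ye.
have [z [cz z0 zn zU]] := lvl_full M n.+1.
have [c [c0 c1 c2]] := dominate (fun f => - y f) z0.
have zE := lvl_full_out z0 zU.
have nw : (n < rk w)%N by apply: leq_trans nm (yr w ye).
have yU f : f != w -> y f != 0 -> f \in lvl M n.+1.
  move=> fw yf; apply: (subsetP (lvl_anti M nm)).
  rewrite -(same_levels_offE _ sl fw).
  apply/in_lvl; exists (flipv [set w] y); split.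
  - exact: cyc_flip.
  - move=> g; rewrite /flipv inE; case: eqVneq => [->|/y0 //].
    by rewrite oppr_ge0 ltW.
  - by move=> g; rewrite flipv_eq0; exact: yr.
  - by rewrite /flipv inE (negbTE fw) lt_def yf y0.
have u f : f != w -> y f != 0 -> 0 < - y f + c * z f.
  by move=> fw yf; rewrite c1 // zU yU.
have uw : - y w + c * z w = - y w by rewrite c2 // zE.
case/in_lvl: wn; exists (fun f => - y f + c * z f); split.
- by apply: cyc_ext (cyc_lin (-1) c cy cz) => f; rewrite mulN1r.
- move=> f; have [->|fw] := eqVneq f w; first by rewrite uw oppr_ge0 ltW.
  have [->|yf] := eqVneq (y f) 0; last exact/ltW/u.
  by rewrite oppr0 add0r mulr_ge0.
- move=> f; have [->//|fw] := eqVneq f w.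
  have [yf|yf _] := eqVneq (y f) 0; last by have /in_lvl/pos_rk := yU f fw yf.
  by rewrite yf oppr0 add0r mulf_eq0 negb_or => /andP[_ /zn].
- by rewrite uw oppr_gt0.
Qed.

Lemma flip_flip A M : flip A (flip A M) = M.
Proof. by apply: omat_eq => // y /=; rewrite flipvK. Qed.

Lemma part_flip M w n : lvl (flip [set w] M) n = lvl M n ->
  lvl (flip [set w] M) n.+1 = lvl M n.+1 ->
  part (flip [set w] M) n = flip [set w] (part M n).
Proof.
move=> e1 e2; apply: omat_eq; first by rewrite /= e1 e2.
have flip0 y f : y f = 0 -> flipv [set w] y f = 0.
  by move=> yf; apply/eqP; rewrite flipv_eq0 yf.
have flip_if y : flipv [set w] (fun e => if e \in lvl M n.+1 then 0 else y e)
    = fun e => if e \in lvl M n.+1 then 0 else flipv [set w] y e.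
  by apply/funext => f; rewrite /flipv; case: ifP; case: ifP; rewrite ?oppr0.
move=> y; split.
  move=> /cyc_part[y' [cy yU ->]]; rewrite e2; apply/cyc_part.
  exists (flipv [set w] y'); split=> // f; rewrite -e1 => /yU; exact: flip0.
move=> /cyc_part[y' [cy yU eqy]]; apply/cyc_part.
exists (flipv [set w] y'); split; first exact: cyc_flip.
  by move=> f; rewrite e1 => /yU; exact: flip0.
by rewrite e2 -flip_if -eqy flipvK.
Qed.

(** Otherwise w is in a positive flow of M and in a positive tension of the reorientation;
    by orthogonality they share another edge, which would be cyclic in M and acyclic after
    the reversal. *)
Lemma pos_flip M w : w \in ground M -> same_levels_off w M (flip [set w] M) ->
  pos M 0 w -> pos (flip [set w] M) 0 w.
Proof.
move=> gw sl pw; have [//|pF] := @pos_total _ _ (flip [set w] M) w gw.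
have := pF; rewrite dual_flip => /pos_flip_neg[t [/= ct t0 _ tw tn]].
have {}tw : t w < 0 by rewrite lt_def eq_sym tn.
have [y [cy y0 _ yw]] := pw.
have [f [fw yf tf]] : exists f, [/\ f != w, y f != 0 & t f != 0].
  apply: contrapT => H; have := orth cy ct; rewrite (bigD1 w) //= big1.
    by rewrite addr0 => /eqP; rewrite mulf_eq0 gt_eqF // lt_eqF.
  move=> f fw; apply/eqP/contraT; rewrite mulf_eq0 negb_or => /andP[yf tf].
  by case: H; exists f.
have fU : f \in lvl M 0 by apply/in_lvl; exact: pos_of yf.
have /in_lvl pf : f \in lvl (flip [set w] M) 0.
  by rewrite (same_levels_offE _ sl fw).
suff pf' : pos (dual (flip [set w] M)) 0 f by case: (pos_excl pf pf').
rewrite dual_flip; exists (flipv [set w] t); split=> //.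
- exact: (@cyc_flip _ _ _ (dual M)).
- move=> g; rewrite /flipv inE; case: eqVneq => [->|/t0 //].
  by rewrite oppr_ge0 ltW.
- by rewrite /flipv inE (negbTE fw) lt_def tf t0.
Qed.

Lemma active_basis_flip_pos M w T : max_of M w -> ~ loop M w -> pos M 0 w ->
  same_levels_off w M (flip [set w] M) ->
  partFO M T -> partFO (flip [set w] M) T -> False.
Proof.
move=> wm nl pw sl F1 F2; have pw' := pos_flip wm.1 sl pw.
have [n wn] := part_of_pos pw; have [m wm'] := part_of_pos pw'.
have enm : m = n.
  apply/eqP; rewrite eqn_leq (flip_level sl wn wm') /=.
  have H := @flip_level (flip [set w] M) w m n; rewrite flip_flip in H.
  by apply: H => // k; rewrite sl.
rewrite {m}enm in wm'.
have eqU k : (w \in lvl M k) = (w \in lvl (flip [set w] M) k) ->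
    lvl (flip [set w] M) k = lvl M k.
  move=> eqk; apply/setP => e; have [->//|ew] := eqVneq e w.
  by rewrite (same_levels_offE _ sl ew).
have eqP : part (flip [set w] M) n = flip [set w] (part M n).
  apply: part_flip; apply: eqU; move: wn wm'; rewrite !in_part.
    by move=> /andP[-> _] /andP[-> _].
  by move=> /andP[_ /negbTE ->] /andP[_ /negbTE ->].
have [p pm _] := part_inhabited wn; have [FO1 pT] := F1 n p pm.
have pm' : min_of (part (flip [set w] M) n) p by rewrite eqP.
have [FO2 _] := F2 n p pm'; rewrite eqP in FO2.
apply: FO_flip_excl FO1 FO2 => //; rewrite eq_sym.
exact: min_part_neq nl wm wn pm.
Qed.

Lemma active_basis_flip_excl M w T : max_of M w -> ~ isthmus M w -> ~ loop M w ->
  same_levels_off w M (flip [set w] M) ->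
  same_levels_off w (dual M) (dual (flip [set w] M)) ->
  active_basis M T -> active_basis (flip [set w] M) T -> False.
Proof.
move=> wm ni nl s1 s2 [_ F1 G1] [_ F2 G2].
have [pw|pw] := pos_total wm.1; first exact: active_basis_flip_pos F1 F2.
rewrite dual_flip in s2 G2.
by apply: (@active_basis_flip_pos (dual M)) G1 G2; rewrite // /loop dualK.
Qed.

(** If both bases avoid w, both equal the active basis of the deletion of w and the levels of
    the two matroids agree, so that the active minors at w are reorientations of one another
    with the same fully optimal basis, against [FO_flip_excl].  The other case is dual. *)
Theorem active_basis_flip M w T T' : max_of M w -> ~ isthmus M w -> ~ loop M w ->
  active_basis M T -> active_basis (flip [set w] M) T' ->
  (w \in T') = (w \notin T).
Proof.
move=> wm ni nl a1 a2.
have wm' : max_of (flip [set w] M) w by [].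
have ni' : ~ isthmus (flip [set w] M) w by rewrite isthmus_flip.
have nl' : ~ loop (flip [set w] M) w by rewrite loop_flip.
have off N : same_profile w M N -> same_profile w (flip [set w] M) N ->
    same_levels_off w M (flip [set w] M) /\
    same_levels_off w (dual M) (dual (flip [set w] M)).
  by move=> [h1 h2] [h3 h4]; split=> n; rewrite -?h1 -?h2 ?h3 ?h4.
have [wT|wT] := boolP (w \in T); have [wT'|wT'] := boolP (w \in T') => //=.
- have p1 := active_basis_profile_con wm ni nl a1 wT.
  have p2 := active_basis_profile_con wm' ni' nl' a2 wT'.
  have b1 := active_basis_con wm wT p1 a1.
  have b2 := active_basis_con wm' wT' p2 a2.
  rewrite con_flip in p2 b2; have [s1 s2] := off _ p1 p2.
  have eqT : T = T'.
    by rewrite -(setD1K wT) -(setD1K wT') (active_basis_uniq b1 b2).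
  by rewrite -eqT in a2; case: (active_basis_flip_excl wm ni nl s1 s2 a1 a2).
- have p1 := active_basis_profile wm ni nl a1 wT.
  have p2 := active_basis_profile wm' ni' nl' a2 wT'.
  have b1 := active_basis_del wm wT p1 a1.
  have b2 := active_basis_del wm' wT' p2 a2.
  rewrite del_flip in p2 b2; have [s1 s2] := off _ p1 p2.
  have eqT := active_basis_uniq b1 b2.
  by rewrite -eqT in a2; case: (active_basis_flip_excl wm ni nl s1 s2 a1 a2).
Qed.

End ActiveBasis.

(** * Loops, and matroids with a single part *)

Section SpecialCases.

Context (d : Order.disp_t) (E : finOrderType d).
Implicit Types (A B W F T X Y : {set E}) (e f g p w : E) (y z t : E -> rat).
Implicit Types M N : omat E.

Lemma loop_vec M w : loop M w ->
  exists y, [/\ cyc M y, y w = 1 & forall f, f != w -> y f = 0].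
Proof.
move=> [y /= cy [yw y0]]; exists (fun e => (y w)^-1 * y e); split.
- exact: cyc_scale.
- by rewrite mulVf.
- by move=> f /y0 ->; rewrite mulr0.
Qed.

Lemma loop_coc M w t : loop M w -> coc M t -> t w = 0.
Proof.
move=> /loop_vec[y [cy yw y0]] ct; have := orth cy ct.
rewrite (bigD1 w) //= big1; first by rewrite yw mul1r addr0.
by move=> f /y0 ->; rewrite mul0r.
Qed.

Lemma loop_del_con M w : loop M w -> con M [set w] = del M [set w].
Proof.
move=> lw; apply: omat_eq_coc => // t; split=> [[/= ct tw]|[t' /= ct ->]].
  exists t => //; apply/funext => e; rewrite inE; case: eqVneq => // ->.
  exact: loop_coc ct.
split; last by move=> e ->.
suff -> : (fun e => if e \in [set w] then 0 else t' e) = t' by [].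
apply/funext => e; rewrite inE; case: eqVneq => // ->.
by rewrite (loop_coc lw ct).
Qed.

Lemma loop_profile M w : loop M w -> same_profile w M (del M [set w]).
Proof.
move=> lw; have [y [cy yw y0]] := loop_vec lw.
split; apply: same_levelsP; try exact: notin_del.
  move=> n e ew; split; last exact: pos_del.
  case=> v [cv v0 vn ve].
  have vE f : f != w -> v f - v w / y w * y f = v f.
    by move=> /y0 ->; rewrite mulr0 subr0.
  have vw : v w - v w / y w * y w = 0 by rewrite yw; lra.
  apply: (pos_delI (cyc_elim w cv cy)) => //.
  - by move=> f; have [->|fw] := eqVneq f w; rewrite ?vw ?vE.
  - move=> f; have [->|fw] := eqVneq f w; first by rewrite vw eqxx.
    by rewrite vE //; exact: vn.
  - by rewrite vE.
move=> n e ew; rewrite dual_del; split; first exact: pos_con.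
case=> _ [[t ct ->] t0 tn te]; exists t; suff eqt f : (if f \in [set w] then 0 else t f) = t f.
  split=> // [f|f|]; first by rewrite -eqt.
    by rewrite -eqt; exact: tn.
  by rewrite -eqt.
by rewrite inE; case: eqVneq => // ->; rewrite (loop_coc lw ct).
Qed.

Lemma loop_notin_active_basis M w T : max_of M w -> loop M w -> active_basis M T ->
  w \notin T.
Proof.
move=> wm lw [_ F1 _]; have [y [cy yw y0]] := loop_vec lw.
have gw : w \in ground (part M (rk w)).
  rewrite in_part; apply/andP; split; last by apply/in_lvl => /pos_rk; rewrite ltnn.
  apply/in_lvl; exists y; split=> //; last by rewrite yw.
    by move=> f; have [->|/y0 ->//] := eqVneq f w; rewrite yw.
  by move=> f; have [->//|/y0 ->] := eqVneq f w; rewrite eqxx.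
have [p pm rp] := part_inhabited gw.
by have [_] := F1 _ p pm; rewrite (rk_inj rp).
Qed.

Lemma cbip_lvl M p n : min_of M p -> cbip M p ->
  lvl M n = if (n <= rk p)%N then ground M else set0.
Proof.
move=> pm [c1 c2]; apply/setP => e; case: leqP => np.
  apply/in_lvl/idP => [/pos_ground //|/c1[y [cy y0 _ ye]]].
  exists y; split=> // f yf; apply: leq_trans np (pm.2 _ _).
  by apply: contraNT yf => /(cyc_ground cy) ->.
rewrite in_set0; apply/in_lvl => -[y [cy y0 yn ye]].
have := c2 y cy y0 (ex_intro _ e (lt0r_neq0 ye)).
by move=> /lt0r_neq0/yn; rewrite leqNgt np.
Qed.

Lemma cbip_part M p : min_of M p -> cbip M p -> part M (rk p) = M.
Proof.
move=> pm cb; have U0 := cbip_lvl (rk p) pm cb; have U1 := cbip_lvl (rk p).+1 pm cb.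
rewrite leqnn in U0; rewrite ltnn in U1.
apply: omat_eq => [|y].
  by apply/setP => e; rewrite in_part U0 U1 in_set0 andbT.
split=> [/cyc_part[y' [cy _ ->]]|cy].
  by apply: cyc_ext cy => e; rewrite U1 in_set0.
apply/cyc_part; exists y; split=> //.
  by move=> e; rewrite U0; exact: cyc_ground.
by apply/funext => e; rewrite U1 in_set0.
Qed.

(** A cyclic-bipolar matroid is its own only nonempty part. *)
Lemma cbip_active_basis M p T : min_of M p -> cbip M p -> FO M p T -> p \notin T ->
  active_basis M T.
Proof.
move=> pm cb FT pT; have sT : T \subset ground M by case: FT => -[].
split=> //.
  move=> n q qm; have rq := rk_min_part qm.
  have np : n = rk p.
    have := qm.1; rewrite in_part !(cbip_lvl _ pm cb).
    by case: (ltngtP n (rk p)) => // _; rewrite ?andbN ?in_set0.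
  have qp : q = p by apply: rk_inj; rewrite rq.
  by rewrite np qp cbip_part // (setIidPl sT).
move=> n q [+ _]; rewrite in_part => /andP[/in_lvl pq _].
by case: (pos_excl (cb.1 q (pos_ground pq)) pq).
Qed.

Lemma cbip_dual_active_basis M p T : min_of M p -> cbip (dual M) p -> FO M p T ->
  p \in T -> active_basis M T.
Proof.
move=> pm cb FT pT; have sT : T \subset ground M by case: FT => -[].
have pm' : min_of (dual M) p by [].
have := cbip_active_basis pm' cb (FO_dual FT); rewrite inE pT => /(_ isT).
by move/active_basis_dual; rewrite dualK /= setDDK.
Qed.

End SpecialCases.

(** * Flows, tensions and closed walks of a digraph *)

Section Graphs.

Context (V : finType) (d : Order.disp_t) (E : finOrderType d).
Implicit Types (G H K : digraph V E) (A B C D W F T S : {set E}) (X : {set V}).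
Implicit Types (a b e f g p w : E) (y z t : E -> rat) (v : V) (c : seq (E * bool)).
Implicit Types (n k : nat) (M N : omat E).

Definition excess G y v : rat :=
  \sum_e y e * ((tgt G e == v)%:R - (src G e == v)%:R).

Definition flow G y := (forall e, e \notin edges G -> y e = 0) /\ forall v, excess G y v = 0.

Definition tension G t := (forall e, e \notin edges G -> t e = 0) /\
  exists h : V -> rat, forall e, e \in edges G -> t e = h (tgt G e) - h (src G e).

Lemma sum_delta (h : V -> rat) v : \sum_u h u * (v == u)%:R = h v.
Proof.
rewrite (bigD1 v) //= eqxx mulr1 big1 ?addr0 // => u uv.
by rewrite eq_sym (negbTE uv) mulr0.
Qed.

(** Summation by parts: differences of a potential against y are the potential against the
    excess of y. *)
Lemma sum_excess G y (h : V -> rat) :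
  \sum_e y e * (h (tgt G e) - h (src G e)) = \sum_v h v * excess G y v.
Proof.
under [RHS]eq_bigr do rewrite mulr_sumr.
rewrite exchange_big /=; apply: eq_bigr => e _.
under eq_bigr do rewrite mulrCA.
rewrite -mulr_sumr; congr (_ * _).
under eq_bigr do rewrite mulrBr.
by rewrite sumrB !sum_delta.
Qed.

Lemma flow_tension_orth G y t : flow G y -> tension G t -> \sum_e y e * t e = 0.
Proof.
move=> [y0 yb] [t0 [h th]].
rewrite (_ : \sum_e _ = \sum_e y e * (h (tgt G e) - h (src G e))).
  by rewrite sum_excess big1 // => v _; rewrite yb mulr0.
apply: eq_bigr => e _; have [eG|eG] := boolP (e \in edges G); first by rewrite th.
by rewrite y0 // !mul0r.
Qed.

Lemma excess_lin G (a b : rat) y z v :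
  excess G (fun e => a * y e + b * z e) v = a * excess G y v + b * excess G z v.
Proof.
rewrite /excess !mulr_sumr -big_split /=; apply: eq_bigr => e _; ring.
Qed.

Definition unit_vec f (s : rat) : E -> rat := fun g => if g == f then s else 0.

Lemma excess_unit G f s v :
  excess G (unit_vec f s) v = s * ((tgt G f == v)%:R - (src G f == v)%:R).
Proof.
rewrite /excess (bigD1 f) //= /unit_vec eqxx big1 ?addr0 // => g gf.
by rewrite (negbTE gf) mul0r.
Qed.

Section Painting.
Variables (G : digraph V E) (A B W : {set E}).

(** A step (f, true) traverses f forwards, as in [step_src]; black edges can be traversed
    both ways. *)
Definition usable (s : E * bool) : bool :=
  [&& s.1 \in edges G, s.1 \notin W & (s.1 \in B) || ((s.1 \in A) == ~~ s.2)].

Definition reach : rel V :=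
  [rel x u | [exists s, [&& usable s, step_src G s == x & step_tgt G s == u]]].

Definition admissible y := [/\ forall f, f \notin edges G -> y f = 0,
  forall f, f \in W -> y f = 0 & forall f, f \notin B -> 0 <= flipv A y f].

Lemma excess_step (s : E * bool) v :
  excess G (unit_vec s.1 (if s.2 then 1 else -1)) v
  = (step_tgt G s == v)%:R - (step_src G s == v)%:R.
Proof. by rewrite excess_unit /step_tgt /step_src; case: s.2; ring. Qed.

Lemma admissible_step (s : E * bool) : usable s ->
  admissible (unit_vec s.1 (if s.2 then 1 else -1)).
Proof.
case/and3P => sG sW sA; split=> f; rewrite /flipv /unit_vec.
- by case: eqVneq => // ->; rewrite sG.
- by case: eqVneq => // ->; rewrite (negbTE sW).
- case: eqVneq => [-> sB|_ _]; last by rewrite oppr0 if_same.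
  by move: sA; rewrite (negbTE sB) /=; case: s.2; case: (s.1 \in A) => //=; rewrite ?opprK.
Qed.

Lemma reach_vec x x' : connect reach x x' -> exists2 y, admissible y &
  forall v, excess G y v = (x' == v)%:R - (x == v)%:R.
Proof.
case/connectP => p; elim: p x => [|u p IH] x /=.
  move=> _ ->; exists (fun=> 0).
    by split=> // f _; rewrite /flipv oppr0 if_same.
  by move=> v; rewrite /excess big1 ?subrr // => e _; rewrite mul0r.
case/andP => /existsP[s /and3P[us /eqP <- /eqP eu]] pth last_eq.
have [y [y1 y2 y3] yb] := IH u pth last_eq.
have [s1 s2 s3] := admissible_step us.
exists (fun e => 1 * y e + 1 * unit_vec s.1 (if s.2 then 1 else -1) e).
  split=> f Hf; first by rewrite y1 ?s1 //; ring.
    by rewrite y2 ?s2 //; ring.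
  by rewrite flipv_lin !mul1r addr_ge0 ?y3 ?s3.
by move=> v; rewrite excess_lin yb excess_step eu; ring.
Qed.

(** Search from the head of e along usable steps.  If the tail is reached, the path closes to a
    flow through e; if not, the cut around the reached vertices is the tension. *)
Lemma minty e : e \in edges G -> e \notin B -> e \notin W ->
  (forall f, f \in B -> f \notin W) ->
  (exists y, [/\ flow G y, forall f, f \notin B -> 0 <= flipv A y f,
                   forall f, f \in W -> y f = 0 & 0 < flipv A y e]) \/
  (exists t, [/\ tension G t, forall f, f \notin W -> 0 <= flipv A t f,
                   forall f, f \in B -> t f = 0 & 0 < flipv A t e]).
Proof.
move=> eG eB eW BW; set s := (e, e \notin A).
have us : usable s by rewrite /usable eG eW negbK eqxx orbT.
have [con|ncon] := boolP (connect reach (step_tgt G s) (step_src G s)).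
  left; have [y [y1 y2 y3] yb] := reach_vec con.
  have [s1 s2 s3] := admissible_step us.
  exists (fun e => 1 * y e + 1 * unit_vec s.1 (if s.2 then 1 else -1) e); split.
  - split=> [f fG|v]; first by rewrite y1 ?s1 //; ring.
    by rewrite excess_lin yb excess_step; ring.
  - by move=> f fB; rewrite flipv_lin !mul1r addr_ge0 ?y3 ?s3.
  - by move=> f fW; rewrite y2 ?s2 //; ring.
  - rewrite flipv_lin !mul1r ltr_wpDl ?y3 // /flipv /unit_vec /= eqxx.
    by case: (e \in A) => //=; rewrite opprK.
right; pose X := [set x | connect reach (step_tgt G s) x].
have closed u : usable u -> step_src G u \in X -> step_tgt G u \in X.
  move=> uu; rewrite !inE => cx; apply: connect_trans cx (connect1 _).
  by apply/existsP; exists u; rewrite uu !eqxx.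
exists (fun f => if f \in edges G then (tgt G f \in X)%:R - (src G f \in X)%:R else 0).
have step f : f \in edges G -> f \notin W -> (f \in B) || (f \notin A) ->
    src G f \in X -> tgt G f \in X.
  move=> fG fW fA; apply: (closed (f, true)).
  by rewrite /usable fG fW /=; move: fA; case: (f \in A).
have step' f : f \in edges G -> f \notin W -> (f \in B) || (f \in A) ->
    tgt G f \in X -> src G f \in X.
  move=> fG fW fA; apply: (closed (f, false)).
  by rewrite /usable fG fW /=; move: fA; case: (f \in A).
split.
- split=> [f /negbTE ->//|]; exists (fun x => (x \in X)%:R).
  by move=> f ->.
- move=> f fW; rewrite /flipv; have [fG|fG] := boolP (f \in edges G); last first.
    by rewrite oppr0 if_same.
  have [fA|fA] := boolP (f \in A).
    have := step' f fG fW; rewrite fA orbT => /(_ isT).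
    by case: (tgt G f \in X) => [/(_ isT) ->|_]; case: (src G f \in X).
  have := step f fG fW; rewrite fA orbT => /(_ isT).
  by case: (src G f \in X) => [/(_ isT) ->|_]; case: (tgt G f \in X).
- move=> f fB; case: ifP => // fG; have fW := BW f fB.
  suff -> : (tgt G f \in X) = (src G f \in X) by rewrite subrr.
  by apply/idP/idP; [apply: step'|apply: step]; rewrite ?fB.
- have : step_tgt G s \in X by rewrite inE connect0.
  have : step_src G s \notin X by rewrite inE.
  rewrite /flipv eG /s /step_tgt /step_src /=.
  by case: (e \in A) => /= /negbTE -> ->; rewrite ?sub0r ?subr0 ?opprK.
Qed.

End Painting.

Definition om G : omat E.
Proof.
refine (@OMat _ E (edges G) (flow G) (tension G) _ _ _ _ _ _
  (@flow_tension_orth G) (@minty G)).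
- by move=> y e [+ _]; exact.
- by move=> y e [+ _]; exact.
- by split=> // v; rewrite /excess big1 // => e _; rewrite mul0r.
- by split=> //; exists (fun=> 0) => e _; rewrite subr0.
- move=> a b y z [y0 yb] [z0 zb]; split=> [e eG|v]; first by rewrite y0 ?z0 //; ring.
  by rewrite excess_lin yb zb; ring.
- move=> a b y z [y0 [h yh]] [z0 [k zk]]; split=> [e eG|]; first by rewrite y0 ?z0 //; ring.
  by exists (fun v => a * h v + b * k v) => e eG; rewrite yh ?zk //; ring.
Defined.

Lemma om_restrict G F : om (restrict G F) = del (om G) (~: F).
Proof.
apply: omat_eq => [|y]; first by rewrite /= setDE setCK.
split=> [[y0 yb]|[[y0 yb] yF]].
  split; last by move=> e; rewrite inE => eF; apply: y0; rewrite inE (negbTE eF) andbF.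
  by split=> // e eG; apply: y0; rewrite inE (negbTE eG).
split=> // e; rewrite inE negb_and => /orP[/y0 //|eF]; apply: yF.
by rewrite inE.
Qed.

Lemma om_reorient G A : om (reorient A G) = flip A (om G).
Proof.
apply: omat_eq_coc => // t; split=> -[t0 [h th]]; split.
- by move=> e eG; apply/eqP; rewrite flipv_eq0 t0.
- by exists h => e eG; rewrite /flipv (th e eG) /=; case: (e \in A) => //; ring.
- by move=> e eG; apply/eqP; rewrite -(flipv_eq0 A); apply/eqP/t0.
- exists h => e eG; have := th e eG; rewrite /flipv /=.
  by case: (e \in A) => // th'; rewrite -[t e]opprK th'; ring.
Qed.

Lemma adjacent_sym G : symmetric (adjacent G).
Proof.
move=> x u; apply: eq_existsb => e; congr (_ && _).
by rewrite orbC; congr (_ || _); rewrite andbC.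
Qed.

(** Tensions of the contraction are the tensions of G that vanish on F: these are the
    differences of potentials that are constant on the components of G(F). *)
Lemma om_contract G F : om (contract G F) = con (om G) F.
Proof.
apply: omat_eq_coc => // t; set r := fingraph.root (adjacent (restrict G F)).
have csym : connect_sym (adjacent (restrict G F)).
  by apply: sym_connect_sym => x u; exact: adjacent_sym.
have rF e : e \in edges G -> e \in F -> r (src G e) = r (tgt G e).
  move=> eG eF; apply/fingraph.rootP => //; apply: connect1; apply/existsP; exists e.
  by rewrite inE eG eF /= !eqxx.
split=> [[t0 [h th]]|[[t0 [h th]] tF]].
  have tF e : e \in F -> t e = 0 by move=> eF; apply: t0; rewrite inE eF.
  split=> //; split; first by move=> e eG; apply: t0; rewrite inE (negbTE eG) andbF.
  exists (fun v => h (r v)) => e eG; have [eF|eF] := boolP (e \in F).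
    by rewrite tF // rF // subrr.
  by rewrite th // inE eF.
have hr v : h (r v) = h v.
  have : connect (adjacent (restrict G F)) v (r v) by exact: connect_root.
  move=> /connectP[p]; elim: p v (r v) => [|u p IH] v x /=; first by move=> _ ->.
  case/andP=> /existsP[e /andP[]]; rewrite inE => /andP[eG eF] ends pth lst.
  rewrite (IH u x pth lst); have := th e eG; rewrite tF //=.
  by case/orP: ends => /andP[/eqP <- /eqP <-] => /eqP;
    rewrite eq_sym subr_eq0 => /eqP ->.
split=> [e|]; first by rewrite inE negb_and negbK => /orP[/tF|/t0].
exists h => e; rewrite inE => /andP[eF eG].
by rewrite /= -/r !hr th.
Qed.

Lemma om_del1 G w : om (minor Deletion G w) = del (om G) [set w].
Proof. by rewrite om_restrict setCK. Qed.

Lemma om_con1 G w : om (minor Contraction G w) = con (om G) [set w].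
Proof. exact: om_contract. Qed.

(** The flow of intensity one along the walk c. *)
Definition chi c : E -> rat := fun e => \sum_(s <- c | s.1 == e) (if s.2 then 1 else -1).

Lemma excess_chi G c v :
  excess G (chi c) v = \sum_(s <- c) ((step_tgt G s == v)%:R - (step_src G s == v)%:R).
Proof.
under [RHS]eq_bigr do rewrite -excess_step.
rewrite /excess exchange_big /=; apply: eq_bigr => e _.
rewrite -mulr_suml; congr (_ * _); rewrite /chi big_mkcond /=.
by apply: eq_bigr => s _; rewrite /unit_vec eq_sym.
Qed.

Lemma path_stepsP G s c :
  path (fun u u' => step_tgt G u == step_src G u') s c
  = (map (step_tgt G) (belast s c) == map (step_src G) c).
Proof. by elim: c s => //= u c IH s; rewrite eqseq_cons IH. Qed.

Lemma cycle_stepsP G c : path.cycle (fun u u' => step_tgt G u == step_src G u') c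
  = (map (step_tgt G) c == rot 1 (map (step_src G) c)).
Proof.
by case: c => // s c; rewrite /path.cycle path_stepsP belast_rcons -map_rot rot1_cons.
Qed.

Lemma flow_chi G c : cycle_walk G c -> flow G (chi c).
Proof.
case/and5P => _ /allP cG; rewrite cycle_stepsP => /eqP cyc _ _; split=> [e eG|v].
  rewrite /chi big_seq_cond big1 // => s /andP[/cG sG /eqP se].
  by rewrite se (negbTE eG) in sG.
rewrite excess_chi sumrB.
rewrite -(big_map (step_tgt G) xpredT (fun x => (x == v)%:R)) cyc.
rewrite -(big_map (step_src G) xpredT (fun x => (x == v)%:R)).
by rewrite (perm_big (map (step_src G) c)) ?subrr // perm_rot.
Qed.

Lemma chi_in c e s : uniq (unzip1 c) -> (e, s) \in c -> chi c e = if s then 1 else -1.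
Proof.
move=> uc ec; rewrite /chi (big_rem _ ec) /= eqxx big_seq_cond big1 ?addr0 //.
move=> u /andP[uin /eqP ue]; move: uc.
have -> : uniq (unzip1 c) = uniq (unzip1 ((e, s) :: rem (e, s) c)).
  by apply: perm_uniq; apply: perm_map; exact: perm_to_rem.
by rewrite /= => /andP[/negP nin _]; case: nin; have := map_f fst uin; rewrite ue.
Qed.

Lemma chi_out c e : e \notin unzip1 c -> chi c e = 0.
Proof.
move=> ec; rewrite /chi big_seq_cond big1 // => s /andP[sc /eqP se].
by case/negP: ec; rewrite -se; exact: map_f.
Qed.

Lemma chi_neq0 c e : uniq (unzip1 c) -> (chi c e != 0) = (e \in unzip1 c).
Proof.
move=> uc; apply/idP/idP; first by apply: contraNT => /chi_out ->.
by case/mapP => -[f s] fc ->; rewrite (chi_in uc fc); case: s {fc}.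
Qed.

Lemma has_walkP G C (P : pred (seq (E * bool))) :
  reflect (exists c, [/\ cycle_walk G c, [set e in unzip1 c] = C & P c])
          (has_walk G C P).
Proof.
apply: (iffP existsP) => [[c /and3P[cw /eqP cC Pc]]|[c [cw cC Pc]]]; first by exists c.
have sc : (size c <= #|E|)%N.
  case/and5P: cw => _ _ _ _ uc; rewrite -(size_map fst c).
  by rewrite cardE; apply: uniq_leq_size => // e _; rewrite mem_enum.
by exists (Bseq sc); rewrite /= cw cC eqxx.
Qed.

(** Follow the support of y in the direction of its signs.  The vertices reached from the head
    of e include its tail, since no edge of the support leaves them and y has no net flow out
    of them; a shortest path back to the tail then gives a simple closed walk. *)
Lemma walk_of_flow G y e : flow G y -> y e != 0 ->
  exists c, [/\ cycle_walk G c, e \in unzip1 c &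
    forall s, s \in c -> y s.1 != 0 /\ s.2 = (0 < y s.1)].
Proof.
move=> fy ye; pose st f := (f, 0 < y f).
pose r : rel V := [rel x u | [exists f, [&& y f != 0, step_src G (st f) == x
  & step_tgt G (st f) == u]]].
have yG f : y f != 0 -> f \in edges G by apply: contraNT => /(fy.1) ->.
have con : connect r (step_tgt G (st e)) (step_src G (st e)).
  apply: contraT => ncon; pose X := [set x | connect r (step_tgt G (st e)) x].
  have clo f : y f != 0 -> step_src G (st f) \in X -> step_tgt G (st f) \in X.
    move=> yf; rewrite !inE => cx; apply: connect_trans cx (connect1 _).
    by apply/existsP; exists f; rewrite yf !eqxx.
  have ge0 f : 0 <= y f * ((tgt G f \in X)%:R - (src G f \in X)%:R).
    have [->|yf] := eqVneq (y f) 0; first by rewrite mul0r.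
    have := clo f yf; rewrite /st /step_src /step_tgt /=; case: ltP => yf0 imp.
      apply: mulr_ge0; first exact: ltW.
      rewrite subr_ge0; move: imp.
      by case: (src G f \in X) => // /(_ isT) ->.
    apply: mulr_le0 => //; rewrite subr_le0; move: imp.
    by case: (tgt G f \in X) => // /(_ isT) ->.
  have := sum_excess G y (fun x => (x \in X)%:R).
  rewrite [RHS]big1; last by move=> v _; rewrite fy.2 mulr0.
  move/eqP; rewrite psumr_eq0 // => /allP /(_ e (mem_index_enum _)) /=.
  have : step_tgt G (st e) \in X by rewrite inE connect0.
  have : step_src G (st e) \notin X by rewrite inE.
  rewrite mulf_eq0 (negbTE ye) /st /step_src /step_tgt /=.
  by case: ltP => _ /negbTE -> ->; rewrite ?subr0 ?sub0r.
case/connectP: con => p0 pth0 lst0; case/shortenP: pth0 lst0 => p pth up _ lst.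
have [c [c1 c2 c3]] : exists c, [/\ map (step_src G) c = belast (step_tgt G (st e)) p,
    map (step_tgt G) c = p & forall s, s \in c -> y s.1 != 0 /\ s = st s.1].
  elim: p (step_tgt G (st e)) pth {up lst} => [|u p IH] x /=; first by exists [::].
  case/andP => /existsP[f /and3P[yf /eqP fx /eqP fu]] /IH[c [c1 c2 c3]].
  exists (st f :: c); split=> /=; rewrite ?c1 ?c2 ?fx ?fu //.
  by move=> s; rewrite inE => /orP[/eqP ->|/c3].
(* c runs from the head of e to its tail, and e closes the walk *)
pose c' := rcons c (st e).
have c'P s : s \in c' -> y s.1 != 0 /\ s = st s.1.
  by rewrite mem_rcons inE => /orP[/eqP ->|/c3].
have srcE : map (step_src G) c' = step_tgt G (st e) :: p.
  by rewrite map_rcons c1 lst -lastI.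
exists c'; split.
- apply/and5P; split.
  + by rewrite /c'; case: (c).
  + by apply/allP => s /c'P[/yG].
  + by rewrite cycle_stepsP srcE rot1_cons map_rcons c2.
  + by rewrite srcE.
  + apply: (@map_uniq _ _ (fun f => step_src G (st f))).
    rewrite -map_comp (_ : map _ c' = map (step_src G) c') ?srcE //.
    by rewrite -srcE; apply/eq_in_map => s /c'P[_ es]; rewrite [in RHS]es.
- by rewrite /c' /unzip1 map_rcons mem_rcons inE eqxx.
- by move=> s /c'P[ys es]; split=> //; rewrite {1}es.
Qed.

(** * Cycles and cocycles as supports *)

Lemma cycle_vec G C : is_cycle G C ->
  exists2 y, flow G y & forall e, (y e != 0) = (e \in C).
Proof.
case/has_walkP => c [cw <- _]; exists (chi c); first exact: flow_chi.
by move=> e; case/and5P: cw => _ _ _ _ uc; rewrite inE chi_neq0.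
Qed.

Lemma cycle_of_flow G y e : flow G y -> y e != 0 ->
  exists C, [/\ is_cycle G C, e \in C & forall f, f \in C -> y f != 0].
Proof.
move=> fy ye; have [c [cw ec cy]] := walk_of_flow fy ye.
exists [set e in unzip1 c]; split; rewrite ?inE //.
  by apply/has_walkP; exists c.
by move=> f; rewrite inE => /mapP[s sc ->]; have [] := cy s sc.
Qed.

Lemma directed_cycle_vec G C : is_directed_cycle G C ->
  exists2 y, flow G y & forall e, y e = (e \in C)%:R.
Proof.
case/has_walkP => c [cw <- /allP sc]; exists (chi c); first exact: flow_chi.
move=> e; rewrite inE; case/and5P: cw => _ _ _ _ uc.
have [|/chi_out -> //] := boolP (e \in unzip1 c).
by case/mapP => -[f s] fc ->; rewrite (chi_in uc fc) (sc _ fc : s = true).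
Qed.

Lemma directed_cycle_of_flow G y e : flow G y -> (forall f, 0 <= y f) -> y e != 0 ->
  exists C, [/\ is_directed_cycle G C, e \in C & forall f, f \in C -> y f != 0].
Proof.
move=> fy y0 ye; have [c [cw ec cy]] := walk_of_flow fy ye.
exists [set e in unzip1 c]; split; rewrite ?inE //.
  apply/has_walkP; exists c; split=> //; apply/allP => s /cy[ys ->].
  by rewrite lt_def ys y0.
by move=> f; rewrite inE => /mapP[s sc ->]; have [] := cy s sc.
Qed.

Definition cutv G X : E -> rat :=
  fun e => if e \in edges G then (tgt G e \in X)%:R - (src G e \in X)%:R else 0.

Lemma tension_cutv G X : tension G (cutv G X).
Proof.
split=> [e /negbTE eG|]; first by rewrite /cutv eG.
by exists (fun v => (v \in X)%:R) => e eG; rewrite /cutv eG.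
Qed.

Lemma in_cut G X e : (e \in cut G X) = (e \in edges G) && ((src G e \in X) != (tgt G e \in X)).
Proof. by rewrite inE. Qed.

Lemma cutv_neq0 G X e : (cutv G X e != 0) = (e \in cut G X).
Proof.
rewrite in_cut /cutv; case: (e \in edges G) => //=.
by case: (src G e \in X); case: (tgt G e \in X).
Qed.

Lemma cutv_val G X e : e \in cut G X -> cutv G X e = if src G e \in X then -1 else 1.
Proof.
rewrite in_cut /cutv => /andP[-> ]; case: (src G e \in X); case: (tgt G e \in X) => //= _.
Qed.

(** The cut separates the vertices where the potential is below the larger of its values at
    the ends of e. *)
Lemma cut_of_tension G t e : tension G t -> t e != 0 ->
  exists X, [/\ e \in cut G X, forall f, f \in cut G X -> t f != 0 &
    (forall f, 0 <= t f) -> forall f, f \in cut G X -> src G f \in X].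
Proof.
move=> [t0 [h th]] te; have eG : e \in edges G by apply: contraNT te => /t0 ->.
exists [set v | h v < Num.max (h (src G e)) (h (tgt G e))]; split.
- rewrite in_cut eG !inE !lt_max !ltxx orbF /=.
  by move: te; rewrite th // subr_eq0; case: ltgtP.
- move=> f; rewrite in_cut => /andP[fG]; apply: contraNneq.
  by rewrite th // => /eqP; rewrite subr_eq0 !inE => /eqP ->.
- move=> tpos f; rewrite in_cut => /andP[fG]; rewrite !inE.
  have : h (src G f) <= h (tgt G f) by rewrite -subr_ge0 -th.
  set m := Num.max _ _; case: (ltP (h (src G f)) m) => // mf le.
  by rewrite ltNge (le_trans mf le).
Qed.

Lemma cocycleP G D : is_cocycle G D ->
  (exists2 X, D = cut G X & D != set0) /\
  forall X, cut G X != set0 -> cut G X \subset D -> cut G X = D.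
Proof.
case/minsetP => /andP[Dn /existsP[X /eqP eqD]] Dm; split; first by exists X.
move=> Y Yn YD; apply: Dm => //; rewrite Yn; apply/existsP; by exists Y.
Qed.

Lemma cocycle_of_tension G t e : tension G t -> t e != 0 ->
  exists2 D, is_cocycle G D & forall f, f \in D -> t f != 0.
Proof.
move=> tt te; have [X [eX Xt _]] := cut_of_tension tt te.
pose P (B : {set E}) := (B != set0) && [exists X, B == cut G X].
have PX : P (cut G X).
  apply/andP; split; first by apply/set0Pn; exists e.
  by apply/existsP; exists X.
have [D Dm sD] := minset_exists PX.
by exists D => // f /(subsetP sD); exact: Xt.
Qed.

Lemma directed_cocycle_vec G D : is_directed_cocycle G D ->
  exists2 t, tension G t & forall e, t e = (e \in D)%:R.
Proof.
case/andP => _ /existsP[X /andP[/eqP eqD /forallP srcX]].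
exists (fun e => 0 * cutv G X e + (-1) * cutv G X e).
  by apply: (@coc_lin _ _ (om G)); exact: tension_cutv.
move=> e; have [eD|eD] := boolP (e \in D).
  have sX : src G e \in X by have := srcX e; rewrite eD.
  by rewrite cutv_val -?eqD // sX.
have /eqP -> : cutv G X e == 0 by apply: contraNT eD; rewrite cutv_neq0 eqD.
by rewrite !mulr0 addr0.
Qed.

Definition supp y : {set E} := [set e | y e != 0].

(** From a nonnegative tension one subtracts the largest multiple of a tension z of smaller
    support that keeps it nonnegative; if z is not positive at e, then e survives and the
    support shrinks, against minimality. *)
Lemma min_nonneg_tension G t e : tension G t -> (forall f, 0 <= t f) -> t e != 0 ->
  exists s, [/\ tension G s, forall f, 0 <= s f, s e != 0, supp s \subset supp t &
    forall z, tension G z -> supp z \subset supp s -> supp z != set0 -> supp z = supp s].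
Proof.
move=> tt t0 te.
pose P (B : {set E}) := (e \in B) &&
  `[< exists s, [/\ tension G s, forall f, 0 <= s f & supp s = B] >].
have [|B /minsetP[/andP[eB /asboolP[s [ts s0 eqB]]] Bm] sB] := @minset_exists _ P (supp t).
  by rewrite /P inE te; apply/asboolP; exists t.
exists s; split=> //; first by rewrite -eqB inE in eB.
  by rewrite eqB.
rewrite eqB => z tz sz zn; apply/eqP/contraT => neq.
have smaller u : tension G u -> (forall f, 0 <= u f) -> u e != 0 -> supp u \proper B -> False.
  move=> tu u0 ue pu; move: (pu); rewrite properEneq => /andP[/eqP neq' sub].
  by apply: neq'; apply: Bm => //; rewrite /P inE ue; apply/asboolP; exists u.
have pz : supp z \proper B by rewrite properEneq neq.
(* otherwise -z will do, or z or -z already contradicts minimality *)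
wlog ze : z tz sz zn neq pz / (z e <= 0) && [exists f, 0 < z f].
  move=> H.
  have tN : tension G (fun e => - z e) by apply: (@cycN _ _ (dual (om G))).
  have sN : supp (fun e => - z e) = supp z by apply/setP => f; rewrite !inE oppr_eq0.
  have [/existsP exf|nof] := boolP [exists f, 0 < z f].
    have [zle|zgt] := leP (z e) 0.
      by apply: (H z) => //; rewrite zle; apply/existsP.
    have [/existsP exf'|nof'] := boolP [exists f, 0 < - z f].
      by apply: (H (fun e => - z e)); rewrite ?sN // oppr_le0 ltW //; apply/existsP.
    case: (smaller z tz) => //; last by rewrite lt0r_neq0.
    move=> f; rewrite leNgt; apply: contra nof' => zf; apply/existsP; exists f.
    by rewrite oppr_gt0.
  have zle f : z f <= 0 by rewrite leNgt; apply: contra nof => zf; apply/existsP; exists f.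
  have [ze|ze] := eqVneq (z e) 0; last first.
    by case: (smaller _ tN); rewrite ?sN ?oppr_eq0 // => f; rewrite oppr_ge0.
  apply: (H (fun e => - z e)); rewrite ?sN // ze oppr0 lexx.
  case/set0Pn: zn => f; rewrite inE => zf; apply/existsP; exists f.
  by rewrite oppr_gt0 lt_def eq_sym zf zle.
case/andP: ze => ze /existsP[f1 zf1].
(* the largest multiple of z that can be subtracted is given by the smallest ratio *)
case: (Order.TotalTheory.arg_minP (fun f => s f / z f) (zf1 : (fun f => 0 < z f) f1)).
move=> f0 zf0 fm.
have u0 f : 0 <= s f - s f0 / z f0 * z f.
  rewrite subr_ge0; have [zf|zf] := ltP 0 (z f).
    by rewrite -ler_pdivlMr // fm.
  by apply: le_trans (s0 f); rewrite mulr_ge0_le0 // divr_ge0 // ltW.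
case: (@smaller (fun f => s f - s f0 / z f0 * z f)) => //.
- exact: (@cyc_elim _ _ (dual (om G)) f0 s z ts tz).
- have se : 0 < s e by move: eB; rewrite -eqB inE lt_def s0 => ->.
  apply: lt0r_neq0; apply: lt_le_trans se _; rewrite lerBrDr gerDl.
  by rewrite mulr_ge0_le0 // divr_ge0 // ltW.
- apply/properP; split.
    apply/subsetP => f; rewrite inE -eqB inE; apply: contraNN => /eqP sf.
    have /eqP -> : z f == 0; last by rewrite sf mulr0 subr0.
    apply/contraT => zf; have := subsetP sz f.
    by rewrite -eqB !inE zf sf eqxx => /(_ isT).
  exists f0; last by rewrite inE divfK ?subrr ?eqxx // lt0r_neq0.
  by apply: (subsetP sz); rewrite inE lt0r_neq0.
Qed.

(** A directed cut through e need not be a cocycle; an inclusion-minimal support of a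
    nonnegative tension through e is. *)
Lemma directed_cocycle_of_tension G t e : tension G t -> (forall f, 0 <= t f) -> t e != 0 ->
  exists D, [/\ is_directed_cocycle G D, e \in D & forall f, f \in D -> t f != 0].
Proof.
move=> tt t0 te; have [s [ts s0 se st sm]] := min_nonneg_tension tt t0 te.
have suppX X : supp (cutv G X) = cut G X.
  by apply/setP => f; rewrite inE cutv_neq0.
have [X [eX Xs Xsrc]] := cut_of_tension ts se.
have cutX Y : cut G Y != set0 -> cut G Y \subset supp s -> cut G Y = supp s.
  by move=> Yn Ys; rewrite -suppX; apply: sm; rewrite ?suppX //; exact: tension_cutv.
have eqX : cut G X = supp s.
  by apply: cutX; [apply/set0Pn; exists e|apply/subsetP => f /Xs; rewrite inE].
exists (supp s); split; last by move=> f /(subsetP st); rewrite inE.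
  apply/andP; split.
    apply/minsetP; split=> [|B /andP[Bn /existsP[Y /eqP eqB]] Bs].
      rewrite -eqX; apply/andP; split; first by apply/set0Pn; exists e.
      by apply/existsP; exists X.
    by rewrite eqB; apply: cutX; rewrite -eqB.
  apply/existsP; exists X; rewrite eqX eqxx /=; apply/forallP => f; apply/implyP.
  by rewrite -eqX; exact: Xsrc.
by rewrite inE.
Qed.

(** * Spanning trees and fundamental vectors *)

Lemma spanning_treeP G T : spanning_tree G T <-> basis (om G) T.
Proof.
have indepP F : reflect (forall y, flow G y -> (forall e, e \notin F -> y e = 0) ->
    forall e, y e = 0) [forall C, is_cycle G C ==> ~~ (C \subset F)].
  apply: (iffP forallP) => [H y fy yF e|H C].
    apply/eqP/contraT => ye; have [C [cC eC Cy]] := cycle_of_flow fy ye.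
    have /implyP/(_ cC)/subsetPn[f fC fF] := H C.
    by have := Cy f fC; rewrite yF ?eqxx.
  apply/implyP => /[dup] cC /cycle_vec[y fy yC]; apply/negP => sCF.
  have y0 e : y e = 0.
    apply: H => // f fF; apply/eqP; apply: contraNT fF; rewrite yC.
    exact: (subsetP sCF).
  have C0 : C = set0 by apply/setP => e; rewrite -yC y0 eqxx inE.
  case/has_walkP: cC => c [/and5P[cn _ _ _ _] eqC _]; move: eqC.
  case: c cn => // s c _ /setP/(_ s.1); rewrite C0 !inE eqxx //.
split=> [/maxsetP[/andP[sT /indepP T1] Tm]|[sT T1 T2]].
  split=> // t tt t0 e; apply/eqP/contraT => te.
  have eG : e \in edges G by apply: contraNT te => /(tt.1) ->.
  have eT : e \notin T by apply: contra te => /t0 ->.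
  have [ind|/indepP ni] := boolP [forall C, is_cycle G C ==> ~~ (C \subset e |: T)].
    have := Tm (e |: T); rewrite subUset sub1set eG sT ind subsetUr => /(_ isT isT) eqT.
    by move: eT; rewrite -eqT !inE eqxx.
  case: ni => y fy yT; have ye : y e = 0.
    have := flow_tension_orth fy tt; rewrite (bigD1 e) //= big1 ?addr0.
      by move/eqP; rewrite mulf_eq0 (negbTE te) orbF => /eqP.
    move=> f fe; have [fT|fT] := boolP (f \in T); first by rewrite t0 // mulr0.
    by rewrite yT ?mul0r // !inE negb_or fe.
  apply: T1 => // f fT; have [->//|fe] := eqVneq f e.
  by apply: yT; rewrite !inE negb_or fe.
apply/maxsetP; split; first by rewrite sT; apply/indepP.
move=> F /andP[sF /indepP F1] sTF; apply/eqP; rewrite eqEsubset sTF andbT.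
apply/subsetP => e eF; apply: contraT => eT.
have [y [fy y1 y0]] := fund_cyc (And3 sT T1 T2) (subsetP sF e eF) eT.
suff : y e = 0 by rewrite y1 => /eqP; rewrite oner_eq0.
apply: F1 => // f fF; apply: y0; first by apply: contra fF; exact: (subsetP sTF).
by apply: contraNneq fF => ->.
Qed.

(** In the filtrations a is only a lower bound of D, so the default a need not belong to D. *)
Lemma emin_in a D e : e \in D -> emin a D \in D /\ forall f, f \in D -> (emin a D <= f)%O.
Proof.
move=> eD; rewrite /emin /Order.arg_min /extremum; case: pickP => [m /andP[mD /forallP mm]|nom].
  by split=> // f fD; have := mm f; rewrite fD.
have := Order.TotalTheory.arg_minP (fun x : E => x) eD; case=> m mD mm.
have /negbT/negP[] := nom m; apply/andP; split=> //; apply/forallP => f.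
by apply/implyP; exact: mm.
Qed.

Lemma opp_minP M T e y : basis M T -> cyc M y -> 0 < y e ->
  (forall f, f \notin T -> f != e -> y f = 0) ->
  opp_min M T e <-> y (emin e (supp y)) < 0.
Proof.
move=> bT cy ye y0; have eS : e \in supp y by rewrite inE lt0r_neq0.
have [mS mm] := emin_in e eS; set m := emin _ _ in mS mm *.
split=> [/(_ y cy y0 ye)[f yf fm]|ym z cz z0 ze].
  suff -> : m = f by [].
  apply/le_anti; rewrite mm ?inE ?lt_eqF //= -leq_rk; apply: fm.
  by rewrite inE in mS.
have zE f : z f = z e / y e * y f.
  have := fund_cyc_uniq bT cy cz y0 z0 f => H.
  apply: (mulfI (lt0r_neq0 ye)); rewrite -H; field; exact: lt0r_neq0.
have k0 : 0 < z e / y e by rewrite divr_gt0.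
exists m; first by rewrite zE pmulr_rlt0.
move=> g; rewrite zE mulf_eq0 negb_or => /andP[_ yg].
by rewrite leq_rk; apply: mm; rewrite inE.
Qed.

(** The vector of any closed walk in e |: T is a multiple of the fundamental flow y, so its
    edge set is the support of y and the directions along it are the signs of y. *)
Lemma fund_cycle_supp G T e y : basis (om G) T -> flow G y -> e \notin T -> y e != 0 ->
  (forall f, f \notin T -> f != e -> y f = 0) ->
  fund_cycle G T e = supp y /\ forall f g,
    (opposite_in_cycle G (supp y) f g = (y f * y g < 0)) *
    (same_in_cycle G (supp y) f g = (0 < y f * y g)).
Proof.
move=> bT fy eT ye y0.
have ySub f : y f != 0 -> f \in e |: T.
  move=> yf; rewrite !inE; have [//|fe] := eqVneq f e.
  by apply: contraNT yf => fT; rewrite y0.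
have prop c : cycle_walk G c -> [set f in unzip1 c] \subset e |: T ->
    [set f in unzip1 c] = supp y /\ exists2 k, k != 0 & forall f, y f = k * chi c f.
  move=> cw sc; have uc : uniq (unzip1 c) by case/and5P: cw.
  have z0 f : f \notin T -> f != e -> chi c f = 0.
    move=> fT fe; apply: chi_out; apply/negP => fc.
    by have := subsetP sc f; rewrite !inE fc (negbTE fT) (negbTE fe) => /(_ isT).
  have ze : chi c e != 0.
    apply/negP => /eqP ze; have all0 f : chi c f = 0.
      case: bT => _ T1 _; apply: T1; first exact: flow_chi.
      by move=> g gT; have [->//|ge] := eqVneq g e; apply: z0.
    case/and5P: cw => cn _ _ _ _; case: c cn uc all0 {sc z0 ze} => // s c _ uc all0.
    have := chi_neq0 s.1 uc; by rewrite all0 eqxx inE eqxx.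
  have E1 f := fund_cyc_uniq bT fy (flow_chi cw) y0 z0 f.
  have kE f : y f = y e / chi c e * chi c f.
    by apply: (mulfI ze); rewrite E1; field.
  have k0 : y e / chi c e != 0 by rewrite mulf_neq0 ?invr_eq0.
  split; last by exists (y e / chi c e).
  by apply/setP => f; rewrite !inE kE mulf_eq0 negb_or k0 chi_neq0.
have [C0 [cC0 _ C0y]] := cycle_of_flow fy ye.
have [c0 [cw0 eqC0 _]] := has_walkP _ _ _ cC0.
have sC0 : C0 \subset e |: T by apply/subsetP => f /C0y; exact: ySub.
have [eqS0 [k k0 kE]] : _ := prop c0 cw0 ltac:(by rewrite eqC0).
have uc0 : uniq (unzip1 c0) by case/and5P: cw0.
split.
  rewrite /fund_cycle; case: pickP => [C /andP[/has_walkP[c [cw <- _]] sC]|].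
    by have [] := prop c cw sC.
  by move/(_ C0); rewrite cC0 sC0.
have signs c f g s s' : cycle_walk G c -> [set h in unzip1 c] = supp y ->
    (f, s) \in c -> (g, s') \in c -> (y f * y g < 0) = (s != s') /\ (0 < y f * y g) = (s == s').
  move=> cw eqc fc gc; have uc : uniq (unzip1 c) by case/and5P: cw.
  have [|_ [k' k'0 k'E]] := prop c cw.
    by rewrite eqc; apply/subsetP => h; rewrite inE; exact: ySub.
  rewrite !k'E (chi_in uc fc) (chi_in uc gc).
  have kk : 0 < k' * k' by rewrite -expr2 exprn_even_gt0.
  case: s {fc}; case: s' {gc} => /=;
    by rewrite ?mulr1 ?mulrN1 ?mulrN ?mulNr ?mulr1 ?opprK ?oppr_lt0 ?oppr_gt0 ?kk // ltNge ltW.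
have inS f : y f != 0 -> exists s, (f, s) \in c0.
  move=> yf; have : f \in [set h in unzip1 c0] by rewrite eqS0 inE.
  by rewrite inE => /mapP[[h s] hc ->]; exists s.
move=> f g; split; apply/has_walkP/idP.
- move=> [c [cw eqc /existsP[s /andP[fc gc]]]].
  by have [-> _] := signs c f g s (~~ s) cw eqc fc gc; case: s {fc gc}.
- move=> fg; have [yf yg] : y f != 0 /\ y g != 0.
    by apply/andP; rewrite -negb_or -mulf_eq0 lt_eqF.
  have [[s fc] [s' gc]] := (inS f yf, inS g yg).
  exists c0; split=> //; apply/existsP; exists s; rewrite fc /=.
  have [+ _] := signs c0 f g s s' cw0 eqS0 fc gc; rewrite fg.
  by case: s {fc}; case: s' gc.
- move=> [c [cw eqc /existsP[s /andP[fc gc]]]].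
  by have [_ ->] := signs c f g s s cw eqc fc gc.
- move=> fg; have [yf yg] : y f != 0 /\ y g != 0.
    by apply/andP; rewrite -negb_or -mulf_eq0 gt_eqF.
  have [[s fc] [s' gc]] := (inS f yf, inS g yg).
  exists c0; split=> //; apply/existsP; exists s; rewrite fc /=.
  have [_ +] := signs c0 f g s s' cw0 eqS0 fc gc; rewrite fg.
  by case: s {fc}; case: s' gc.
Qed.

(** The vector of any cut in b |: (edges G :\: T) is a multiple of the fundamental tension t, so
    the cut is the support of t and edges cross it according to the signs of t. *)
Lemma fund_cocycle_supp G T b t : basis (om G) T -> tension G t -> b \in T -> t b != 0 ->
  (forall f, f \in T -> f != b -> t f = 0) ->
  fund_cocycle G T b = supp t /\ forall f g,
    (opposite_in_cocycle G (supp t) f g = (t f * t g < 0)) *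
    (same_in_cocycle G (supp t) f g = (0 < t f * t g)).
Proof.
move=> bT tt Tb tb t0.
have bT' := basis_dual bT.
have tG f : t f != 0 -> f \in edges G by apply: contraNT => /(tt.1) ->.
have tSub f : t f != 0 -> f \in b |: (edges G :\: T).
  move=> tf; rewrite !inE tG // andbT; have [//|fb] := eqVneq f b.
  by apply: contra tf => fT; rewrite t0.
have t0' f : f \notin ground (om G) :\: T -> f != b -> t f = 0.
  rewrite inE negb_and negbK => /orP[fT fb|/tt.1 //]; exact: t0.
have prop X : cut G X != set0 -> cut G X \subset b |: (edges G :\: T) ->
    cut G X = supp t /\ exists2 k, k != 0 & forall f, t f = k * cutv G X f.
  move=> Xn sX.
  have z0 f : f \notin ground (om G) :\: T -> f != b -> cutv G X f = 0.
    move=> fT fb; apply/eqP; apply: contraNT fT; rewrite cutv_neq0 => /(subsetP sX).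
    by rewrite in_setU1 (negbTE fb).
  have ze : cutv G X b != 0.
    apply/negP => /eqP ze; have all0 f : cutv G X f = 0.
      case: bT' => _ T1 _; apply: T1; first exact: tension_cutv.
      by move=> g gT; have [->//|gb] := eqVneq g b; apply: z0.
    by case/set0Pn: Xn => f; rewrite -cutv_neq0 all0 eqxx.
  have E1 f := fund_cyc_uniq bT' tt (tension_cutv G X) t0' z0 f.
  have kE f : t f = t b / cutv G X b * cutv G X f.
    by apply: (mulfI ze); rewrite E1; field.
  have k0 : t b / cutv G X b != 0 by rewrite mulf_neq0 ?invr_eq0.
  split; last by exists (t b / cutv G X b).
  by apply/setP => f; rewrite [RHS]inE kE mulf_eq0 negb_or k0 cutv_neq0.
have [D0 cD0 D0t] := cocycle_of_tension tt tb.
have [[X0 eqD0 D0n] _] := cocycleP cD0.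
have sD0 : D0 \subset b |: (edges G :\: T) by apply/subsetP => f /D0t; exact: tSub.
have [eqS0 [k k0 kE]] : _ := prop X0 ltac:(by rewrite -eqD0) ltac:(by rewrite -eqD0).
split.
  rewrite /fund_cocycle; case: pickP => [D /andP[/cocycleP[[X -> Xn] _] sD]|].
    by have [] := prop X Xn sD.
  by move/(_ D0); rewrite cD0 sD0.
have suppn : supp t != set0 by rewrite -eqS0 -eqD0.
have signs X f g : supp t = cut G X -> t f != 0 -> t g != 0 ->
    (t f * t g < 0) = ((src G f \in X) != (src G g \in X)) /\
    (0 < t f * t g) = ((src G f \in X) == (src G g \in X)).
  move=> eqX tf tg; have [||_ [k' k'0 k'E]] := prop X.
  - by rewrite -eqX.
  - by rewrite -eqX; apply/subsetP => h; rewrite inE; exact: tSub.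
  rewrite !k'E !cutv_val -?eqX ?inE //.
  have kk : 0 < k' * k' by rewrite -expr2 exprn_even_gt0.
  case: (src G f \in X); case: (src G g \in X) => /=;
    by rewrite ?mulr1 ?mulrN1 ?mulrN ?mulNr ?mulr1 ?opprK ?oppr_lt0 ?oppr_gt0 ?kk // ltNge ltW.
move=> f g; split; apply/idP/idP.
- case/and3P; rewrite !inE => tf tg /existsP[X /andP[/eqP eqX]].
  by have [-> _] := signs X f g eqX tf tg.
- move=> fg; have [tf tg] : t f != 0 /\ t g != 0.
    by apply/andP; rewrite -negb_or -mulf_eq0 lt_eqF.
  apply/and3P; split; rewrite ?inE //; apply/existsP; exists X0.
  rewrite eqS0 eqxx /=; by have [<- _] := signs X0 f g (esym eqS0) tf tg.
- case/and3P; rewrite !inE => tf tg /existsP[X /andP[/eqP eqX]].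
  by have [_ ->] := signs X f g eqX tf tg.
- move=> fg; have [tf tg] : t f != 0 /\ t g != 0.
    by apply/andP; rewrite -negb_or -mulf_eq0 gt_eqF.
  apply/and3P; split; rewrite ?inE //; apply/existsP; exists X0.
  rewrite eqS0 eqxx /=; by have [_ <-] := signs X0 f g (esym eqS0) tf tg.
Qed.

(** * Active spanning trees of bipolar and cyclic-bipolar digraphs *)

Lemma fund_cycle_opp G T e : basis (om G) T -> e \in edges G -> e \notin T ->
  let C := fund_cycle G T e in
  [/\ opposite_in_cycle G C e (emin e C) <-> opp_min (om G) T e,
      opposite_in_cycle G C (emin e C) e <-> opp_min (om G) T e &
      same_in_cycle G C (emin e C) e <-> ~ opp_min (om G) T e].
Proof.
move=> bT eG eT C; rewrite {}/C; have [y [fy ye y0]] := fund_cyc bT eG eT.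
have ye0 : 0 < y e by rewrite ye.
have [-> sgn] := fund_cycle_supp bT fy eT (lt0r_neq0 ye0) y0.
have mS : y (emin e (supp y)) != 0.
  have eS : e \in supp y by rewrite inE lt0r_neq0.
  by have [] := emin_in e eS; rewrite inE.
have O := opp_minP bT fy ye0 y0.
rewrite !sgn ye mul1r mulr1; split; [exact: iff_sym|exact: iff_sym|].
split=> [gt /O|no]; first by rewrite ltNge ltW.
by case: (ltgtP (y _) 0) mS => // lt; case: no; apply/O.
Qed.

Lemma fund_cocycle_opp G T b : basis (om G) T -> b \in T ->
  let D := fund_cocycle G T b in
  [/\ opposite_in_cocycle G D b (emin b D) <-> opp_min (dual (om G)) (edges G :\: T) b,
      opposite_in_cocycle G D (emin b D) b <-> opp_min (dual (om G)) (edges G :\: T) b &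
      same_in_cocycle G D (emin b D) b <-> ~ opp_min (dual (om G)) (edges G :\: T) b].
Proof.
move=> bT Tb D; rewrite {}/D; have [t [tt tb t0]] := fund_coc bT Tb.
have tb0 : 0 < t b by rewrite tb.
have [-> sgn] := fund_cocycle_supp bT tt Tb (lt0r_neq0 tb0) t0.
have mS : t (emin b (supp t)) != 0.
  have bS : b \in supp t by rewrite inE lt0r_neq0.
  by have [] := emin_in b bS; rewrite inE.
have t0' f : f \notin edges G :\: T -> f != b -> t f = 0.
  rewrite inE negb_and negbK => /orP[fT fb|/tt.1 //]; exact: t0.
have O := opp_minP (basis_dual bT) tt tb0 t0'.
rewrite !sgn tb mul1r mulr1; split; [exact: iff_sym|exact: iff_sym|].
split=> [gt /O|no]; first by rewrite ltNge ltW.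
by case: (ltgtP (t _) 0) mS => // lt; case: no; apply/O.
Qed.

Lemma fully_optimal_tree G p T : p \in T ->
  fully_optimal G (T :\ p) (edges G :\: T) T <-> FO (om G) p T.
Proof.
move=> pT; split=> [/and3P[/spanning_treeP bT /forallP HB /forallP HF]|[bT F1 F2]].
  split=> // [e ge eT _|b Tb bp].
    by have := HF e; rewrite !inE eT ge => h; have [O _ _] := fund_cycle_opp bT ge eT; apply/O.
  by have := HB b; rewrite !inE bp Tb => h; have [O _ _] := fund_cocycle_opp bT Tb; apply/O.
apply/and3P; split; first exact/spanning_treeP.
  apply/forallP => b; apply/implyP; rewrite !inE => /andP[bp Tb].
  by have [O _ _] := fund_cocycle_opp bT Tb; apply/O; apply: F2.
apply/forallP => e; apply/implyP; rewrite !inE => /andP[eT ge].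
by have [O _ _] := fund_cycle_opp bT ge eT; apply/O; apply: F1 => //; apply: contraNneq eT => ->.
Qed.

Lemma fully_optimal_cotree G p T : p \notin T ->
  fully_optimal G T ((edges G :\: T) :\ p) T <-> FO (om G) p T.
Proof.
move=> pT; split=> [/and3P[/spanning_treeP bT /forallP HB /forallP HF]|[bT F1 F2]].
  split=> // [e ge eT ep|b Tb _].
    by have := HF e; rewrite !inE eT ge ep => h; have [O _ _] := fund_cycle_opp bT ge eT; apply/O.
  by have := HB b; rewrite Tb => h; have [O _ _] := fund_cocycle_opp bT Tb; apply/O.
apply/and3P; split; first exact/spanning_treeP.
  apply/forallP => b; apply/implyP => Tb.
  by have [O _ _] := fund_cocycle_opp bT Tb; apply/O; apply: F2 => //; apply: contraNneq pT => <-.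
apply/forallP => e; apply/implyP; rewrite !inE => /and3P[ep eT ge].
by have [O _ _] := fund_cycle_opp bT ge eT; apply/O; apply: F1.
Qed.

(** Otherwise p would be the smallest edge of its own fundamental cycle and should be opposite
    to itself. *)
Lemma fully_optimal_in G p T : is_min (edges G) p ->
  fully_optimal G (T :\ p) (edges G :\: T) T -> p \in T.
Proof.
move=> /andP[pG /forallP pm] /and3P[/spanning_treeP bT _ /forallP HF].
apply: contraT => pT; have := HF p; rewrite inE pT pG => h.
have [O _ _] := fund_cycle_opp bT pG pT; move/O: h => h.
have [y [cy yp y0]] := fund_cyc bT pG pT.
have [|f yf] := h y cy y0; first by rewrite yp.
move=> /(_ p); rewrite yp oner_eq0 leq_rk => /(_ isT) fp.
have fG : f \in edges G by apply: contraTT yf => /(cyc_ground cy) ->; rewrite ltxx.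
have := pm f; rewrite fG => pf.
have fp' : f = p by apply/le_anti; rewrite fp.
by move: yf; rewrite fp' yp ltNge ler01.
Qed.

Lemma fully_optimal_notin G p T : is_min (edges G) p ->
  fully_optimal G T ((edges G :\: T) :\ p) T -> p \notin T.
Proof.
move=> /andP[pG /forallP pm] /and3P[/spanning_treeP bT /forallP HB _].
apply/negP => pT; have := HB p; rewrite pT => h.
have [O _ _] := fund_cocycle_opp bT pT; move/O: h => h.
have [t [ct tp t0]] := fund_coc bT pT.
have [||f tf] := h t ct.
- move=> f; rewrite inE negb_and negbK => /orP[fT fp|/(coc_ground ct) //]; exact: t0.
- by rewrite tp.
move=> /(_ p); rewrite tp oner_eq0 leq_rk => /(_ isT) fp.
have fG : f \in edges G by apply: contraTT tf => /(coc_ground ct) ->; rewrite ltxx.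
have := pm f; rewrite fG => pf.
have fp' : f = p by apply/le_anti; rewrite fp.
by move: tf; rewrite fp' tp ltNge ler01.
Qed.

(** The relation of directed cycles to flows and of directed cocycles to tensions. *)
Definition carries M (dir : pred {set E}) : Prop :=
  (forall C, dir C -> C != set0 /\ exists2 y, cyc M y & forall e, y e = (e \in C)%:R) /\
  (forall y e, cyc M y -> (forall f, 0 <= y f) -> y e != 0 ->
     exists C, [/\ dir C, e \in C & forall f, f \in C -> y f != 0]).

Lemma directed_cycles G : carries (om G) (is_directed_cycle G).
Proof.
split=> [C dC|y e]; last exact: directed_cycle_of_flow.
split; last exact: directed_cycle_vec.
case/has_walkP: dC => c [/and5P[cn _ _ _ _] <- _].
by case: c cn => // s c _; apply/set0Pn; exists s.1; rewrite !inE eqxx.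
Qed.

Lemma directed_cocycles G : carries (dual (om G)) (is_directed_cocycle G).
Proof.
split=> [C dC|y e]; last exact: directed_cocycle_of_tension.
by split; [case/andP: dC => /cocycleP[[]]|exact: directed_cocycle_vec].
Qed.

Section Carried.
Variables (M : omat E) (dir : pred {set E}).
Hypothesis dirM : carries M dir.

Lemma pos_carried n e : pos M n e <->
  exists C, [/\ dir C, e \in C & forall f, f \in C -> (n <= rk f)%N].
Proof.
split=> [[y [cy y0 yn ye]]|[C [dC eC Cn]]].
  have [C [dC eC Cy]] := dirM.2 y e cy y0 (lt0r_neq0 ye).
  by exists C; split=> // f /Cy/yn.
have [_ [y cy yE]] := dirM.1 C dC; exists y; split=> // [f|f|].
- by rewrite yE ler0n.
- by rewrite yE pnatr_eq0 eqb0 negbK; exact: Cn.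
- by rewrite yE eC.
Qed.

Lemma cbip_carried p :
  [forall e in ground M, exists D : {set E}, dir D && (e \in D)]
  && [forall D, dir D ==> (p \in D)] <-> cbip M p.
Proof.
split=> [/andP[/forallP H1 /forallP H2]|[H1 H2]].
  split=> [e eG|y cy y0 [f yf]].
    have := H1 e; rewrite eG => /existsP[C /andP[dC eC]].
    by apply/pos_carried; exists C.
  have [C [dC fC Cy]] := dirM.2 y f cy y0 yf.
  by have := H2 C; rewrite dC => pC; rewrite lt_def y0 Cy.
apply/andP; split; apply/forallP; last move=> C; last apply/implyP.
  move=> e; apply/implyP => /H1/pos_carried[C [dC eC _]]; apply/existsP; exists C; exact/andP.
move=> /(dirM.1 C)[/set0Pn[f fC] [y cy yE]].
have := H2 y cy; rewrite yE; case: (p \in C) => //=; rewrite ltxx; apply.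
  by move=> g; rewrite yE ler0n.
by exists f; rewrite yE fC oner_eq0.
Qed.

Lemma active_carried a :
  [exists C : {set E}, dir C && is_min C a] = (a \in lvl M (rk a)).
Proof.
apply/existsP/in_lvl => [[C /andP[dC /andP[aC /forallP am]]]|].
  apply/pos_carried; exists C; split=> // f fC.
  by rewrite leq_rk; have := am f; rewrite fC.
move=> /pos_carried[C [dC aC Cn]]; exists C; rewrite dC /is_min aC /=.
by apply/forallP => f; apply/implyP => /Cn; rewrite leq_rk.
Qed.

Lemma bigcup_carried a : \bigcup_(C | dir C && (a <= emin a C)%O) C = lvl M (rk a).
Proof.
apply/setP => e; apply/bigcupP/in_lvl => [[C /andP[dC am] eC]|/pos_carried[C [dC eC Cn]]].
  apply/pos_carried; exists C; split=> // f fC; rewrite leq_rk (le_trans am) //.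
  by have [_] := emin_in a eC; apply.
by exists C => //; rewrite dC -leq_rk; apply: Cn; have [] := emin_in a eC.
Qed.

End Carried.

Lemma cyclic_bipolarP G p : cyclic_bipolar G p <-> cbip (om G) p.
Proof. exact: cbip_carried (directed_cycles G) p. Qed.

Lemma bipolarP G p : bipolar G p <-> cbip (dual (om G)) p.
Proof. exact: cbip_carried (directed_cocycles G) p. Qed.

Lemma is_minP G p : is_min (edges G) p <-> min_of (om G) p.
Proof.
split=> [/andP[pG /forallP pm]|[pG pm]].
  by split=> // f fG; rewrite leq_rk; have := pm f; rewrite fG.
apply/andP; split=> //; apply/forallP => f; apply/implyP => /pm.
by rewrite leq_rk.
Qed.

Lemma is_maxP G p : is_max (edges G) p <-> max_of (om G) p.
Proof.
split=> [/andP[pG /forallP pm]|[pG pm]].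
  by split=> // f fG; rewrite leq_rk; have := pm f; rewrite fG.
apply/andP; split=> //; apply/forallP => f; apply/implyP => /pm.
by rewrite leq_rk.
Qed.

Lemma min_of_uniq M p q : min_of M p -> min_of M q -> p = q.
Proof. by move=> [gp pm] [gq qm]; apply: rk_inj; apply/eqP; rewrite eqn_leq pm ?qm. Qed.

Lemma alpha_base_cyclic G p : min_of (om G) p -> cbip (om G) p ->
  FO (om G) p (alpha_base G) /\ p \notin alpha_base G.
Proof.
move=> pm cb; rewrite /alpha_base; case: pickP => [T /existsP[q]|noT].
  case/andP=> /[dup] qmin /is_minP/(min_of_uniq pm) <-.
  case/orP=> /andP[].
    by move=> /bipolarP [/(_ p pm.1) pp _]; case: (pos_excl (cb.1 p pm.1) pp).
  have pmin : is_min (edges G) p by exact/is_minP.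
  move=> _ /[dup] /(fully_optimal_notin pmin) pT /(fully_optimal_cotree G pT).
  by [].
have [T FT pT] := FO_exists pm cb.
have /negbT/existsP[] := noT T; exists p; apply/andP; split; first exact/is_minP.
apply/orP; right; apply/andP; split; first exact/cyclic_bipolarP.
exact/fully_optimal_cotree.
Qed.

Lemma alpha_base_acyclic G p : min_of (om G) p -> cbip (dual (om G)) p ->
  FO (om G) p (alpha_base G) /\ p \in alpha_base G.
Proof.
move=> pm cb; rewrite /alpha_base; case: pickP => [T /existsP[q]|noT].
  case/andP=> /[dup] qmin /is_minP/(min_of_uniq pm) <-.
  case/orP=> /andP[]; last first.
    by move=> /cyclic_bipolarP [/(_ p pm.1) pp _]; case: (pos_excl pp (cb.1 p pm.1)).
  have pmin : is_min (edges G) p by exact/is_minP.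
  move=> _ /[dup] /(fully_optimal_in pmin) pT /(fully_optimal_tree G pT).
  by [].
have pm' : min_of (dual (om G)) p by [].
have [T /FO_dual FT pT] := FO_exists pm' cb; rewrite dualK /= in FT.
have pT' : p \in edges G :\: T by rewrite inE pT; case: pm.
have /negbT/existsP[] := noT (edges G :\: T); exists p.
apply/andP; split; first exact/is_minP.
apply/orP; left; apply/andP; split; first exact/bipolarP.
exact/fully_optimal_tree.
Qed.

Definition dual_if (r : bool) M := if r then dual M else M.

Lemma alpha_base_FO r G p : min_of (om G) p -> cbip (dual_if r (om G)) p ->
  FO (om G) p (alpha_base G) /\ (p \in alpha_base G) = r.
Proof.
case: r => pm cb; first exact: alpha_base_acyclic.
by have [FT /negbTE pT] := alpha_base_cyclic pm cb.
Qed.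

(** * The active filtration *)

Lemma in_active G a : (a \in active G) = (a \in lvl (om G) (rk a)).
Proof. by rewrite -(active_carried (directed_cycles G)) inE. Qed.

Lemma in_dual_active G a : (a \in dual_active G) = (a \in lvl (dual (om G)) (rk a)).
Proof. by rewrite -(active_carried (directed_cocycles G)) inE. Qed.

Lemma cyclic_flatE G : cyclic_flat G = lvl (om G) 0.
Proof.
apply/setP => e.
apply/bigcupP/in_lvl => [[C dC eC]|/(pos_carried (directed_cycles G))[C [dC eC _]]].
  by apply/(pos_carried (directed_cycles G)); exists C.
by exists C.
Qed.

Section Levels.
Variables (M : omat E) (S : {set E}).
Hypothesis SM : forall a, (a \in S) = (a \in lvl M (rk a)).
Let sq : seq E := sort <=%O (enum S).

(** Common form of the two filtrations of a digraph, for S the set of active or of dual-active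
    edges; beyond the end of the list no edge is left. *)
Definition level_at k : {set E} := if onth sq k is Some a then lvl M (rk a) else set0.

Lemma mem_sq a : (a \in sq) = (a \in lvl M (rk a)).
Proof. by rewrite mem_sort mem_enum SM. Qed.

Lemma sq_le i j a : (i <= j)%N -> (j < size sq)%N -> (nth a sq i <= nth a sq j)%O.
Proof.
move=> ij js; apply: sorted_leq_nth => //; try exact: leq_ltn_trans js.
- exact: le_trans.
- exact: sort_sorted le_total _.
Qed.

Lemma level_at_lt k a : (k < size sq)%N -> level_at k = lvl M (rk (nth a sq k)).
Proof. by move=> ks; rewrite /level_at onthE (nth_map a). Qed.

Lemma part_min_active e n : e \in ground (part M n) -> exists2 p, p \in sq & rk p = n.
Proof.
move=> /part_inhabited[p [gp _] rp]; exists p => //; rewrite mem_sq rp.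
by move: gp; rewrite in_part => /andP[].
Qed.

Lemma level_above n e : e \in lvl M n -> exists m p,
  [/\ (n <= m)%N, e \in lvl M m, p \in sq & rk p = m].
Proof.
move=> eU; have ex : exists m, e \in lvl M m by exists n.
have [|m mU mm] := @ex_maxnP (fun m => e \in lvl M m) (rk e) ex.
  by move=> k /in_lvl/pos_rk.
have [|p ps rp] := @part_min_active e m.
  by rewrite in_part mU; apply/negP => /mm; rewrite ltnn.
by exists m, p; split=> //; exact: mm.
Qed.

(** Between consecutive entries of the sorted list the levels do not change, because a change
    of level at n comes with an edge of rank n that belongs to the list. *)
Lemma level_atS k a : (k < size sq)%N -> level_at k.+1 = lvl M (rk (nth a sq k)).+1.
Proof.
move=> ks; apply/setP => e; apply/idP/idP.
  have [ks'|ks'] := ltnP k.+1 (size sq); last by rewrite /level_at onth_default ?inE.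
  rewrite (level_at_lt a ks'); apply: (subsetP (lvl_anti M _)).
  rewrite ltn_neqAle leq_rk sq_le // andbT; apply/eqP => /rk_inj/eqP.
  rewrite nth_uniq ?(ltn_trans (ltnSn k)) ?sort_uniq ?enum_uniq //.
  by rewrite eqn_leq ltnn andbF.
move=> /level_above[m [p [lem eU ps rp]]].
have ip : (index p sq < size sq)%N by rewrite index_mem.
have kp : (k < index p sq)%N.
  rewrite ltnNge; apply/negP => ik; have := sq_le a ik ks.
  by rewrite nth_index // -leq_rk rp leqNgt lem.
rewrite (level_at_lt a (leq_ltn_trans kp ip)).
apply: (subsetP (lvl_anti M _)) eU; rewrite -rp leq_rk.
by rewrite -[X in (_ <= X)%O](nth_index a ps); apply: sq_le.
Qed.

Lemma level_at_parts k : (k < size sq)%N ->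
  exists2 n, level_at k = lvl M n & level_at k.+1 = lvl M n.+1 /\ exists e, e \in ground (part M n).
Proof.
move=> ks; have a : E by case: (sq) ks.
exists (rk (nth a sq k)); first exact: level_at_lt.
split; first exact: level_atS.
exists (nth a sq k); rewrite in_part -mem_sq mem_nth //=.
by apply/in_lvl => /pos_rk; rewrite ltnn.
Qed.

Lemma parts_level_at n e : e \in ground (part M n) ->
  exists2 k, (k < size sq)%N & level_at k = lvl M n /\ level_at k.+1 = lvl M n.+1.
Proof.
move=> /part_min_active[p ps rp]; have ip : (index p sq < size sq)%N by rewrite index_mem.
by exists (index p sq) => //; rewrite (level_at_lt p ip) (level_atS p ip) nth_index // rp.
Qed.

End Levels.

Lemma cyclic_filtrationE H k : cyclic_filtration H k = level_at (om H) (active H) k.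
Proof.
rewrite /cyclic_filtration /level_at /active_seq; case: onth => // a.
exact: bigcup_carried (directed_cycles H) a.
Qed.

Lemma dual_filtrationE H k :
  dual_filtration H k = edges H :\: level_at (dual (om H)) (dual_active H) k.
Proof.
rewrite /dual_filtration /level_at /dual_active_seq; case: onth => [a|]; last by rewrite setD0.
by rewrite (bigcup_carried (directed_cocycles H)).
Qed.

Lemma lvl_sub M n : lvl M n \subset ground M.
Proof. by apply/subsetP => e /in_lvl/pos_ground. Qed.

Lemma om_cyclic_minor H F1 F2 n : F1 = lvl (om H) n -> F2 = lvl (om H) n.+1 ->
  om (contract (restrict H F1) F2) = part (om H) n.
Proof. by move=> -> ->; rewrite om_contract om_restrict. Qed.

Lemma om_dual_minor H F1 F2 n : F1 = edges H :\: lvl (dual (om H)) n.+1 ->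
  F2 = edges H :\: lvl (dual (om H)) n ->
  om (contract (restrict H F1) F2) = dual (part (dual (om H)) n).
Proof.
move=> -> ->; rewrite om_contract om_restrict; set M := om H.
have sU1 := lvl_anti (dual M) (leqnSn n); have sU := lvl_sub (dual M) n.
rewrite /part dual_con dual_del dualK; apply: omat_eq => [|y].
  apply/setP => e; have /implyP := subsetP sU1 e; have /implyP := subsetP sU e => /=.
  rewrite !(in_setD, in_setC); move: (e \in lvl _ n) (e \in lvl _ n.+1).
  by case=> -[]; case: (e \in edges H).
have y_out y' e : cyc M y' -> e \notin edges H -> y' e = 0 by move=> cy; exact: (@cyc_ground _ _ M).
split=> [[y' [/= cy y0] ->]|[[y' /= cy ->] y0]].
  split; last first.
    move=> e eU; case: ifP => // _; have [eH|/(y_out _ _ cy)//] := boolP (e \in edges H).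
    by apply: y0; rewrite !(in_setC, in_setD) eU.
  exists y' => //; apply/funext => e; rewrite in_setD in_setC.
  case: (e \in lvl _ n) => //=; have [//|eH] := boolP (e \in edges H).
  exact: (y_out y').
exists y'; first split=> // e.
  rewrite !(in_setC, in_setD) negb_and negbK => /orP[eU|]; last exact: y_out cy.
  have := y0 e eU; rewrite in_setC; by rewrite (subsetP sU1 e eU).
apply/funext => e; rewrite in_setD in_setC.
case: (e \in lvl _ n) => //=; have [//|eH] := boolP (e \in edges H).
by rewrite (y_out _ _ cy eH).
Qed.

(** Digraphs have no decidable equality, so membership in lists of digraphs is [List.In]. *)
Lemma In_cat (K : Type) (x : K) s1 s2 :
  List.In x (s1 ++ s2) <-> List.In x s1 \/ List.In x s2.
Proof.
elim: s1 => [|u s1 IH] /=; first by split=> [|[]//]; right.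
by split=> [[->|/IH[]]|[[->|]|]]; auto; right; apply/IH; auto.
Qed.

Lemma In_mkseq (K : Type) (f : nat -> K) n x :
  List.In x (mkseq f n) <-> exists2 k, (k < n)%N & f k = x.
Proof.
rewrite /mkseq; suff H s : List.In x (map f s) <-> exists2 k, k \in s & f k = x.
  by split=> [/H[k]|[k kn fk]]; [rewrite mem_iota; exists k|apply/H; exists k; rewrite ?mem_iota].
elim: s => [|k s IH] /=; first by split=> // -[].
split=> [[<-|/IH[j js fj]]|[j]]; first by exists k; rewrite ?inE ?eqxx.
  by exists j; rewrite ?inE ?js ?orbT.
by rewrite inE => /orP[/eqP -> |js fj]; [left|right; apply/IH; exists j].
Qed.

Lemma In_bigcup (K : Type) (F : K -> {set E}) (s : seq K) e :
  e \in \bigcup_(x <- s) F x <-> exists2 x, List.In x s & e \in F x.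
Proof.
elim: s => [|x s IH]; first by rewrite big_nil inE; split=> // -[].
rewrite big_cons inE; split=> [/orP[ex|/IH[u us eu]]|[u /= [->|us] eu]].
- by exists x => //; left.
- by exists u => //; right.
- by rewrite eu.
- by apply/orP; right; apply/IH; exists u.
Qed.

Lemma In_head_filter (K : Type) (x0 : K) (P : pred K) s x : List.In x s -> P x ->
  List.In (head x0 (filter P s)) s /\ P (head x0 (filter P s)).
Proof.
elim: s => //= u s IH [->|xs] Px; first by rewrite Px; split; [left|].
have [H1 H2] := IH xs Px; case: ifP => Pu; first by split; [left|].
by split; [right|].
Qed.

Lemma active_minorsP H (m : digraph V E) : List.In m (active_minors H) ->
  exists r n, (exists e, e \in ground (om m)) /\ om m = dual_if r (part (dual_if r (om H)) n).
Proof.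
rewrite /active_minors => /In_cat[] /In_mkseq[k ks <-].
  have [n e1 [e2 ex]] := level_at_parts (in_dual_active H) ks.
  by exists true, n; rewrite (@om_dual_minor _ _ _ n) ?dual_filtrationE ?e1 ?e2.
have [n e1 [e2 ex]] := level_at_parts (in_active H) ks.
by exists false, n; rewrite (@om_cyclic_minor _ _ _ n) ?cyclic_filtrationE ?e1 ?e2.
Qed.

Lemma active_minor_part r H n e : e \in ground (part (dual_if r (om H)) n) ->
  exists2 m, List.In m (active_minors H) & om m = dual_if r (part (dual_if r (om H)) n).
Proof.
case: r => /=.
  move=> /(parts_level_at (in_dual_active H))[k ks [e1 e2]].
  exists (contract (restrict H (dual_filtration H k.+1)) (dual_filtration H k)).
    by apply/In_cat; left; apply/In_mkseq; exists k.
  by apply: om_dual_minor; rewrite dual_filtrationE ?e1 ?e2.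
move=> /(parts_level_at (in_active H))[k ks [e1 e2]].
exists (contract (restrict H (cyclic_filtration H k)) (cyclic_filtration H k.+1)).
  by apply/In_cat; right; apply/In_mkseq; exists k.
by apply: om_cyclic_minor; rewrite cyclic_filtrationE.
Qed.

Lemma setDD_sub A B C : B \subset A -> (A :\: C) :\: (A :\: B) = B :\: C.
Proof.
move=> /subsetP sBA; apply/setP => e; rewrite !inE.
have := sBA e; case: (e \in B) => [->|_] //=; rewrite ?andbT //.
by case: (e \in A); rewrite ?andbF.
Qed.

Lemma mem_active_parts H P : reflect
  (exists n, P != set0 /\ (P = ground (part (om H) n) \/ P = ground (part (dual (om H)) n)))
  (P \in active_parts H).
Proof.
have gdE M n : ground (part M n) = lvl M n :\: lvl M n.+1.
  by apply/setP => e; rewrite in_part in_setD andbC.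
rewrite /active_parts mem_cat; apply: (iffP orP).
  case=> /mapP[k]; rewrite mem_iota add0n => /= ks ->.
    have [n e1 [e2 [e ge]]] := level_at_parts (in_dual_active H) ks.
    have -> : dual_filtration H k.+1 :\: dual_filtration H k = ground (part (dual (om H)) n).
      rewrite !dual_filtrationE e1 e2 gdE setDD_sub //; exact: (lvl_sub (dual (om H))).
    by exists n; split; [apply/set0Pn; exists e|right].
  have [n e1 [e2 [e ge]]] := level_at_parts (in_active H) ks.
  have -> : cyclic_filtration H k :\: cyclic_filtration H k.+1 = ground (part (om H) n).
    by rewrite !cyclic_filtrationE e1 e2 gdE.
  by exists n; split; [apply/set0Pn; exists e|left].
case=> n [/set0Pn[e eP] [] eqP]; rewrite eqP in eP *.
  have [k ks [e1 e2]] := parts_level_at (in_active H) eP.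
  right; apply/mapP; exists k; first by rewrite mem_iota.
  by rewrite !cyclic_filtrationE e1 e2 gdE.
have [k ks [e1 e2]] := parts_level_at (in_dual_active H) eP.
left; apply/mapP; exists k; first by rewrite mem_iota.
rewrite !dual_filtrationE e1 e2 gdE setDD_sub //; exact: (lvl_sub (dual (om H))).
Qed.

Lemma ground_dual_if r M : ground (dual_if r M) = ground M.
Proof. by case: r. Qed.

Lemma dual_ifK r M : dual_if r (dual_if r M) = M.
Proof. by case: r; rewrite /= ?dualK. Qed.

Lemma part_dual_if_uniq r r' M n m e : e \in ground (part (dual_if r M) n) ->
  e \in ground (part (dual_if r' M) m) -> r = r' /\ n = m.
Proof.
case: r; case: r' => /= h h'; first by rewrite (part_uniq h h').
- by case: (part_excl h' h).
- by case: (part_excl h h').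
- by rewrite (part_uniq h h').
Qed.

(** The active minors are the nonempty parts of the matroid and the duals of those of its dual.
    They are disjoint, so the trace of the union of their trees on one of them is its own
    tree. *)
Lemma alpha_on_part r H n p : min_of (part (dual_if r (om H)) n) p ->
  exists m : digraph V E, [/\ om m = dual_if r (part (dual_if r (om H)) n),
    FO (om m) p (alpha_base m), (p \in alpha_base m) = r &
    forall e, e \in ground (om m) -> (e \in alpha H) = (e \in alpha_base m)].
Proof.
move=> pm; have [m mH eqm] := active_minor_part pm.1.
have FOm (m' : digraph V E) : om m' = om m -> FO (om m') p (alpha_base m') /\ (p \in alpha_base m') = r.
  move=> e; apply: alpha_base_FO; rewrite e eqm; first by case: (r) pm.
  by rewrite dual_ifK; exact: part_cbip.
have [FT pT] := FOm m erefl; exists m; split=> // e ge.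
apply/idP/idP => [/In_bigcup[m' m'H em']|em]; last by apply/In_bigcup; exists m.
have [r' [n' [[f fm'] eqm']]] := active_minorsP m'H.
have gm' : e \in ground (om m').
  have [q qm _] : exists2 q, min_of (part (dual_if r' (om H)) n') q & rk q = n'.
    by apply: (@part_inhabited _ _ _ _ f); move: fm'; rewrite eqm' ground_dual_if.
  have [||[[/subsetP sub _ _] _ _] _] := @alpha_base_FO r' m' q; last exact: sub.
    by rewrite eqm'; case: (r') qm.
  by rewrite eqm' dual_ifK; exact: part_cbip.
have [er en] : r = r' /\ n = n'.
  rewrite eqm ground_dual_if in ge; rewrite eqm' ground_dual_if in gm'.
  exact: part_dual_if_uniq ge gm'.
have eqo : om m' = om m by rewrite eqm eqm' er en.
have [FT' pT'] := FOm m' eqo; rewrite eqo in FT'.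
have gp : p \in ground (om m) by rewrite eqm ground_dual_if; exact: pm.1.
by rewrite -(FO_uniq gp FT' FT (etrans pT' (esym pT))).
Qed.

Theorem alpha_active_basis H : active_basis (om H) (alpha H).
Proof.
split.
- apply/subsetP => e /In_bigcup[m mH em].
  have [r [n [[f fm] eqm]]] := active_minorsP mH.
  have [q qm _] : exists2 q, min_of (part (dual_if r (om H)) n) q & rk q = n.
    by apply: (@part_inhabited _ _ _ _ f); move: fm; rewrite eqm ground_dual_if.
  have [||[[/subsetP/(_ e em) + _ _] _ _] _] := @alpha_base_FO r m q.
  + by rewrite eqm; case: (r) qm.
  + by rewrite eqm dual_ifK; exact: part_cbip.
  + by rewrite eqm ground_dual_if => /part_ground; rewrite ground_dual_if.
- move=> n p pm; have [m [eqm FT pT inA]] := @alpha_on_part false H n p pm.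
  rewrite eqm /dual_if in FT inA.
  have -> : alpha H :&: ground (part (om H) n) = alpha_base m.
    apply/setP => e; rewrite in_setI andbC; case: FT => -[/subsetP sub _ _] _ _.
    have [ge|ge] := boolP (e \in ground (part (om H) n)); first by rewrite inA.
    by apply/esym/negbTE; apply: contra ge; exact: sub.
  by split=> //; rewrite inA ?pT //; case: pm.
- move=> n p pm; have [m [eqm FT pT inA]] := @alpha_on_part true H n p pm.
  rewrite eqm /dual_if in FT inA.
  have -> : (ground (om H) :\: alpha H) :&: ground (part (dual (om H)) n)
      = ground (part (dual (om H)) n) :\: alpha_base m.
    apply/setP => e; rewrite in_setI in_setD in_setD.
    have [ge|ge] := boolP (e \in ground (part (dual (om H)) n)); last by rewrite !andbF.
    by rewrite (part_ground (M := dual (om H)) ge) inA // !andbT.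
  rewrite in_setD inA ?pT; last by case: pm.
  by split=> //; have := FO_dual FT; rewrite dualK.
Qed.

Lemma alpha_uniq H T : active_basis (om H) T -> alpha H = T.
Proof. exact: active_basis_uniq (alpha_active_basis H). Qed.

(** * The choice between deletion and contraction *)

Lemma partition_profile H K w : max_of (om H) w -> ~ isthmus (om H) w ->
  ~ loop (om H) w -> same_profile w (om H) (om K) ->
  active_partition K = remove_edge w (active_partition H).
Proof.
move=> wm ni nl [s1 s2]; rewrite /active_partition /remove_edge /=; congr (_, _); last first.
  by rewrite !cyclic_flatE s1.
have nonempty (M : omat E) n : max_of M w -> ~ loop M w -> ground (part M n) != set0 ->
    ground (part M n) :\ w != set0.
  move=> wm' nl' /set0Pn[e ge]; have [p pm _] := part_inhabited ge.
  apply/set0Pn; exists p; rewrite in_setD1 pm.1 andbT.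
  have [wn|wn] := boolP (w \in ground (part M n)); first exact: min_part_neq nl' wm' wn pm.
  by apply: contraNneq wn => <-; exact: pm.1.
have nl' : ~ loop (dual (om H)) w by rewrite /loop dualK.
have wm' : max_of (dual (om H)) w by [].
have sub0 A : A :\ w != set0 -> A != set0.
  by case/set0Pn => e; rewrite in_setD1 => /andP[_ eA]; apply/set0Pn; exists e.
apply/setP => P; rewrite inE; apply/mem_active_parts/imsetP.
- case=> n [Pn [] eqP].
    have gE := levels_ground n s1; exists (ground (part (om H) n)); last by rewrite eqP gE.
    rewrite inE; apply/mem_active_parts; exists n; split; last by left.
    by apply: sub0; rewrite -gE -eqP.
  have gE := levels_ground n s2; exists (ground (part (dual (om H)) n)); last by rewrite eqP gE.
  rewrite inE; apply/mem_active_parts; exists n; split; last by right.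
  by apply: sub0; rewrite -gE -eqP.
- case=> Q; rewrite inE => /mem_active_parts[n [Qn [] eqQ]] ->.
    exists n; rewrite eqQ (levels_ground n s1); split; last by left.
    by apply: nonempty => //; rewrite -eqQ.
  exists n; rewrite eqQ (levels_ground n s2); split; last by right.
  by apply: nonempty => //; rewrite -eqQ.
Qed.

(** The part containing e starts at the highest level that contains e, which is the
    smallest rank in that part. *)
Lemma lvl_parts H M n e : M = om H \/ M = dual (om H) ->
  (e \in lvl M n) = (e \notin lvl (dual M) 0) &&
  [exists P in [set P in active_parts H], (e \in P) && [forall f in P, (n <= rk f)%N]].
Proof.
move=> HM; apply/idP/andP => [eU|[e0 /existsP[P /andP[]]]].
  split; first by apply/in_lvl; move/in_lvl: eU; exact: pos_excl.
  have ex : exists m, e \in lvl M m by exists n.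
  have [|m mU mm] := @ex_maxnP (fun m => e \in lvl M m) (rk e) ex.
    by move=> k /in_lvl/pos_rk.
  have gm : e \in ground (part M m).
    by rewrite in_part mU; apply/negP => /mm; rewrite ltnn.
  apply/existsP; exists (ground (part M m)); rewrite inE gm; apply/andP; split.
    apply/mem_active_parts; exists m; split; first by apply/set0Pn; exists e.
    by case: HM => ->; [left|right].
  apply/forallP => f; apply/implyP; rewrite in_part => /andP[/in_lvl/pos_rk + _].
  exact: leq_trans (mm n eU).
have own N m : e \in ground (part N m) -> e \in lvl N 0.
  by rewrite in_part => /andP[+ _]; apply: (subsetP (lvl_anti _ (leq0n m))).
rewrite inE => /mem_active_parts[m [_ eqP]] /andP[eP /forallP Pn].
have {}eqP : P = ground (part M m).
  case: eqP HM => eqP [] HM; rewrite HM -?eqP // eqP in eP e0 *;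
    by rewrite ?dualK (own _ _ eP) in e0.
rewrite eqP in eP Pn; have [p [pm _] rp] := part_inhabited eP.
have := Pn p; rewrite pm rp => nm.
by apply: (subsetP (lvl_anti _ nm)); move: eP; rewrite in_part => /andP[].
Qed.

(** Conversely to [partition_profile], the active partition determines all levels. *)
Lemma partition_lvl H K : active_partition H = active_partition K ->
  forall n, lvl (om H) n = lvl (om K) n /\ lvl (dual (om H)) n = lvl (dual (om K)) n.
Proof.
case=> e1 e2; rewrite !cyclic_flatE in e2.
have eqD n : lvl (dual (om H)) n = lvl (dual (om K)) n.
  apply/setP => e; rewrite (@lvl_parts H _ n e (or_intror erefl)).
  by rewrite (@lvl_parts K _ n e (or_intror erefl)) e1 !dualK e2.
move=> n; split=> //; apply/setP => e; rewrite (@lvl_parts H _ n e (or_introl erefl)).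
by rewrite (@lvl_parts K _ n e (or_introl erefl)) e1 eqD.
Qed.

Lemma isthmusP G w : is_isthmus G w <-> isthmus (om G) w.
Proof.
split=> [/cocycleP[[X eqD _] _]|[t tt [tw t0]]].
  exists (cutv G X); first exact: tension_cutv.
  split=> [|f fw]; first by rewrite cutv_neq0 -eqD inE.
  by apply/eqP; apply: contraNT fw; rewrite cutv_neq0 -eqD inE.
have [D cD Dt] := cocycle_of_tension tt tw.
rewrite /is_isthmus; suff -> : [set w] = D by [].
have sD f : f \in D -> f = w.
  by move/Dt => tf; apply/eqP; apply: contraNT tf => /t0 ->.
have [[X _ /set0Pn[f fD]] _] := cocycleP cD.
apply/setP => g; rewrite inE; apply/eqP/idP => [->|/sD //].
by rewrite -(sD f fD).
Qed.

Lemma loopP G w : is_loop G w <-> loop (om G) w.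
Proof.
split=> [/andP[wG /eqP sw]|[y [y0 yb] [yw yf]]].
  exists (unit_vec w 1) => /=; last first.
    by split=> [|f fw]; rewrite /unit_vec ?eqxx ?oner_eq0 // (negbTE fw).
  split=> [e eG|v]; last by rewrite excess_unit sw subrr mulr0.
  by rewrite /unit_vec; case: eqVneq => // ew; rewrite ew wG in eG.
apply/andP; split; first by apply: contraNT yw => /y0 ->.
have := yb (tgt G w); rewrite /excess (bigD1 w) //= big1 ?addr0; last first.
  by move=> f /yf ->; rewrite mul0r.
move/eqP; rewrite mulf_eq0 (negbTE yw) eqxx /=.
by case: (src G w == tgt G w).
Qed.

(** If T avoids w it equals T', by uniqueness in the deletion; if T' satisfies the condition at
    w it equals T, by uniqueness in N. *)
Lemma opp_min_choice N p w T T' : max_of N w -> p != w -> p \in ground N ->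
  ~ isthmus N w -> FO N p T -> FO (del N [set w]) p T' ->
  (p \in T) = (p \in T') -> opp_min N T' w <-> w \notin T.
Proof.
move=> wm pw gp ni FT FT' pT; have bT' : basis N T' by apply: basis_delE ni _; case: FT'.
have wT' : w \notin T' by case: FT' => -[/=]; rewrite subsetD1 => /andP[].
split=> [o|wT].
  have FT2 : FO N p T' by apply: FO_delE FT'.
  by rewrite (FO_uniq gp FT FT2 pT).
have FT2 := FO_del wm wT FT; have gp' : p \in ground (del N [set w]) by rewrite in_del1 pw.
have eqT := FO_uniq gp' FT2 FT' pT; rewrite -eqT.
by case: FT => _ + _; apply=> //; [exact: wm.1|rewrite eq_sym].
Qed.

Lemma active_part_del M w n p A : same_levels w M (del M [set w]) ->
  max_of M w -> w \in ground (part M n) -> min_of (part M n) p -> p != w ->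
  active_basis (del M [set w]) A ->
  FO (del (part M n) [set w]) p (A :&: ground (part M n)) /\ p \notin A.
Proof.
move=> sl wm wn pm pw [sA F1 _]; have := F1 n p; rewrite part_del_in // => H.
have [] := H (del_min pw pm); rewrite /= => FA pA; split=> //.
suff -> : A :&: ground (part M n) = A :&: (ground (part M n) :\ w) by [].
apply/setP => e; rewrite !in_setI in_setD1; case: eqVneq => //= ->.
by move: sA; rewrite /= subsetD1 => /andP[_ /negbTE ->].
Qed.

Lemma active_part_con M w n p A : same_levels w M (con M [set w]) ->
  max_of M w -> w \in ground (part M n) -> min_of (part M n) p -> p != w ->
  active_basis (con M [set w]) A ->
  FO (con (part M n) [set w]) p (A :&: ground (part M n)) /\ p \notin A.
Proof.
move=> sl wm wn pm pw [sA F1 _]; have := F1 n p; rewrite part_con_in // => H.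
have [] := H (@del_min _ _ (dual (part M n)) w p pw pm); rewrite /= => FA pA; split=> //.
suff -> : A :&: ground (part M n) = A :&: (ground (part M n) :\ w) by [].
apply/setP => e; rewrite !in_setI in_setD1; case: eqVneq => //= ->.
by move: sA; rewrite /= subsetD1 => /andP[_ /negbTE ->].
Qed.

Lemma FO_active_basis N p T : min_of N p -> FO N p T -> active_basis N T.
Proof.
move=> pm FT; have [pT|pT] := boolP (p \in T).
  exact: cbip_dual_active_basis pm (FO_cbip_dual pT FT) FT pT.
exact: cbip_active_basis pm (FO_cbip pm.1 pT FT) FT pT.
Qed.

(** The situation in which the choice by full optimality is made: N is an active minor with
    both minors at w still bipolar or cyclic-bipolar, T, T' and T'' are the fully optimal trees
    of N, of the deletion and of the contraction. *)
Definition focus N w p T T' T'' : Prop :=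
  [/\ max_of N w, min_of N p, p != w, ~ isthmus N w /\ ~ loop N w &
    [/\ FO N p T, FO (del N [set w]) p T' /\ (p \in T) = (p \in T')
      & FO (con N [set w]) p T'' /\ (p \in T) = (p \in T'')]].

Lemma focus_dual N w p T T' T'' : focus N w p T T' T'' ->
  focus (dual N) w p (ground N :\: T) ((ground N :\ w) :\: T'') ((ground N :\ w) :\: T').
Proof.
case=> wm pm pw [ni nl] [FT [F1 e1] [F2 e2]]; have gp := pm.1.
split=> //; split; first exact: FO_dual.
  by split; [rewrite -dual_con; exact: FO_dual F2|rewrite !inE gp pw e2].
by split; [rewrite -dual_del; exact: FO_dual F1|rewrite !inE gp pw e1].
Qed.

Lemma focus_part M w n A A' A'' : max_of M w -> ~ isthmus M w -> ~ loop M w ->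
  same_profile w M (del M [set w]) -> same_profile w M (con M [set w]) ->
  active_basis M A -> active_basis (del M [set w]) A' ->
  active_basis (con M [set w]) A'' -> w \in ground (part M n) ->
  exists p, focus (part M n) w p (A :&: ground (part M n)) (A' :&: ground (part M n))
    (A'' :&: ground (part M n)).
Proof.
move=> wm ni nl [d1 _] [c1 _] [sA FA _] aD aC wn.
have [p pm _] := part_inhabited wn; have pw := min_part_neq nl wm wn pm.
have [FT pT] := FA n p pm; have cb := part_cbip pm.
have [FD pD] := active_part_del d1 wm wn pm pw aD.
have [FC pC] := active_part_con c1 wm wn pm pw aC.
exists p; split=> //; first exact: part_max.
  by split; [exact: cbip_not_isthmus wn cb|exact: cbip_not_loop pw cb].
by split=> //; split=> //; rewrite !in_setI (negbTE pT) ?(negbTE pD) ?(negbTE pC).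
Qed.

Lemma setDI_dual S S' A : S \subset S' -> S :\: ((S' :\: A) :&: S) = A :&: S.
Proof.
move=> /subsetP sS; apply/setP => e; rewrite !inE; have := sS e.
by case: (e \in S) => [->|_] //=; rewrite ?andbF // !andbT negbK.
Qed.

Lemma setDI_dual1 S S' A w : S \subset S' -> w \notin A ->
  (S :\ w) :\: ((S' :\ w :\: A) :&: S) = A :&: S.
Proof.
move=> sS wA; apply/setP => e; have /implyP := subsetP sS e; rewrite !inE.
have [->|ew] /= := eqVneq e w; first by rewrite andbF (negbTE wA).
by case: (e \in A); case: (e \in S); case: (e \in S').
Qed.

Lemma focus_part_dual M w n A A' A'' : max_of M w -> ~ isthmus M w -> ~ loop M w ->
  same_profile w M (del M [set w]) -> same_profile w M (con M [set w]) ->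
  active_basis M A -> active_basis (del M [set w]) A' ->
  active_basis (con M [set w]) A'' -> w \in ground (part (dual M) n) ->
  exists p, focus (dual (part (dual M) n)) w p (A :&: ground (part (dual M) n))
    (A' :&: ground (part (dual M) n)) (A'' :&: ground (part (dual M) n)).
Proof.
move=> wm ni nl sD sC aA aD aC wn; set N := part (dual M) n in wn *.
have sub : ground N \subset ground M by apply/subsetP => e; exact: (@part_ground _ _ (dual M)).
have d1 : same_profile w (dual M) (del (dual M) [set w]).
  by rewrite -dual_con; exact: same_profile_dual.
have d2 : same_profile w (dual M) (con (dual M) [set w]).
  by rewrite -dual_del; exact: same_profile_dual.
have ni' : ~ loop (dual M) w by rewrite /loop dualK.
have aD' := active_basis_dual aC; rewrite dual_con in aD'.
have aC' := active_basis_dual aD; rewrite dual_del in aC'.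
have [p] := @focus_part (dual M) w n _ _ _ wm nl ni' d1 d2 (active_basis_dual aA) aD' aC' wn.
move=> /focus_dual H; exists p; move: H; rewrite -/N setDI_dual //.
have wA' : w \notin A' by case: aD; rewrite subsetD1 => /andP[].
have wA'' : w \notin A'' by case: aC; rewrite subsetD1 => /andP[].
by rewrite !setDI_dual1.
Qed.

Lemma alpha_minor_focus G w p T T' T'' : focus (om G) w p T T' T'' ->
  alpha (minor Deletion G w) = T' /\ alpha (minor Contraction G w) = T''.
Proof.
case=> wm pm pw _ [_ [FD _] [FC _]]; split; apply: alpha_uniq.
  by rewrite om_del1; apply: FO_active_basis FD; exact: del_min.
by rewrite om_con1; apply: FO_active_basis FC; exact: (@del_min _ _ (dual (om G))).
Qed.

Lemma active_minor_at_in H w : w \in edges H ->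
  List.In (active_minor_at H w) (active_minors H) /\ w \in edges (active_minor_at H w).
Proof.
move=> wH; suff [m mH wm] : exists2 m, List.In m (active_minors H) & w \in edges m.
  exact: (@In_head_filter _ H (fun M : digraph V E => w \in edges M) _ m).
have [[n wn]|[n wn]] := @level_total _ _ (om H) w wH.
  have [m mH eqm] := @active_minor_part false H n w wn; exists m => //.
  by rewrite -[edges m]/(ground (om m)) eqm.
have [m mH eqm] := @active_minor_part true H n w wn; exists m => //.
by rewrite -[edges m]/(ground (om m)) eqm.
Qed.

Lemma focus_active_minor H w : max_of (om H) w -> ~ isthmus (om H) w -> ~ loop (om H) w ->
  same_profile w (om H) (del (om H) [set w]) ->
  same_profile w (om H) (con (om H) [set w]) ->
  let m := active_minor_at H w in
  exists p, focus (om m) w p (alpha H :&: edges m)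
    (alpha (minor Deletion H w) :&: edges m) (alpha (minor Contraction H w) :&: edges m).
Proof.
move=> wm ni nl sD sC m; have [mH wM] := active_minor_at_in wm.1.
have aD : active_basis (del (om H) [set w]) (alpha (minor Deletion H w)).
  by rewrite -om_del1; exact: alpha_active_basis.
have aC : active_basis (con (om H) [set w]) (alpha (minor Contraction H w)).
  by rewrite -om_con1; exact: alpha_active_basis.
have aH := alpha_active_basis H.
rewrite -/m in mH wM; rewrite -[edges m]/(ground (om m)) in wM *.
have [[] [n [_ eqm]]] := active_minorsP mH; rewrite eqm /dual_if in wM *.
  exact: focus_part_dual.
exact: focus_part.
Qed.

Lemma focus_choice N w p T T' T'' : focus N w p T T' T'' ->
  [/\ basis N T' /\ w \notin T', basis N (w |: T'') /\ w \notin T'',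
      opp_min N T' w <-> w \notin T &
      opp_min (dual N) (ground N :\: (w |: T'')) w <-> w \in T].
Proof.
move=> fN; have half N' S S' S'' : focus N' w p S S' S'' ->
    [/\ basis N' S', w \notin S' & opp_min N' S' w <-> w \notin S].
  case=> wm pm pw [ni nl] [FT [FD eD] _].
  split; [apply: basis_delE ni _; by case: FD| |exact: (opp_min_choice wm pw pm.1 ni FT FD eD)].
  by case: FD => -[/=]; rewrite subsetD1 => /andP[].
have [b1 w1 o1] := half _ _ _ _ fN.
have [b2 w2 o2] := half _ _ _ _ (focus_dual fN).
have [wm _ _ _ [FT _ [[[sT'' _ _] _ _] _]]] := fN.
have eqS : (ground N :\ w) :\: T'' = ground N :\: (w |: T'') by rewrite setDDl.
have w3 : w \notin T'' by move: sT''; rewrite subsetD1 => /andP[].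
rewrite eqS in b2 o2; split=> //.
  split=> //; apply: basis_dualE => //; rewrite subUset sub1set wm.1.
  by move: sT''; rewrite subsetD1 => /andP[].
by rewrite o2 inE wm.1 andbT negbK.
Qed.

Definition choice_of (b : bool) : minor_op := if b then Contraction else Deletion.

Lemma optimality_choiceP cr H w op : max_of (om H) w -> ~ isthmus (om H) w ->
  ~ loop (om H) w ->
  same_profile w (om H) (del (om H) [set w]) ->
  same_profile w (om H) (con (om H) [set w]) ->
  optimality_choice cr (@alpha V d E) (active_minor_at H w) w op
  <-> op = choice_of (w \in alpha H).
Proof.
move=> wm ni nl sD sC; have [p] := focus_active_minor wm ni nl sD sC.
set m := active_minor_at H w => fm.
have [_ wM] := active_minor_at_in wm.1.
have [eD eC] := alpha_minor_focus fm; have [[b1 w1] [b2 w2] o1 o2] := focus_choice fm.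
rewrite /optimality_choice eD eC; rewrite !inE wM andbT in o1 o2.
have [_ c1 c2] := fund_cycle_opp b1 wM w1.
have [_ d1 d2] := fund_cocycle_opp b2 (setU11 w _).
rewrite /= in c1 c2 d1 d2.
case: cr; case: op; rewrite /choice_of.
- rewrite c1 o1; by case: (w \in alpha H).
- rewrite c2 o1; by case: (w \in alpha H); split.
- rewrite d2 o2; by case: (w \in alpha H); split.
- rewrite d1 o2; by case: (w \in alpha H).
Qed.

Lemma profile_alpha H w : max_of (om H) w -> ~ isthmus (om H) w -> ~ loop (om H) w ->
  let op := choice_of (w \in alpha H) in same_profile w (om H) (om (minor op H w)).
Proof.
move=> wm ni nl; have aH := alpha_active_basis H.
case: (boolP (w \in alpha H)) => wa /=.
  rewrite -/(minor Contraction H w) om_con1.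
  exact: active_basis_profile_con aH wa.
rewrite -/(minor Deletion H w) om_del1; exact: active_basis_profile aH wa.
Qed.

Lemma same_minor_partition_profile H w : max_of (om H) w -> ~ isthmus (om H) w ->
  ~ loop (om H) w -> same_minor_partition H w ->
  same_profile w (om H) (del (om H) [set w]) /\
  same_profile w (om H) (con (om H) [set w]).
Proof.
move=> wm ni nl /eqP eqP; have := profile_alpha wm ni nl.
rewrite -om_del1 -om_con1; case: (w \in alpha H) => -[s1 s2]; split; split=> // n.
- by have [<- _] := partition_lvl eqP n.
- by have [_ <-] := partition_lvl eqP n.
- by have [-> _] := partition_lvl eqP n.
- by have [_ ->] := partition_lvl eqP n.
Qed.

(** If the two minors have different active partitions, only one agrees with that of H, and by
    [profile_alpha] it is the minor indicated by the active spanning tree. *)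
Theorem H0_choiceP cr H w op : max_of (om H) w -> ~ isthmus (om H) w -> ~ loop (om H) w ->
  H0_choice cr (@alpha V d E) H w op <-> op = choice_of (w \in alpha H).
Proof.
move=> wm ni nl; rewrite /H0_choice; case: ifPn => [same|diff].
  have [sD sC] := same_minor_partition_profile wm ni nl same.
  exact: optimality_choiceP.
have := partition_profile wm ni nl (profile_alpha wm ni nl).
set op0 := choice_of _ => e0; split=> [/eqP e1|->]; last by rewrite e0.
have : active_partition (minor op H w) = active_partition (minor op0 H w) by rewrite e1.
rewrite /same_minor_partition in diff; move=> e2.
by case: op op0 e1 e2 e0 => -[] // _ e2 _; rewrite e2 eqxx in diff.
Qed.

End Graphs.

Local Close Scope ring_scope.

(** * The refined active bijection *)

Section Refined.

Context (V : finType) (d : Order.disp_t) (E : finOrderType d).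
Implicit Types (G H K : digraph V E) (A B C D W F T S : {set E}).
Implicit Types (a b e f g p w : E) (n k : nat).
Implicit Types (M N : omat E).

Lemma flip_del A M w : flip (A :\ w) (del M [set w]) = del (flip A M) [set w].
Proof.
apply: omat_eq => //= y.
have H : (forall e, e \in [set w] -> y e = 0%R) -> flipv (A :\ w) y = flipv A y.
  move=> y0; apply/funext => e; rewrite /flipv in_setD1.
  by case: eqVneq => //= ->; rewrite y0 ?inE // GRing.oppr0 if_same.
split=> -[cy y0].
  have y0' e : e \in [set w] -> y e = 0%R.
    by move=> /y0 /eqP; rewrite flipv_eq0 => /eqP.
  by split=> //; rewrite -H.
split; first by rewrite H.
by move=> e /y0 ye; apply/eqP; rewrite flipv_eq0 ye.
Qed.

Lemma flip_con A M w : flip (A :\ w) (con M [set w]) = con (flip A M) [set w].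
Proof. by rewrite /con dual_flip -flip_del dual_flip. Qed.

Lemma om_reorient_minor op G w A :
  om (reorient (A :\ w) (minor op G w)) = om (minor op (reorient A G) w).
Proof.
rewrite om_reorient; case: op.
  by rewrite !om_del1 om_reorient flip_del.
by rewrite !om_con1 om_reorient flip_con.
Qed.

Lemma om_symdiff G A w : om (reorient (symdiff A [set w]) G) = flip [set w] (om (reorient A G)).
Proof.
rewrite !om_reorient; apply: omat_eq => //= y; rewrite flipv_symdiff.
suff -> : symdiff A [set w] = symdiff [set w] A by [].
by rewrite /symdiff setUC.
Qed.

Lemma symdiffD1 A w : symdiff A [set w] :\ w = A :\ w.
Proof.
by apply/setP => e; rewrite !inE; case: (e == w); case: (e \in A).
Qed.

(** Away from w the refined map is computed from the levels and the active spanning tree,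
    which the minor at w shares with the reoriented digraph. *)
Lemma alpha_ref_off op G w A : let K := reorient A G in
  same_profile w (om K) (om (minor op K w)) ->
  alpha (minor op K w) = alpha K :\ w ->
  alpha_ref G A :\ w = alpha_ref (minor op G w) (A :\ w).
Proof.
move=> K sp eqa; set K' := reorient (A :\ w) (minor op G w).
have omK : om K' = om (minor op K w) by exact: om_reorient_minor.
have aK : alpha K' = alpha K :\ w.
  by rewrite -eqa; apply: alpha_uniq; rewrite omK; exact: alpha_active_basis.
have [s1 s2] := sp; rewrite -omK in s1 s2.
apply/setP => e; rewrite /alpha_ref -/K -/K' aK.
rewrite !(in_setD1, in_setU, in_setI, in_setD) !in_active !in_dual_active s1 s2 !in_setD1.
by case: (e == w) => //=; rewrite ?andbF.
Qed.

Lemma alpha_refE op G w A (b : bool) : let K := reorient A G in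
  same_profile w (om K) (om (minor op K w)) ->
  alpha (minor op K w) = alpha K :\ w -> (w \in alpha_ref G A) = b ->
  alpha_ref G A = if b then w |: alpha_ref (minor op G w) (A :\ w)
                  else alpha_ref (minor op G w) (A :\ w).
Proof.
move=> K sp eqa <-; rewrite -(alpha_ref_off sp eqa).
have [wr|wr] := boolP (w \in alpha_ref G A); first by rewrite setD1K.
apply/setP => e; rewrite in_setD1; case: eqVneq => // ->; exact/negbTE.
Qed.

Lemma in_alpha_ref w G A : let K := reorient A G in (w \in alpha_ref G A) =
  (w \in alpha K) && ~~ ((w \in A) && (w \in dual_active K)) || (w \in A) && (w \in active K).
Proof. by move=> K; rewrite /alpha_ref -/K !inE [in LHS]andbC. Qed.

Lemma notin_active M w : max_of M w -> ~ loop M w -> w \notin lvl M (rk w).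
Proof.
move=> wm nl; apply/negP => wU; apply: nl.
have gw : w \in ground (part M (rk w)).
  by rewrite in_part wU; apply/in_lvl => /pos_rk; rewrite ltnn.
have [//|nl] := pselect (loop M w).
have [p pm rp] := part_inhabited gw.
by have := min_part_neq nl wm gw pm; rewrite (rk_inj rp) eqxx.
Qed.

Lemma loop_active M w : loop M w -> w \in lvl M (rk w).
Proof.
move=> /loop_vec[y [cy yw y0]]; apply/in_lvl; exists y; split=> //; last by rewrite yw.
  by move=> f; case: (eqVneq f w) => [->|/y0 ->//]; rewrite yw.
by move=> f; case: (eqVneq f w) => [->//|/y0 ->]; rewrite eqxx.
Qed.

Lemma loop_not_dual_active M w : loop M w -> w \notin lvl (dual M) (rk w).
Proof.
move=> lw; apply/in_lvl => p; have /in_lvl p' := loop_active lw; exact: pos_excl p' p.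
Qed.

Section Rules.
Variables (G : digraph V E) (w : E) (A : {set E}).
Hypothesis wm : max_of (om G) w.
Let K := reorient A G.

Lemma reorient_max : max_of (om K) w.
Proof. by rewrite om_reorient. Qed.

Lemma alpha_ref_choice : ~ isthmus (om G) w -> ~ loop (om G) w ->
  let op := choice_of (w \in alpha K) in
  alpha_ref G A = if w \in alpha K then w |: alpha_ref (minor op G w) (A :\ w)
                  else alpha_ref (minor op G w) (A :\ w).
Proof.
move=> ni nl op; have wm' := reorient_max.
have ni' : ~ isthmus (om K) w by rewrite om_reorient isthmus_flip.
have nl' : ~ loop (om K) w by rewrite om_reorient loop_flip.
have sp := profile_alpha wm' ni' nl'; rewrite -/op in sp.
have aK := alpha_active_basis K.
apply: alpha_refE => //; last first.
  rewrite in_alpha_ref in_active in_dual_active -/K.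
  rewrite (negbTE (notin_active wm' nl')) (negbTE (@notin_active (dual (om K)) w wm' _)) //.
  by rewrite !andbF orbF andbT.
apply: alpha_uniq; rewrite /op; case: (boolP (w \in alpha K)) => wa /=.
  rewrite -/(minor Contraction K w) om_con1; apply: active_basis_con => //.
  exact: active_basis_profile_con aK wa.
rewrite -/(minor Deletion K w) om_del1.
have -> : alpha K :\ w = alpha K.
  apply/setP => e; rewrite in_setD1; case: eqVneq => // ->; exact/esym/negbTE.
apply: active_basis_del => //; exact: active_basis_profile aK wa.
Qed.

Lemma alpha_ref_loop op : loop (om G) w ->
  alpha_ref G A = if w \in A then w |: alpha_ref (minor op G w) (A :\ w)
                  else alpha_ref (minor op G w) (A :\ w).
Proof.
move=> lw; have wm' := reorient_max.
have lK : loop (om K) w by rewrite om_reorient loop_flip.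
have eqm : om (minor op K w) = del (om K) [set w].
  by case: op; rewrite ?om_del1 ?om_con1 ?loop_del_con.
have sp := loop_profile lK; rewrite -eqm in sp.
have aK := alpha_active_basis K; have wa := loop_notin_active_basis wm' lK aK.
apply: alpha_refE => //; last first.
  rewrite in_alpha_ref in_active in_dual_active -/K (negbTE wa).
  by rewrite (loop_active lK) andbT.
apply: alpha_uniq; rewrite eqm.
have -> : alpha K :\ w = alpha K.
  apply/setP => e; rewrite in_setD1; case: eqVneq => // ->; exact/esym/negbTE.
by apply: active_basis_del => //; rewrite -eqm.
Qed.

Lemma alpha_ref_isthmus op : isthmus (om G) w ->
  alpha_ref G A = if w \notin A then w |: alpha_ref (minor op G w) (A :\ w)
                  else alpha_ref (minor op G w) (A :\ w).
Proof.
move=> iw; have wm' := reorient_max.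
have iK : loop (dual (om K)) w by rewrite om_reorient /loop dualK isthmus_flip.
have aK := alpha_active_basis K.
have wa : w \in alpha K.
  have wm2 : max_of (dual (om K)) w by [].
  have := loop_notin_active_basis wm2 iK (active_basis_dual aK).
  by rewrite inE wm'.1 andbT negbK.
have eqm : om (minor op K w) = con (om K) [set w].
  have := loop_del_con iK; rewrite -dual_con -dual_del => /(congr1 (@dual _ _)).
  by rewrite !dualK; case: op => e; rewrite ?om_del1 ?om_con1.
have sp : same_profile w (om K) (om (minor op K w)).
  have := same_profile_dual (loop_profile iK); rewrite -dual_con !dualK.
  by rewrite eqm.
apply: alpha_refE => //; last first.
  rewrite in_alpha_ref in_active in_dual_active -/K wa (loop_active iK).
  have := loop_not_dual_active iK; rewrite dualK => /negbTE ->.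
  by rewrite andbT andbF orbF.
apply: alpha_uniq; rewrite eqm; apply: active_basis_con => //.
by rewrite -eqm.
Qed.

End Rules.

Lemma reorient_set0 G : om (reorient set0 G) = om G.
Proof.
rewrite om_reorient; apply: omat_eq => //= y.
by suff -> : flipv set0 y = y by []; apply/funext => e; rewrite /flipv inE.
Qed.

Lemma alpha_ref_set0 G : alpha_ref G set0 = alpha G.
Proof.
rewrite /alpha_ref !set0I setD0 setU0; apply: alpha_uniq.
by rewrite reorient_set0; exact: alpha_active_basis.
Qed.

Lemma well_defined_choiceP H w : max_of (om H) w -> ~ isthmus (om H) w -> ~ loop (om H) w ->
  well_defined_choice H w.
Proof.
move=> wm ni nl; split.
- move=> cr; exists (choice_of (w \in alpha H)); split; first exact/H0_choiceP.
  by move=> op /(H0_choiceP _ _ wm ni nl).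
- move=> op; apply/idP/idP => /(H0_choiceP _ _ wm ni nl) ->; exact/H0_choiceP.
- move=> same m T' T''; have [sD sC] := same_minor_partition_profile wm ni nl same.
  have [p fm] := focus_active_minor wm ni nl sD sC.
  have [eD eC] := alpha_minor_focus fm.
  have [_ wM] := active_minor_at_in wm.1.
  have [[b1 w1] [b2 w2] _ _] := focus_choice fm.
  rewrite /T' /T'' /m eD eC; split=> //; split=> //; exact/spanning_treeP.
Qed.

Lemma alpha_ref_rules cr G : inductive_rules cr (@alpha V d E) (@alpha_ref V d E) G.
Proof.
split=> [G0|w /is_maxP wm A sA].
  rewrite alpha_ref_set0; apply/eqP; rewrite -subset0 -G0.
  by case: (alpha_active_basis G).
have wA : w \in w |: A by rewrite setU11.
have wA' : w \notin A :\ w by rewrite !inE eqxx.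
have DU : (w |: A) :\ w = A :\ w by apply/setP => e; rewrite !inE; case: eqVneq.
have DD : (A :\ w) :\ w = A :\ w by apply/setP => e; rewrite !inE; case: eqVneq.
split=> [/isthmusP iw|/loopP lw|ni nl op].
- rewrite (@alpha_ref_isthmus G w (w |: A) wm Deletion iw) wA DU.
  by rewrite (@alpha_ref_isthmus G w (A :\ w) wm Contraction iw) wA' DD.
- rewrite (@alpha_ref_loop G w (w |: A) wm Deletion lw) wA DU.
  by rewrite (@alpha_ref_loop G w (A :\ w) wm Contraction lw) (negbTE wA') DD.
have {}ni : ~ isthmus (om G) w by move/isthmusP; rewrite (negbTE ni).
have {}nl : ~ loop (om G) w by move/loopP; rewrite (negbTE nl).
have wmK : max_of (om (reorient A G)) w by rewrite om_reorient.
have niK : ~ isthmus (om (reorient A G)) w by rewrite om_reorient isthmus_flip.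
have nlK : ~ loop (om (reorient A G)) w by rewrite om_reorient loop_flip.
move=> /(H0_choiceP _ _ wmK niK nlK) ->.
have r1 := @alpha_ref_choice G w A wm ni nl.
have r2 := @alpha_ref_choice G w (symdiff A [set w]) wm ni nl.
have aF := alpha_active_basis (reorient (symdiff A [set w]) G).
rewrite om_symdiff in aF.
have eqw := active_basis_flip wmK niK nlK (alpha_active_basis _) aF.
rewrite symdiffD1 eqw in r2; move: r1 r2.
by case: (w \in alpha (reorient A G)) => /= r1 r2; split.
Qed.

Lemma edges_minor op G w : edges (minor op G w) = edges G :\ w.
Proof. by case: op => //=; rewrite setDE. Qed.

Lemma H0_choice_eq cr act1 act2 H w op :
  (forall op', act1 (minor op' (active_minor_at H w) w) = act2 (minor op' (active_minor_at H w) w)) ->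
  H0_choice cr act1 H w op = H0_choice cr act2 H w op.
Proof.
move=> e; rewrite /H0_choice; case: (same_minor_partition H w); last by [].
by rewrite /optimality_choice; case: cr; rewrite e.
Qed.

Lemma edges_active_minor H w : w \in edges H -> edges (active_minor_at H w) \subset edges H.
Proof.
move=> wH; have [mH _] := active_minor_at_in wH.
apply/subsetP => e; rewrite -[edges (active_minor_at H w)]/(ground (om _)).
have [r [n [_ ->]]] := active_minorsP mH.
by rewrite ground_dual_if => /part_ground; rewrite ground_dual_if.
Qed.

(** The choice of H_0 only uses the map on minors with fewer edges, where it agrees with the
    active spanning tree by induction. *)
Lemma inductive_rules_uniq cr (ref : digraph V E -> {set E} -> {set E}) :
  (forall G, inductive_rules cr (fun H => ref H set0) ref G) ->
  forall G A, A \subset edges G -> ref G A = alpha_ref G A.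
Proof.
move=> rules G; have [n] := ubnP #|edges G|; elim: n G => // n IH G.
rewrite ltnS => len A sA; have [R0 R1] := rules G; have [Q0 Q1] := alpha_ref_rules cr G.
have [G0|[e eG]] := set_0Vmem (edges G).
  move: sA; rewrite G0 subset0 => /eqP ->; by rewrite R0 // Q0.
have [w wm] := @max_of_exists _ _ (om G) e eG.
have wM : is_max (edges G) w by exact/is_maxP.
have wG := wm.1; have small op H : edges H \subset edges G -> (#|edges (minor op H w)| < n)%N.
  move=> sH; rewrite edges_minor; apply: leq_trans len.
  apply: (@leq_ltn_trans #|edges G :\ w|); first by apply: subset_leq_card; exact: setSD.
  by rewrite [X in (_ < X)%N](cardsD1 w) wG.
have IHm op : ref (minor op G w) (A :\ w) = alpha_ref (minor op G w) (A :\ w).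
  by apply: IH; [exact: small|rewrite edges_minor; exact: setSD].
have [Ri Rl Rc] := R1 w wM A sA; have [Qi Ql Qc] := Q1 w wM A sA.
(* the rules give the image of A in one of two ways, according to whether w is in A *)
have eA : A = if w \in A then w |: A else A :\ w.
  case: ifPn => wA; first by apply/esym/setUidPr; rewrite sub1set.
  by apply/setP => f; rewrite in_setD1; case: eqVneq => // ->; exact/negbTE.
have [iw|ni] := boolP (is_isthmus G w).
  have [r1 r2] := Ri iw; have [q1 q2] := Qi iw.
  by rewrite eA; case: ifP => _; rewrite ?r1 ?r2 ?q1 ?q2 IHm.
have [lw|nl] := boolP (is_loop G w).
  have [r1 r2] := Rl lw; have [q1 q2] := Ql lw.
  by rewrite eA; case: ifP => _; rewrite ?r1 ?r2 ?q1 ?q2 IHm.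
set K := reorient A G.
have ni' : ~ isthmus (om G) w by move/isthmusP; rewrite (negbTE ni).
have nl' : ~ loop (om G) w by move/loopP; rewrite (negbTE nl).
have wmK : max_of (om K) w by rewrite om_reorient.
have niK : ~ isthmus (om K) w by rewrite om_reorient isthmus_flip.
have nlK : ~ loop (om K) w by rewrite om_reorient loop_flip.
have cq : H0_choice cr (@alpha V d E) K w (choice_of (w \in alpha K)).
  exact/(H0_choiceP _ _ wmK niK nlK).
have cr' : H0_choice cr (fun H => ref H set0) K w (choice_of (w \in alpha K)).
  rewrite (@H0_choice_eq _ _ (@alpha V d E)) // => op.
  rewrite -alpha_ref_set0; apply: IH; last exact: sub0set.
  by apply: small; exact: (@edges_active_minor K w wG).
have := Rc ni nl _ cr'; have := Qc ni nl _ cq.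
by case: (w \in alpha K) => -[q1 _] [r1 _]; rewrite r1 q1 IHm.
Qed.

End Refined.

Theorem theorem6p13 (V : finType) (d : Order.disp_t) (E : finOrderType d) :
  (* the choice of H_0 is well defined *)
  (forall (G : digraph V E) (w : E) (A : {set E}),
     is_max (edges G) w -> ~~ is_isthmus G w -> ~~ is_loop G w ->
     A \subset edges G -> well_defined_choice (reorient A G) w)
  (* the refined active bijection satisfies the inductive rules *)
  /\ (forall (cr : criterion) (G : digraph V E),
        inductive_rules cr (@alpha V d E) (@alpha_ref V d E) G)
  (* and is computed by them, the active spanning tree of H being the image
     of the empty set with respect to H *)
  /\ (forall (cr : criterion) (ref : digraph V E -> {set E} -> {set E}),
        (forall G : digraph V E,
           inductive_rules cr (fun H : digraph V E => ref H set0) ref G) ->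
        forall (G : digraph V E) (A : {set E}),
          A \subset edges G -> ref G A = alpha_ref G A).
Proof.
split; last split.
- move=> G w A /is_maxP wm ni nl _; apply: well_defined_choiceP.
  + by rewrite om_reorient.
  + by rewrite om_reorient isthmus_flip => /isthmusP; rewrite (negbTE ni).
  + by rewrite om_reorient loop_flip => /loopP; rewrite (negbTE nl).
- exact: alpha_ref_rules.
- exact: inductive_rules_uniq.
Qed.
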